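(* Let $\Psi$ be a bounded set of nonnegative matrices that define operators on $l^2(R)$ and let $r\in\{\rho,\hat\rho\}$. Let $\alpha,\beta$ be nonnegative numbers with $\alpha+\beta\ge1$, and let $r_n=r\big(S_{\alpha,\beta}(\Psi^{2^n})\big)^{2^{-n}}$ for $n\in\mathbb N\cup\{0\}$. Then $$r(S_{\alpha,\beta}(\Psi))=r_0\le r_1\le\cdots\le r_n\le r(\Psi)^{\alpha+\beta}.$$
   Context: $R$ is $\{1,\dots,N\}$ for some $N\in\mathbb N$ or $R=\mathbb N$. A nonnegative matrix $A=[a_{ij}]_{i,j\in R}$ defines an operator on $l^2(R)$ if $Ax\in l^2(R)$ for all $x\in l^2(R)$, where $(Ax)_i=\sum_j a_{ij}x_j$. $A^*$ is the transpose (adjoint) and Hadamard powers/products are entrywise: $(A^{(\alpha)}\circ B^{(\beta)})_{ij}=a_{ij}^{\alpha}b_{ij}^{\beta}$. For a bounded set $\Psi$: $\Psi^*=\{A^*:A\in\Psi\}$, $S_{\alpha,\beta}(\Psi)=\Psi^{(\alpha)}\circ(\Psi^* )^{(\beta)}=\{A^{(\alpha)}\circ(B^* )^{(\beta)}:A,B\in\Psi\}$ (a bounded set of nonnegative matrices defining operators on $l^2(R)$ when $\alpha+\beta\ge1$), $\Psi^k=\{A_1\cdots A_k:A_i\in\Psi\}$. For a bounded set $\Sigma$ of bounded operators: $\rho(\Sigma)=\limsup_k[\sup_{A\in\Sigma^k}\rho(A)]^{1/k}$ and $\hat\rho(\Sigma)=\lim_k[\sup_{A\in\Sigma^k}\|A\|]^{1/k}$.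 *)

(* Defs.v *)
From Stdlib Require Import Reals.
From Coquelicot Require Import Coquelicot.
Open Scope R_scope.

(** Index set R of the paper: [None] = N (all naturals), [Some n] = {0,...,n-1}
    (0-based version of {1,...,n}); the theorem assumes n >= 1. *)
Definition idx := option nat.
Definition inI (I : idx) (i : nat) : bool :=
  match I with None => true | Some n => Nat.ltb i n end.

(** Matrices indexed by I x I, represented as functions (entries outside I are ignored). *)
Definition mat := nat -> nat -> R.
Definition matset := mat -> Prop.

Definition l2 (I : idx) (x : nat -> R) : Prop :=
  (forall i, inI I i = false -> x i = 0) /\ ex_series (fun i => (x i) ^ 2).

Definition l2norm (x : nat -> R) : R := sqrt (Series (fun i => (x i) ^ 2)).

Definition mrow (I : idx) (a : mat) (x : nat -> R) (i : nat) : nat -> R :=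
  fun j => if inI I j then a i j * x j else 0.
Definition matapp (I : idx) (a : mat) (x : nat -> R) : nat -> R :=
  fun i => if inI I i then Series (mrow I a x i) else 0.

Definition nonneg_mat (I : idx) (a : mat) : Prop :=
  forall i j, inI I i = true -> inI I j = true -> 0 <= a i j.

Definition defines_op (I : idx) (a : mat) : Prop :=
  forall x, l2 I x ->
    (forall i, inI I i = true -> ex_series (mrow I a x i)) /\ l2 I (matapp I a x).

Definition opnorm (I : idx) (a : mat) : R :=
  real (Lub_Rbar (fun r => exists x, l2 I x /\ l2norm x <= 1 /\ r = l2norm (matapp I a x))).

Definition l2c (I : idx) (z : nat -> C) : Prop :=
  (forall i, inI I i = false -> z i = RtoC 0) /\ ex_series (fun i => (Cmod (z i)) ^ 2).

Definition mactc (I : idx) (a : mat) (z : nat -> C) : nat -> C :=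
  fun i => (matapp I a (fun j => Re (z j)) i, matapp I a (fun j => Im (z j)) i).

(** lambda is in the spectrum of A iff A - lambda I is not bijective on l^2(I; C)
    (by the bounded inverse theorem this is the usual spectrum). *)
Definition in_spectrum (I : idx) (a : mat) (l : C) : Prop :=
  ~ ((forall z, l2c I z -> (forall i, Cminus (mactc I a z i) (Cmult l (z i)) = RtoC 0) ->
                forall i, z i = RtoC 0) /\
     (forall y, l2c I y -> exists z, l2c I z /\
                forall i, Cminus (mactc I a z i) (Cmult l (z i)) = y i)).

Definition specrad (I : idx) (a : mat) : R :=
  real (Lub_Rbar (fun r => exists l, in_spectrum I a l /\ r = Cmod l)).

Definition mmul (I : idx) (a b : mat) : mat :=
  fun i j => Series (fun k => if inI I k then a i k * b k j else 0).

(** [prodset I S n] = S^(n+1), the set of products of n+1 members of S. *)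
Fixpoint prodset (I : idx) (Sg : matset) (n : nat) : matset :=
  match n with
  | O => Sg
  | Datatypes.S n' => fun c => exists a b, Sg a /\ prodset I Sg n' b /\ c = mmul I a b
  end.

Definition mpowset (I : idx) (Sg : matset) (k : nat) : matset := prodset I Sg (Nat.pred k).

Definition hpow (x y : R) : R :=
  if Req_EM_T y 0 then 1 else if Req_EM_T x 0 then 0 else Rpower x y.

Definition rootk (x : R) (k : nat) : R := hpow x (/ INR k).

Definition Sab (alpha beta : R) (Sg : matset) : matset :=
  fun c => exists a b, Sg a /\ Sg b /\
    c = (fun i j => hpow (a i j) alpha * hpow (b j i) beta).

Definition sup_over (P : R -> Prop) : R := real (Lub_Rbar P).

Definition gsr (I : idx) (Sg : matset) : R :=
  real (LimSup_seq (fun k =>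
    rootk (sup_over (fun r => exists a, prodset I Sg k a /\ r = specrad I a)) (Datatypes.S k))).

Definition jsr (I : idx) (Sg : matset) : R :=
  real (Lim_seq (fun k =>
    rootk (sup_over (fun r => exists a, prodset I Sg k a /\ r = opnorm I a)) (Datatypes.S k))).

(* Main.v *)
Require Import Defs.
From Stdlib Require Import Reals Lra Lia FunctionalExtensionality Classical IndefiniteDescription.
From Coquelicot Require Import Coquelicot.
Open Scope R_scope.

(** The proof avoids spectral theory for general operators by working with nonnegative matrices only.
    Boundedness by [C] is a statement about finite sections, stable under transposition, entrywise
    domination and products. For [p, q] in [0,1], weighted AM-GM gives
    [p^al q^be <= (al p + be q) / (al + be)]; this yields both the norm bound
    [|A^(al) o B^(be)| <= |A|^al |B|^be] and the entrywise inequality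
    [(A1^(al) o B1^(be)) (A2^(al) o B2^(be)) <= (A1 A2)^(al) o (B1 B2)^(be)].

    The spectral radius of a nonnegative [A] is the infimum of the [s] with [|A^n| = O(s^n)].
    Above such an [s] the Neumann series inverts [A - l]. Conversely, let [g > 0] be the infimum: the
    partial sums of [sum A^k / g^k] are unbounded, so resolvents of the transpose at [t > g], [t -> g],
    produce nonnegative unit vectors [w_n] with [|A^T w_n - g w_n| <= 4^-n]; by positivity
    [y = sum 2^-n w_n] satisfies [<y, w_n> >= 2^-n], so [y] is not in the range of [A - g] and [g] is
    in the spectrum. Monotonicity and the Hadamard inequality thus pass from powers to spectral radii.

    Finally every product of [2k] members of [S(Psi^m)] is dominated by a product of [k] members of
    [S(Psi^(2m))], and every product of [k] members of [S(Psi^m)] by [A^(al) o (B^T)^(be)] with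
    [A, B] in [Psi^(mk)]. *)

(** * Finite sums and nonnegative series *)

(** The definitions set the obstacles. [opnorm] and [specrad] are suprema read through [real], which
    turns an infinite value into [0], so boundedness of each single matrix has to be derived from
    [defines_op] before its norm is meaningful. The spectrum is defined by bijectivity alone, so an
    approximate eigenvector does not yet give a spectral point: a vector outside the range has to be
    exhibited, and this is why the transpose and the weighted sum of the [w_n] enter.

    The two radii call for different arguments mainly in the doubling step, which compares products
    of even length only. For the joint spectral radius, Fekete's lemma bounds the limit by the root
    at every single length, in particular at even ones. The spectral radius is not
    submultiplicative; there a product is squared to reach an even length, with
    [rho(A)^2 <= rho(A^2)]. *)

Fixpoint fsum (f : nat -> R) (n : nat) : R :=
  match n with O => 0 | S k => fsum f k + f k end.

Lemma fsum_ext f g n : (forall i, (i < n)%nat -> f i = g i) -> fsum f n = fsum g n.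
Proof.
  induction n as [|n IH]; intros H; simpl; [reflexivity|].
  rewrite IH by (intros; apply H; lia). rewrite (H n) by lia. reflexivity.
Qed.

Lemma fsum_le f g n : (forall i, (i < n)%nat -> f i <= g i) -> fsum f n <= fsum g n.
Proof.
  induction n as [|n IH]; intros H; simpl; [lra|].
  apply Rplus_le_compat; [apply IH; intros; apply H; lia|apply H; lia].
Qed.

Lemma fsum_plus f g n : fsum (fun i => f i + g i) n = fsum f n + fsum g n.
Proof. induction n as [|n IH]; simpl; [lra|rewrite IH; lra]. Qed.

Lemma fsum_scal c f n : fsum (fun i => c * f i) n = c * fsum f n.
Proof. induction n as [|n IH]; simpl; [lra|rewrite IH; lra]. Qed.

Lemma fsum_zero n : fsum (fun _ => 0) n = 0.
Proof. induction n as [|n IH]; simpl; lra. Qed.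

Lemma fsum_const c n : fsum (fun _ => c) n = INR n * c.
Proof. induction n as [|n IH]; [simpl; lra|]. rewrite S_INR. simpl. rewrite IH. lra. Qed.

Lemma fsum_nonneg f n : (forall i, 0 <= f i) -> 0 <= fsum f n.
Proof. intros H. rewrite <- (fsum_zero n). apply fsum_le. intros; apply H. Qed.

Lemma fsum_swap (f : nat -> nat -> R) n m :
  fsum (fun i => fsum (f i) m) n = fsum (fun j => fsum (fun i => f i j) n) m.
Proof.
  induction n as [|n IH]; simpl; [symmetry; apply fsum_zero|].
  rewrite IH, <- fsum_plus. reflexivity.
Qed.

Lemma fsum_mono f n m : (forall i, 0 <= f i) -> (n <= m)%nat -> fsum f n <= fsum f m.
Proof. intros H. induction 1; simpl; [lra|]. specialize (H m). lra. Qed.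

Lemma fsum_term f n k : (forall i, 0 <= f i) -> (k < n)%nat -> f k <= fsum f n.
Proof.
  intros H L. apply Rle_trans with (fsum f (S k)).
  - simpl. pose proof (fsum_nonneg f k H). lra.
  - apply fsum_mono; [exact H|lia].
Qed.

Lemma fsum_single f n k : (k < n)%nat -> (forall i, i <> k -> f i = 0) -> fsum f n = f k.
Proof.
  intros L H. induction n as [|n IH]; [lia|]. simpl.
  destruct (Nat.eq_dec k n) as [->|E].
  - rewrite (fsum_ext f (fun _ => 0)) by (intros; apply H; lia). rewrite fsum_zero; lra.
  - rewrite IH by lia. rewrite (H n) by lia. lra.
Qed.

(** This is the cross term left over when one coordinate is added in Cauchy-Schwarz. Multiplied by
    [X], the difference of the two sides is [(X y - S x)^2 + (X Y - S^2) x^2]. *)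
Lemma cauchy_schwarz_step S X Y x y :
  0 <= X -> 0 <= Y -> S ^ 2 <= X * Y -> 2 * S * (x * y) <= X * y ^ 2 + Y * x ^ 2.
Proof.
  intros HX HY H. destruct (Req_dec X 0) as [->|NX].
  - assert (S = 0) by nra. subst. nra.
  - assert (0 < X) by lra.
    assert (0 <= X * (X * y ^ 2 - 2 * S * (x * y) + Y * x ^ 2)).
    { replace (X * (X * y ^ 2 - 2 * S * (x * y) + Y * x ^ 2)) with
        ((X * y - S * x) ^ 2 + (X * Y - S ^ 2) * x ^ 2) by ring.
      pose proof (pow2_ge_0 (X * y - S * x)). pose proof (pow2_ge_0 x). nra. }
    nra.
Qed.

Lemma cauchy_schwarz x y n :
  fsum (fun i => x i * y i) n ^ 2 <= fsum (fun i => x i ^ 2) n * fsum (fun i => y i ^ 2) n.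
Proof.
  induction n as [|n IH]; [simpl; lra|].
  change (fsum ?f (S n)) with (fsum f n + f n).
  assert (HX : 0 <= fsum (fun i => x i ^ 2) n) by (apply fsum_nonneg; intros; apply pow2_ge_0).
  assert (HY : 0 <= fsum (fun i => y i ^ 2) n) by (apply fsum_nonneg; intros; apply pow2_ge_0).
  cbv beta.
  pose proof (cauchy_schwarz_step _ _ _ (x n) (y n) HX HY IH). nra.
Qed.

Lemma cauchy_schwarz_bound x y n X Y : 0 <= X -> 0 <= Y ->
  fsum (fun i => x i ^ 2) n <= X ^ 2 -> fsum (fun i => y i ^ 2) n <= Y ^ 2 ->
  Rabs (fsum (fun i => x i * y i) n) <= X * Y.
Proof.
  intros HX HY Hx Hy. apply Rsqr_incr_0_var; [|nra].
  rewrite <- Rsqr_abs, !Rsqr_pow2.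
  eapply Rle_trans; [apply cauchy_schwarz|]. rewrite Rpow_mult_distr.
  apply Rmult_le_compat; auto; apply fsum_nonneg; intros; apply pow2_ge_0.
Qed.

Lemma fsum_sum_n f n : fsum f (S n) = sum_n f n.
Proof.
  induction n as [|n IH]; [simpl; rewrite sum_O; lra|].
  rewrite sum_Sn, <- IH. reflexivity.
Qed.

Lemma is_series_fsum f (l : R) : is_series f l <-> is_lim_seq (fsum f) l.
Proof.
  rewrite is_lim_seq_incr_1. change (is_series f l) with (is_lim_seq (sum_n f) l).
  split; apply is_lim_seq_ext; intros n; rewrite fsum_sum_n; reflexivity.
Qed.

Lemma Series_lim f : ex_series f -> is_lim_seq (fsum f) (Series f).
Proof. intros H. apply is_series_fsum, Series_correct, H. Qed.

Lemma is_lim_seq_fsum (u : nat -> nat -> R) (l : nat -> R) N :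
  (forall i, (i < N)%nat -> is_lim_seq (u i) (l i)) ->
  is_lim_seq (fun n => fsum (fun i => u i n) N) (fsum l N).
Proof.
  induction N as [|N IH]; intros H; simpl; [apply is_lim_seq_const|].
  apply is_lim_seq_plus'; [apply IH; intros; apply H; lia|apply H; lia].
Qed.

Lemma is_lim_seq_le_const (u : nat -> R) (l c : R) N :
  is_lim_seq u l -> (forall n, (N <= n)%nat -> u n <= c) -> l <= c.
Proof.
  intros Hl H. apply (is_lim_seq_le_loc u (fun _ => c) l c); auto using is_lim_seq_const.
  exists N. exact H.
Qed.

Lemma fsum_le_Series f n : (forall i, 0 <= f i) -> ex_series f -> fsum f n <= Series f.
Proof.
  intros H E.
  apply (is_lim_seq_le_loc (fun _ => fsum f n) (fsum f) (fsum f n) (Series f));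
    auto using is_lim_seq_const, Series_lim.
  exists n. intros m L. apply fsum_mono; auto.
Qed.

Lemma Series_term f k : (forall i, 0 <= f i) -> ex_series f -> f k <= Series f.
Proof.
  intros H E. apply Rle_trans with (fsum f (S k)).
  - apply fsum_term; [exact H|lia].
  - apply fsum_le_Series; auto.
Qed.

Lemma nonneg_series_bound f c : (forall i, 0 <= f i) -> (forall n, fsum f n <= c) ->
  ex_series f /\ Series f <= c.
Proof.
  intros H B.
  assert (E : ex_finite_lim_seq (fsum f)).
  { apply ex_finite_lim_seq_incr with c; [|exact B]. intros n. simpl. specialize (H n). lra. }
  destruct E as [l Hl]. assert (E : ex_series f) by (exists l; apply is_series_fsum, Hl).
  split; [exact E|].
  apply (is_lim_seq_le_const (fsum f) _ _ 0 (Series_lim f E)). auto.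
Qed.

Lemma Series_nonneg f : (forall i, 0 <= f i) -> ex_series f -> 0 <= Series f.
Proof. intros H E. apply (fsum_le_Series f 0 H E). Qed.

Lemma abs_series_ex f c : (forall n, fsum (fun i => Rabs (f i)) n <= c) ->
  ex_series (fun i => Rabs (f i)) /\ ex_series f /\ Rabs (Series f) <= Series (fun i => Rabs (f i))
  /\ Series (fun i => Rabs (f i)) <= c.
Proof.
  intros H. destruct (nonneg_series_bound (fun i => Rabs (f i)) c) as [E B]; auto.
  { intros; apply Rabs_pos. }
  repeat split; auto using ex_series_Rabs, Series_Rabs.
Qed.

Lemma abs_series_fsum_le f n : ex_series (fun i => Rabs (f i)) ->
  fsum (fun i => Rabs (f i)) n <= Series (fun i => Rabs (f i)).
Proof. intros E. apply (fsum_le_Series (fun i => Rabs (f i))); [intros; apply Rabs_pos|exact E]. Qed.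

Lemma ex_series_lin (c d : R) f g : ex_series f -> ex_series g ->
  ex_series (fun n => c * f n + d * g n) /\
  Series (fun n => c * f n + d * g n) = c * Series f + d * Series g.
Proof.
  intros Hf Hg.
  assert (is_series (fun n => c * f n + d * g n) (c * Series f + d * Series g)).
  { apply is_series_fsum.
    eapply is_lim_seq_ext with (fun n => c * fsum f n + d * fsum g n).
    { intros n. rewrite fsum_plus, !fsum_scal. reflexivity. }
    apply is_lim_seq_plus'; [apply (is_lim_seq_scal_l _ c (Series f))|
      apply (is_lim_seq_scal_l _ d (Series g))]; apply Series_lim; assumption. }
  split; [eexists; eassumption|apply is_series_unique; assumption].
Qed.

Lemma Series_fsum (f : nat -> nat -> R) N : (forall k, (k < N)%nat -> ex_series (f k)) ->
  ex_series (fun j => fsum (fun k => f k j) N) /\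
  Series (fun j => fsum (fun k => f k j) N) = fsum (fun k => Series (f k)) N.
Proof.
  intros H.
  assert (is_series (fun j => fsum (fun k => f k j) N) (fsum (fun k => Series (f k)) N)).
  { apply is_series_fsum.
    eapply is_lim_seq_ext with (fun n => fsum (fun k => fsum (f k) n) N).
    { intros n. apply fsum_swap. }
    apply (is_lim_seq_fsum (fun k => fsum (f k))). intros. apply Series_lim; auto. }
  split; [eexists; eassumption|apply is_series_unique; assumption].
Qed.

Lemma Series_le_nonneg f g : (forall n, 0 <= f n <= g n) -> ex_series g ->
  ex_series f /\ Series f <= Series g.
Proof.
  intros H E. apply nonneg_series_bound; [intros; apply H|].
  intros n. apply Rle_trans with (fsum g n).
  - apply fsum_le; intros; apply H.
  - apply fsum_le_Series; auto. intros i; destruct (H i); lra.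
Qed.

(** The uniform bound on finite rectangles makes all row and column sums converge. Finite sums are
    interchanged and the limit is taken in one index at a time. The reverse inequality is this one
    with the indices exchanged. *)
Lemma tonelli_le (f : nat -> nat -> R) K : (forall n j, 0 <= f n j) ->
  (forall N M, fsum (fun n => fsum (f n) M) N <= K) ->
  ex_series (fun n => Series (f n)) /\
  Series (fun n => Series (f n)) <= Series (fun j => Series (fun n => f n j)).
Proof.
  intros H B.
  assert (ER : forall n, ex_series (f n)).
  { intros n. apply (nonneg_series_bound _ K); [apply H|]. intros M.
    eapply Rle_trans; [|apply (B (S n) M)].
    apply (fsum_term (fun n => fsum (f n) M)); [intros; apply fsum_nonneg; apply H|lia]. }
  assert (EC : forall j, ex_series (fun n => f n j)).
  { intros j. apply (nonneg_series_bound _ K); [intros; apply H|]. intros N.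
    eapply Rle_trans; [|apply (B N (S j))].
    apply fsum_le. intros n _. apply fsum_term; [apply H|lia]. }
  assert (BC : ex_series (fun j => Series (fun n => f n j))).
  { apply (nonneg_series_bound _ K).
    { intros; apply Series_nonneg; auto. }
    intros M. apply (is_lim_seq_le_const (fun N => fsum (fun j => fsum (fun n => f n j) N) M) _ _ 0).
    - apply (is_lim_seq_fsum (fun j => fsum (fun n => f n j))). intros; apply Series_lim; auto.
    - intros N _. rewrite <- fsum_swap. apply B. }
  apply nonneg_series_bound; [intros; apply Series_nonneg; auto|].
  intros N. apply (is_lim_seq_le_const (fun M => fsum (fun n => fsum (f n) M) N) _ _ 0).
  - apply (is_lim_seq_fsum (fun n => fsum (f n))). intros; apply Series_lim; auto.
  - intros M _. rewrite fsum_swap.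
    apply Rle_trans with (fsum (fun j => Series (fun n => f n j)) M).
    + apply fsum_le. intros j _. apply (fsum_le_Series (fun n => f n j)); auto.
    + apply fsum_le_Series; auto. intros; apply Series_nonneg; auto.
Qed.

Lemma tonelli (f : nat -> nat -> R) K : (forall n j, 0 <= f n j) ->
  (forall N M, fsum (fun n => fsum (f n) M) N <= K) ->
  ex_series (fun n => Series (f n)) /\
  Series (fun n => Series (f n)) = Series (fun j => Series (fun n => f n j)).
Proof.
  intros H B. destruct (tonelli_le f K H B) as [E L].
  destruct (tonelli_le (fun j n => f n j) K) as [E' L']; auto.
  { intros N M. rewrite <- fsum_swap. apply B. }
  split; [exact E|apply Rle_antisym; assumption].
Qed.

(** Write [f = (|f| + f) - |f|] and apply Tonelli to both nonnegative parts; the coefficients [1]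
    only fit the shape of [ex_series_lin]. *)
Lemma fubini (f : nat -> nat -> R) K :
  (forall N M, fsum (fun n => fsum (fun j => Rabs (f n j)) M) N <= K) ->
  Series (fun n => Series (f n)) = Series (fun j => Series (fun n => f n j)).
Proof.
  intros B.
  assert (ER : forall n, ex_series (fun j => Rabs (f n j))).
  { intros n. apply (nonneg_series_bound _ K); [intros; apply Rabs_pos|]. intros M.
    eapply Rle_trans; [|apply (B (S n) M)].
    apply (fsum_term (fun n => fsum (fun j => Rabs (f n j)) M));
      [intros; apply fsum_nonneg; intros; apply Rabs_pos|lia]. }
  assert (EC : forall j, ex_series (fun n => Rabs (f n j))).
  { intros j. apply (nonneg_series_bound _ K); [intros; apply Rabs_pos|]. intros N.
    eapply Rle_trans; [|apply (B N (S j))].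
    apply fsum_le. intros n _. apply (fsum_term (fun j => Rabs (f n j))); [intros; apply Rabs_pos|lia]. }
  assert (P : forall n j, 0 <= 1 * Rabs (f n j) + 1 * f n j <= 2 * Rabs (f n j)).
  { intros n j. pose proof (Rle_abs (f n j)). pose proof (Rle_abs (- f n j)).
    rewrite Rabs_Ropp in *. lra. }
  destruct (tonelli (fun n j => Rabs (f n j)) K) as [E1 T1]; auto.
  { intros; apply Rabs_pos. }
  destruct (tonelli (fun j n => Rabs (f n j)) K) as [E1' _].
  { intros; apply Rabs_pos. }
  { intros N M. rewrite <- (fsum_swap (fun n j => Rabs (f n j))). apply B. }
  destruct (tonelli (fun n j => 1 * Rabs (f n j) + 1 * f n j) (2 * K)) as [E2 T2].
  { intros; apply P. }
  { intros N M. apply Rle_trans with (2 * fsum (fun n => fsum (fun j => Rabs (f n j)) M) N).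
    - rewrite <- fsum_scal. apply fsum_le; intros. rewrite <- fsum_scal. apply fsum_le; intros. apply P.
    - specialize (B N M). lra. }
  destruct (tonelli (fun j n => 1 * Rabs (f n j) + 1 * f n j) (2 * K)) as [E2' _].
  { intros; apply P. }
  { intros N M. rewrite <- (fsum_swap (fun n j => 1 * Rabs (f n j) + 1 * f n j)).
    apply Rle_trans with (2 * fsum (fun n => fsum (fun j => Rabs (f n j)) N) M).
    - rewrite <- fsum_scal. apply fsum_le; intros. rewrite <- fsum_scal. apply fsum_le; intros. apply P.
    - specialize (B M N). lra. }
  assert (D : forall g, ex_series (fun i => Rabs (g i)) ->
     Series g = 1 * Series (fun i => 1 * Rabs (g i) + 1 * g i) + (-1) * Series (fun i => Rabs (g i))).
  { intros g Eg. destruct (ex_series_lin 1 1 (fun i => Rabs (g i)) g Eg (ex_series_Rabs _ Eg)) as [_ ->].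
    lra. }
  rewrite (Series_ext _ _ (fun n => D (f n) (ER n))).
  rewrite (Series_ext _ _ (fun j => D (fun n => f n j) (EC j))).
  rewrite (proj2 (ex_series_lin 1 (-1) _ _ E2 E1)).
  rewrite (proj2 (ex_series_lin 1 (-1) _ _ E2' E1')). rewrite T1, T2. reflexivity.
Qed.

(** * Square-summable vectors and nonnegative bounded matrices *)

(** Membership in l2 and a norm bound in one statement, by partial sums only, so that no convergence
    has to be known in advance. *)
Definition l2_bound (x : nat -> R) (X : R) : Prop :=
  0 <= X /\ forall N, fsum (fun i => x i ^ 2) N <= X ^ 2.

Definition nonneg_entries (a : mat) : Prop := forall i j, 0 <= a i j.

(* Boundedness by [C] on finite sections; the form is symmetric under transposition,
   and for nonnegative matrices it is equivalent to a bound on the l2 operator norm. *)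
Definition op_bound (a : mat) (C : R) : Prop :=
  nonneg_entries a /\ 0 <= C /\
  forall N x y X Y, (forall i, 0 <= x i) -> (forall i, 0 <= y i) -> 0 <= X -> 0 <= Y ->
    fsum (fun i => x i ^ 2) N <= X ^ 2 -> fsum (fun i => y i ^ 2) N <= Y ^ 2 ->
    fsum (fun i => y i * fsum (fun j => a i j * x j) N) N <= C * X * Y.

Definition mat_app (a : mat) (x : nat -> R) : nat -> R := fun i => Series (fun j => a i j * x j).
Definition mat_mul (a b : mat) : mat := fun i j => Series (fun k => a i k * b k j).
Definition transpose (a : mat) : mat := fun i j => a j i.
Definition id_mat : mat := fun i j => if Nat.eqb i j then 1 else 0.
Fixpoint mat_pow (a : mat) (n : nat) : mat :=
  match n with O => id_mat | S k => mat_mul a (mat_pow a k) end.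
Definition basis (k : nat) : nat -> R := fun i => if Nat.eqb i k then 1 else 0.

Lemma l2_bound_pos x X : l2_bound x X -> 0 <= X.
Proof. intros H; apply H. Qed.

Lemma l2_bound_abs x X : l2_bound x X -> l2_bound (fun i => Rabs (x i)) X.
Proof.
  intros [H0 H]. split; [exact H0|]. intros N. eapply Rle_trans; [|apply H].
  apply fsum_le; intros. rewrite <- !Rsqr_pow2, <- Rsqr_abs. lra.
Qed.

Lemma l2_bound_le x y X : (forall i, Rabs (x i) <= y i) -> l2_bound y X -> l2_bound x X.
Proof.
  intros L [H0 H]. split; [exact H0|]. intros N. eapply Rle_trans; [|apply H].
  apply fsum_le; intros. rewrite <- !Rsqr_pow2, Rsqr_abs. apply Rsqr_incr_1; auto.
  - apply Rabs_pos.
  - eapply Rle_trans; [apply Rabs_pos|apply L].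
Qed.

Lemma l2_bound_weaken x X X' : l2_bound x X -> X <= X' -> l2_bound x X'.
Proof.
  intros [H0 H] L. split; [lra|]. intros N. eapply Rle_trans; [apply H|].
  apply pow_incr. lra.
Qed.

Lemma l2_bound_entry x X i : l2_bound x X -> Rabs (x i) <= X.
Proof.
  intros [H0 H]. apply Rsqr_incr_0_var; [|exact H0]. rewrite <- Rsqr_abs, !Rsqr_pow2.
  eapply Rle_trans; [|apply (H (S i))].
  apply (fsum_term (fun i => x i ^ 2)); [intros; apply pow2_ge_0|lia].
Qed.

Lemma l2_bound_scal c x X : l2_bound x X -> l2_bound (fun i => c * x i) (Rabs c * X).
Proof.
  intros [H0 H]. split; [pose proof (Rabs_pos c); nra|]. intros N.
  rewrite (fsum_ext _ (fun i => c ^ 2 * x i ^ 2)) by (intros; ring).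
  rewrite fsum_scal, Rpow_mult_distr, <- (Rsqr_pow2 (Rabs c)), <- Rsqr_abs, Rsqr_pow2.
  apply Rmult_le_compat_l; [apply pow2_ge_0|apply H].
Qed.

Lemma l2_bound_plus x y X Y : l2_bound x X -> l2_bound y Y -> l2_bound (fun i => x i + y i) (X + Y).
Proof.
  intros [HX Hx] [HY Hy]. split; [lra|]. intros N.
  rewrite (fsum_ext _ (fun i => (x i ^ 2 + y i ^ 2) + 2 * (x i * y i))) by (intros; ring).
  rewrite !fsum_plus, fsum_scal.
  pose proof (cauchy_schwarz_bound x y N X Y HX HY (Hx N) (Hy N)).
  pose proof (Rle_abs (fsum (fun i => x i * y i) N)). specialize (Hx N). specialize (Hy N). nra.
Qed.

Lemma l2_bound_zero : l2_bound (fun _ => 0) 0.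
Proof.
  split; [lra|]. intros N. rewrite (fsum_ext _ (fun _ => 0)) by (intros; ring).
  rewrite fsum_zero. lra.
Qed.

Lemma l2_bound_ext x y X : (forall i, x i = y i) -> l2_bound x X -> l2_bound y X.
Proof. intros E H. replace y with x by (apply functional_extensionality; auto). exact H. Qed.

Lemma l2_bound_inner x y X Y N : l2_bound x X -> l2_bound y Y -> fsum (fun i => Rabs (x i * y i)) N <= X * Y.
Proof.
  intros Hx Hy. apply l2_bound_abs in Hx. apply l2_bound_abs in Hy. destruct Hx as [HX Hx], Hy as [HY Hy].
  eapply Rle_trans; [|apply (cauchy_schwarz_bound _ _ N X Y HX HY (Hx N) (Hy N))].
  rewrite (fsum_ext _ (fun i => Rabs (x i) * Rabs (y i))) by (intros; apply Rabs_mult).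
  apply Rle_abs.
Qed.

Lemma l2_bound_basis k : l2_bound (basis k) 1.
Proof.
  split; [lra|]. intros N. unfold basis.
  apply Rle_trans with (fsum (fun i => if Nat.eqb i k then 1 else 0) (N + S k)).
  - eapply Rle_trans; [|apply fsum_mono with (n := N); [|lia]].
    + apply fsum_le. intros i _. destruct (Nat.eqb i k); lra.
    + intros i. destruct (Nat.eqb i k); lra.
  - rewrite (fsum_single _ _ k); [rewrite Nat.eqb_refl; lra|lia|].
    intros i Hi. apply Nat.eqb_neq in Hi. rewrite Hi. reflexivity.
Qed.

Lemma l2_bound_l2 x : (exists X, l2_bound x X) <-> ex_series (fun i => x i ^ 2).
Proof.
  split.
  - intros [X [_ H]]. apply (nonneg_series_bound _ (X ^ 2)); auto. intros; apply pow2_ge_0.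
  - intros E. exists (sqrt (Series (fun i => x i ^ 2))). split; [apply sqrt_pos|]. intros N.
    rewrite pow2_sqrt.
    + apply (fsum_le_Series (fun i => x i ^ 2)); auto. intros; apply pow2_ge_0.
    + apply Series_nonneg; auto. intros; apply pow2_ge_0.
Qed.

Lemma l2norm_le x X : 0 <= X -> ex_series (fun i => x i ^ 2) -> (l2norm x <= X <-> l2_bound x X).
Proof.
  intros HX E. assert (P : forall i, 0 <= x i ^ 2) by (intros; apply pow2_ge_0).
  pose proof (Series_nonneg _ P E) as S0. unfold l2norm. split.
  - intros H. split; [exact HX|]. intros N.
    eapply Rle_trans; [apply (fsum_le_Series _ N P E)|].
    rewrite <- (pow2_sqrt (Series _) S0). apply pow_incr. split; [apply sqrt_pos|exact H].
  - intros [_ H]. rewrite <- (sqrt_pow2 X HX). apply sqrt_le_1_alt.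
    apply (nonneg_series_bound _ _ P H).
Qed.

Lemma l2_bound_l2norm x : ex_series (fun i => x i ^ 2) -> l2_bound x (l2norm x).
Proof. intros E. apply l2norm_le; auto; [apply sqrt_pos|lra]. Qed.

(** * Calculus of bounded nonnegative matrices *)

Lemma op_bound_nonneg_entries a C : op_bound a C -> nonneg_entries a.
Proof. intros H; apply H. Qed.

Lemma op_bound_pos a C : op_bound a C -> 0 <= C.
Proof. intros H; apply H. Qed.

Lemma op_bound_weaken a C C' : op_bound a C -> C <= C' -> op_bound a C'.
Proof.
  intros (N & P & H) L. repeat split; [exact N|lra|]. intros n x y X Y Hx Hy HX HY Bx By.
  eapply Rle_trans; [apply (H n x y X Y); auto|].
  apply Rmult_le_compat_r; [exact HY|]. apply Rmult_le_compat_r; [exact HX|exact L].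
Qed.

Lemma op_bound_le a b C : nonneg_entries a -> (forall i j, a i j <= b i j) -> op_bound b C -> op_bound a C.
Proof.
  intros Na L (N & P & H). repeat split; [exact Na|exact P|]. intros n x y X Y Hx Hy HX HY Bx By.
  eapply Rle_trans; [|apply (H n x y X Y); auto].
  apply fsum_le; intros. apply Rmult_le_compat_l; auto.
  apply fsum_le; intros. apply Rmult_le_compat_r; auto.
Qed.

Lemma op_bound_transpose a C : op_bound a C -> op_bound (transpose a) C.
Proof.
  intros (N & P & H). repeat split; [intros i j; apply N|exact P|].
  intros n x y X Y Hx Hy HX HY Bx By. replace (C * X * Y) with (C * Y * X) by ring.
  eapply Rle_trans; [|apply (H n y x Y X); auto]. right.
  rewrite (fsum_ext _ (fun i => fsum (fun j => y i * a j i * x j) n)).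
  2:{ intros i _. rewrite <- fsum_scal. apply fsum_ext; intros. unfold transpose. ring. }
  rewrite fsum_swap. apply fsum_ext. intros i _. rewrite <- fsum_scal. apply fsum_ext; intros. ring.
Qed.

(** Testing the form against [y = a x] itself gives [|y|^2 <= C X |y|], and one factor [|y|]
    cancels. *)
Lemma op_bound_section a C x X N : op_bound a C -> (forall i, 0 <= x i) -> l2_bound x X ->
  fsum (fun i => fsum (fun j => a i j * x j) N ^ 2) N <= (C * X) ^ 2.
Proof.
  intros (Nn & P & H) Hx [HX Bx].
  set (y := fun i => fsum (fun j => a i j * x j) N).
  assert (Hy : forall i, 0 <= y i).
  { intros i. apply fsum_nonneg. intros j. apply Rmult_le_pos; [apply Nn|apply Hx]. }
  set (S := fsum (fun i => y i ^ 2) N).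
  assert (S0 : 0 <= S) by (apply fsum_nonneg; intros; apply pow2_ge_0).
  assert (L : S <= C * X * sqrt S).
  { eapply Rle_trans; [|apply (H N x y X (sqrt S)); auto using sqrt_pos].
    - right. apply fsum_ext. intros i _. unfold y. ring.
    - rewrite pow2_sqrt by exact S0. unfold S. lra. }
  change (S <= (C * X) ^ 2). rewrite <- (pow2_sqrt S S0). apply pow_incr.
  split; [apply sqrt_pos|]. rewrite <- (pow2_sqrt S S0) in L at 1.
  pose proof (sqrt_pos S). assert (0 <= C * X) by nra. nra.
Qed.

Lemma op_bound_row a C x X i N : op_bound a C -> l2_bound x X -> fsum (fun j => Rabs (a i j * x j)) N <= C * X.
Proof.
  intros Ha Hx. pose proof (op_bound_nonneg_entries _ _ Ha) as Nn. pose proof (op_bound_pos _ _ Ha). pose proof (l2_bound_pos _ _ Hx).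
  rewrite (fsum_ext _ (fun j => a i j * Rabs (x j)))
    by (intros; rewrite Rabs_mult, (Rabs_pos_eq (a i i0)) by apply Nn; reflexivity).
  assert (P : forall i j, 0 <= a i j * Rabs (x j))
    by (intros; apply Rmult_le_pos; [apply Nn|apply Rabs_pos]).
  (* The section is enlarged to contain row [i]. *)
  apply Rle_trans with (fsum (fun j => a i j * Rabs (x j)) (N + S i)); [apply fsum_mono; auto; lia|].
  apply Rsqr_incr_0_var; [|apply Rmult_le_pos; auto]. rewrite !Rsqr_pow2.
  eapply Rle_trans; [|apply (op_bound_section a C (fun j => Rabs (x j)) X (N + S i) Ha);
    [intros; apply Rabs_pos|apply l2_bound_abs, Hx]].
  apply (fsum_term (fun k => fsum (fun j => a k j * Rabs (x j)) (N + S i) ^ 2) (N + S i) i);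
    [intros; apply pow2_ge_0|lia].
Qed.

Lemma op_bound_row_ex a C x X i : op_bound a C -> l2_bound x X -> ex_series (fun j => Rabs (a i j * x j)).
Proof. intros Ha Hx. apply (abs_series_ex (fun j => a i j * x j) (C * X)). intros n. apply (op_bound_row a C x X i n Ha Hx). Qed.

Lemma mat_app_ex a C x X i : op_bound a C -> l2_bound x X -> ex_series (fun j => a i j * x j).
Proof. intros Ha Hx. apply ex_series_Rabs, (op_bound_row_ex a C x X i Ha Hx). Qed.

Lemma mat_app_abs_le a C x X i : op_bound a C -> l2_bound x X ->
  Rabs (mat_app a x i) <= mat_app a (fun j => Rabs (x j)) i.
Proof.
  intros Ha Hx. unfold mat_app. eapply Rle_trans; [apply Series_Rabs, (op_bound_row_ex a C x X i Ha Hx)|].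
  right. apply Series_ext. intros j. rewrite Rabs_mult, (Rabs_pos_eq (a i j)); [reflexivity|].
  apply (op_bound_nonneg_entries _ _ Ha).
Qed.

Lemma mat_app_nonneg a C x X i : op_bound a C -> l2_bound x X -> (forall j, 0 <= x j) -> 0 <= mat_app a x i.
Proof.
  intros Ha Hx P. apply Series_nonneg; [|apply (mat_app_ex a C x X i Ha Hx)].
  intros j. apply Rmult_le_pos; [apply (op_bound_nonneg_entries _ _ Ha)|apply P].
Qed.

Lemma mat_app_l2_bound a C x X : op_bound a C -> l2_bound x X -> l2_bound (mat_app a x) (C * X).
Proof.
  intros Ha Hx. apply l2_bound_le with (mat_app a (fun j => Rabs (x j))).
  { intros i. apply (mat_app_abs_le a C x X i Ha Hx). }
  apply l2_bound_abs in Hx. assert (Px : forall j, 0 <= (fun j => Rabs (x j)) j) by (intros; apply Rabs_pos).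
  revert Hx Px. generalize (fun j => Rabs (x j)). clear x. intros x Hx Px.
  split; [apply Rmult_le_pos; [apply (op_bound_pos _ _ Ha)|apply (l2_bound_pos _ _ Hx)]|]. intros N.
  (* The number [N] of rows stays fixed while the columns [M] grow; for [M >= N] the square section
     of size [M] bounds the sum. *)
  apply (is_lim_seq_le_const (fun M => fsum (fun i => fsum (fun j => a i j * x j) M ^ 2) N) _ _ N).
  - apply (is_lim_seq_fsum (fun i M => fsum (fun j => a i j * x j) M ^ 2)). intros i _.
    apply is_lim_seq_ext with (fun M => fsum (fun j => a i j * x j) M * fsum (fun j => a i j * x j) M).
    { intros; ring. }
    replace (mat_app a x i ^ 2) with (mat_app a x i * mat_app a x i) by ring.
    apply is_lim_seq_mult'; apply Series_lim, (mat_app_ex a C x X i Ha Hx).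
  - intros M L. eapply Rle_trans; [|apply (op_bound_section a C x X M Ha Px Hx)].
    apply fsum_mono; [intros; apply pow2_ge_0|exact L].
Qed.

(** Finitely supported vectors suffice because the form only sees sections. For a product of
    matrices this makes convergence of the row sums trivial. *)
Lemma op_bound_of_mat_app a C : nonneg_entries a -> 0 <= C ->
  (forall x X, (forall i, 0 <= x i) -> l2_bound x X -> (exists N, forall i, (N <= i)%nat -> x i = 0) ->
     (forall i, ex_series (fun j => a i j * x j)) /\ l2_bound (mat_app a x) (C * X)) -> op_bound a C.
Proof.
  intros Nn P H. repeat split; auto. intros N x y X Y Hx Hy HX HY Bx By.
  set (x' := fun i => if Nat.ltb i N then x i else 0).
  assert (Px' : forall i, 0 <= x' i) by (intros i; unfold x'; destruct (Nat.ltb i N); auto; lra).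
  assert (Ex' : forall i, (i < N)%nat -> x' i = x i).
  { intros i L. unfold x'. apply Nat.ltb_lt in L. rewrite L. reflexivity. }
  assert (Zx' : forall i, (N <= i)%nat -> x' i = 0).
  { intros i L. unfold x'. apply Nat.ltb_ge in L. rewrite L. reflexivity. }
  assert (Hx' : l2_bound x' X).
  { split; [exact HX|]. intros M. eapply Rle_trans; [|exact Bx].
    rewrite (fsum_ext (fun i => x i ^ 2) (fun i => x' i ^ 2)) by (intros; rewrite Ex'; auto).
    destruct (Nat.le_ge_cases M N) as [L|L].
    - apply fsum_mono; auto. intros; apply pow2_ge_0.
    - clear - L Zx'. induction L; [lra|]. cbn [fsum]. rewrite (Zx' m L). lra. }
  destruct (H x' X Px' Hx') as [E [_ B]]; [exists N; exact Zx'|].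
  assert (CX : 0 <= C * X) by (apply Rmult_le_pos; auto).
  apply Rle_trans with (fsum (fun i => mat_app a x' i * y i) N).
  - apply fsum_le. intros i _. rewrite Rmult_comm. apply Rmult_le_compat_r; auto.
    rewrite (fsum_ext (fun j => a i j * x j) (fun j => a i j * x' j)) by (intros; rewrite Ex'; auto).
    apply (fsum_le_Series (fun j => a i j * x' j)); auto. intros; apply Rmult_le_pos; auto.
  - eapply Rle_trans; [apply Rle_abs|]. apply cauchy_schwarz_bound; auto.
Qed.

Lemma mat_app_lin a C x y X Y c d i : op_bound a C -> l2_bound x X -> l2_bound y Y ->
  mat_app a (fun j => c * x j + d * y j) i = c * mat_app a x i + d * mat_app a y i.
Proof.
  intros Ha Hx Hy. unfold mat_app.
  rewrite (Series_ext _ (fun j => c * (a i j * x j) + d * (a i j * y j))) by (intros; ring).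
  apply ex_series_lin; [apply (mat_app_ex a C x X i Ha Hx)|apply (mat_app_ex a C y Y i Ha Hy)].
Qed.

Lemma mat_app_mono a C x y X Y i : op_bound a C -> l2_bound x X -> l2_bound y Y -> (forall j, x j <= y j) ->
  mat_app a x i <= mat_app a y i.
Proof.
  intros Ha Hx Hy L.
  assert (0 <= mat_app a (fun j => 1 * y j + (-1) * x j) i).
  { apply (mat_app_nonneg a C _ (Rabs 1 * Y + Rabs (-1) * X) i Ha).
    - apply l2_bound_plus; apply l2_bound_scal; assumption.
    - intros j. specialize (L j). lra. }
  rewrite (mat_app_lin a C y x Y X 1 (-1) i Ha Hy Hx) in H. lra.
Qed.

Lemma mat_app_basis a k i : mat_app a (basis k) i = a i k.
Proof.
  unfold mat_app. apply is_series_unique, is_series_fsum.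
  apply is_lim_seq_ext_loc with (fun _ => a i k); [|apply is_lim_seq_const].
  exists (S k). intros n L. rewrite (fsum_single _ _ k); [|lia|].
  - unfold basis. rewrite Nat.eqb_refl. ring.
  - intros j Hj. unfold basis. apply Nat.eqb_neq in Hj. rewrite Hj. ring.
Qed.

Lemma l2_bound_col a C k : op_bound a C -> l2_bound (fun i => a i k) C.
Proof.
  intros Ha. apply l2_bound_ext with (mat_app a (basis k)); [intros; apply mat_app_basis|].
  replace C with (C * 1) by ring. apply mat_app_l2_bound; auto using l2_bound_basis.
Qed.

Lemma op_bound_entry a C i j : op_bound a C -> a i j <= C.
Proof.
  intros Ha. eapply Rle_trans; [apply Rle_abs|].
  apply (l2_bound_entry (fun i => a i j)). apply l2_bound_col; auto.
Qed.

Lemma mat_mul_ex a C b D i j : op_bound a C -> op_bound b D -> ex_series (fun k => a i k * b k j).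
Proof. intros Ha Hb. apply (mat_app_ex a C (fun k => b k j) D i Ha). apply l2_bound_col; auto. Qed.

(** An interchange of summations. By positivity of both matrices, the rectangle bound for Fubini is
    the row bound of [a] at the vector [b |x|]. *)
Lemma mat_app_mat_mul a C b D x X i : op_bound a C -> op_bound b D -> l2_bound x X ->
  mat_app (mat_mul a b) x i = mat_app a (mat_app b x) i.
Proof.
  intros Ha Hb Hx. unfold mat_app at 1. unfold mat_mul.
  rewrite (Series_ext _ (fun j => Series (fun k => x j * (a i k * b k j))))
    by (intros; rewrite Series_scal_l; ring).
  rewrite (fubini (fun j k => x j * (a i k * b k j)) (C * (D * X))).
  - unfold mat_app. apply Series_ext. intros k. rewrite <- Series_scal_l.
    apply Series_ext. intros; ring.
  - intros N M. rewrite fsum_swap.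
    eapply Rle_trans; [|apply (op_bound_row a C (mat_app b (fun j => Rabs (x j))) (D * X) i M Ha)].
    2:{ apply mat_app_l2_bound; auto. apply l2_bound_abs; auto. }
    apply fsum_le. intros k _.
    rewrite (fsum_ext _ (fun j => a i k * Rabs (b k j * x j))).
    2:{ intros j _. rewrite !Rabs_mult, (Rabs_pos_eq (a i k)) by apply (op_bound_nonneg_entries _ _ Ha). ring. }
    rewrite fsum_scal, Rabs_mult, (Rabs_pos_eq (a i k)) by apply (op_bound_nonneg_entries _ _ Ha).
    apply Rmult_le_compat_l; [apply (op_bound_nonneg_entries _ _ Ha)|].
    eapply Rle_trans; [|apply Rle_abs]. unfold mat_app.
    rewrite (Series_ext (fun j => b k j * Rabs (x j)) (fun j => Rabs (b k j * x j))).
    2:{ intros j. rewrite Rabs_mult, (Rabs_pos_eq (b k j)) by apply (op_bound_nonneg_entries _ _ Hb). reflexivity. }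
    apply (abs_series_fsum_le (fun j => b k j * x j)), (op_bound_row_ex b D x X k Hb Hx).
Qed.

Lemma mat_mul_nonneg_entries a C b D : op_bound a C -> op_bound b D -> nonneg_entries (mat_mul a b).
Proof.
  intros Ha Hb i j. apply Series_nonneg; [|apply (mat_mul_ex a C b D i j Ha Hb)].
  intros k. apply Rmult_le_pos; [apply (op_bound_nonneg_entries _ _ Ha)|apply (op_bound_nonneg_entries _ _ Hb)].
Qed.

Lemma mat_mul_op_bound a C b D : op_bound a C -> op_bound b D -> op_bound (mat_mul a b) (C * D).
Proof.
  intros Ha Hb. apply op_bound_of_mat_app.
  - apply (mat_mul_nonneg_entries a C b D Ha Hb).
  - apply Rmult_le_pos; [apply (op_bound_pos _ _ Ha)|apply (op_bound_pos _ _ Hb)].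
  - intros x X Px Hx [N Z]. split.
    + intros i. exists (fsum (fun j => mat_mul a b i j * x j) N). apply is_series_fsum.
      apply is_lim_seq_ext_loc with (fun _ => fsum (fun j => mat_mul a b i j * x j) N);
        [|apply is_lim_seq_const].
      exists N. intros n L. induction L; [reflexivity|]. simpl. rewrite <- IHL, (Z m L). ring.
    + apply l2_bound_ext with (mat_app a (mat_app b x)).
      { intros i. symmetry. apply (mat_app_mat_mul a C b D x X i Ha Hb Hx). }
      rewrite Rmult_assoc. apply mat_app_l2_bound; auto. apply mat_app_l2_bound; auto.
Qed.

(** Each column of [c] is an l2 vector, to which [mat_app_mat_mul] applies. *)
Lemma mat_mul_assoc a A b B c C : op_bound a A -> op_bound b B -> op_bound c C -> mat_mul (mat_mul a b) c = mat_mul a (mat_mul b c).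
Proof.
  intros Ha Hb Hc. apply functional_extensionality; intros i. apply functional_extensionality; intros j.
  apply (mat_app_mat_mul a A b B (fun k => c k j) C i Ha Hb). apply l2_bound_col; auto.
Qed.

Lemma mat_mul_le a b c d C D : nonneg_entries a -> nonneg_entries b -> (forall i j, a i j <= c i j) -> (forall i j, b i j <= d i j) ->
  op_bound c C -> op_bound d D -> forall i j, mat_mul a b i j <= mat_mul c d i j.
Proof.
  intros Na Nb Lac Lbd Hc Hd i j. apply Series_le_nonneg; [|apply (mat_mul_ex c C d D i j Hc Hd)].
  intros k. split; [apply Rmult_le_pos; auto|apply Rmult_le_compat; auto].
Qed.

Lemma mat_mul_transpose a b : transpose (mat_mul a b) = mat_mul (transpose b) (transpose a).
Proof.
  apply functional_extensionality; intros i. apply functional_extensionality; intros j.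
  unfold transpose, mat_mul. apply Series_ext. intros; ring.
Qed.

Lemma mat_app_id_mat x i : mat_app id_mat x i = x i.
Proof.
  (* Row [i] of the identity is [basis i], so the roles of matrix and vector can be exchanged: a
     matrix all of whose rows are [x] acts on [basis i]. *)
  transitivity (mat_app (fun _ j => x j) (basis i) i); [|apply mat_app_basis].
  unfold mat_app. apply Series_ext. intros j. unfold id_mat, basis. rewrite Nat.eqb_sym. ring.
Qed.

Lemma mat_mul_id_mat_l a : mat_mul id_mat a = a.
Proof.
  apply functional_extensionality; intros i. apply functional_extensionality; intros j.
  apply (mat_app_id_mat (fun k => a k j) i).
Qed.

Lemma transpose_id_mat : transpose id_mat = id_mat.
Proof.
  apply functional_extensionality; intros i. apply functional_extensionality; intros j.
  unfold transpose, id_mat. rewrite Nat.eqb_sym. reflexivity.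
Qed.

Lemma mat_mul_id_mat_r a : mat_mul a id_mat = a.
Proof.
  change (transpose (transpose (mat_mul a id_mat)) = a). rewrite mat_mul_transpose, transpose_id_mat, mat_mul_id_mat_l. reflexivity.
Qed.

Lemma id_mat_op_bound : op_bound id_mat 1.
Proof.
  apply op_bound_of_mat_app; [|lra|].
  - intros i j. unfold id_mat. destruct (Nat.eqb i j); lra.
  - intros x X Px Hx _. split.
    + intros i. apply ex_series_ext with (fun j => x j * basis i j).
      { intros j. unfold id_mat, basis. rewrite Nat.eqb_sym. apply Rmult_comm. }
      apply (abs_series_ex _ (X * 1)). intros n.
      apply l2_bound_inner; auto using l2_bound_basis.
    + apply l2_bound_ext with x; [intros; symmetry; apply mat_app_id_mat|]. rewrite Rmult_1_l. exact Hx.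
Qed.

Lemma mat_pow_op_bound a C n : op_bound a C -> op_bound (mat_pow a n) (C ^ n).
Proof.
  intros Ha. induction n as [|n IH]; simpl; [apply id_mat_op_bound|]. apply mat_mul_op_bound; auto.
Qed.

Lemma mat_pow_add a C n m : op_bound a C -> mat_pow a (n + m) = mat_mul (mat_pow a n) (mat_pow a m).
Proof.
  intros Ha. induction n as [|n IH]; simpl; [rewrite mat_mul_id_mat_l; reflexivity|].
  rewrite IH. symmetry. apply (mat_mul_assoc a C _ (C ^ n) _ (C ^ m)); auto using mat_pow_op_bound.
Qed.

Lemma mat_pow_transpose a C n : op_bound a C -> mat_pow (transpose a) n = transpose (mat_pow a n).
Proof.
  intros Ha. induction n as [|n IH]; [symmetry; apply transpose_id_mat|].
  replace (S n) with (n + 1)%nat at 2 by lia. rewrite (mat_pow_add a C n 1 Ha).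
  rewrite mat_mul_transpose, <- IH. simpl. rewrite mat_mul_id_mat_r. reflexivity.
Qed.

Lemma mat_pow_le a b C n : nonneg_entries a -> (forall i j, a i j <= b i j) -> op_bound b C ->
  nonneg_entries (mat_pow a n) /\ forall i j, mat_pow a n i j <= mat_pow b n i j.
Proof.
  intros Na L Hb. pose proof (op_bound_le a b C Na L Hb) as Ha.
  split; [apply (op_bound_nonneg_entries _ (C ^ n)), mat_pow_op_bound, Ha|].
  induction n as [|n IH]; simpl; [intros; lra|].
  apply (mat_mul_le a (mat_pow a n) b (mat_pow b n) C (C ^ n)); auto using mat_pow_op_bound.
  apply (op_bound_nonneg_entries _ (C ^ n)), mat_pow_op_bound, Ha.
Qed.

Lemma mat_app_mat_pow_succ a C n x X i : op_bound a C -> l2_bound x X -> mat_app (mat_pow a (S n)) x i = mat_app a (mat_app (mat_pow a n) x) i.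
Proof. intros Ha Hx. apply (mat_app_mat_mul a C (mat_pow a n) (C ^ n) x X i); auto using mat_pow_op_bound. Qed.

(** * Norm-convergent series of vectors *)

(** The sum is only pointwise; convergence in norm is carried separately by majorants [m] of the
    norms whose partial sums stay below [K]. *)
Definition vseries (v : nat -> nat -> R) : nat -> R := fun i => Series (fun n => v n i).

Lemma vseries_abs_l2_bound v m K : (forall n, l2_bound (v n) (m n)) -> (forall N, fsum m N <= K) ->
  forall i, ex_series (fun n => Rabs (v n i)).
Proof.
  intros Hv Hm i. apply (abs_series_ex (fun n => v n i) K). intros N. eapply Rle_trans; [|apply (Hm N)].
  apply fsum_le. intros n _. apply (l2_bound_entry (v n)), Hv.
Qed.

Lemma fsum_l2_bound v m N : (forall n, l2_bound (v n) (m n)) -> l2_bound (fun i => fsum (fun n => v n i) N) (fsum m N).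
Proof.
  intros Hv. induction N as [|N IH]; simpl; [apply l2_bound_zero|]. apply l2_bound_plus; auto.
Qed.

Lemma vseries_l2_bound v m K : (forall n, l2_bound (v n) (m n)) -> (forall N, fsum m N <= K) -> l2_bound (vseries v) K.
Proof.
  intros Hv Hm. split; [apply (Hm O)|]. intros N.
  apply (is_lim_seq_le_const (fun M => fsum (fun i => fsum (fun n => v n i) M ^ 2) N) _ _ O).
  - apply (is_lim_seq_fsum (fun i M => fsum (fun n => v n i) M ^ 2)). intros i _.
    apply is_lim_seq_ext with (fun M => fsum (fun n => v n i) M * fsum (fun n => v n i) M).
    { intros; ring. }
    replace (vseries v i ^ 2) with (vseries v i * vseries v i) by ring.
    apply is_lim_seq_mult'; apply Series_lim, ex_series_Rabs, (vseries_abs_l2_bound v m K Hv Hm).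
  - intros M _. apply (l2_bound_weaken _ _ K (fsum_l2_bound v m M Hv)). apply Hm.
Qed.

Lemma mat_app_vseries a C v m K i : op_bound a C -> (forall n, l2_bound (v n) (m n)) -> (forall N, fsum m N <= K) ->
  mat_app a (vseries v) i = Series (fun n => mat_app a (v n) i).
Proof.
  intros Ha Hv Hm. unfold mat_app at 1, vseries.
  rewrite (Series_ext _ (fun j => Series (fun n => a i j * v n j)))
    by (intros; rewrite Series_scal_l; reflexivity).
  rewrite (fubini (fun j n => a i j * v n j) (C * K)); [reflexivity|].
  intros N M.
  eapply Rle_trans; [|apply (op_bound_row a C (vseries (fun n j => Rabs (v n j))) K i N Ha)].
  2:{ apply (vseries_l2_bound _ m K); auto. intros; apply l2_bound_abs; auto. }
  apply fsum_le. intros j _.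
  rewrite (fsum_ext _ (fun n => a i j * Rabs (v n j)))
    by (intros; rewrite Rabs_mult, (Rabs_pos_eq (a i j)) by apply (op_bound_nonneg_entries _ _ Ha); reflexivity).
  rewrite fsum_scal, Rabs_mult, (Rabs_pos_eq (a i j)) by apply (op_bound_nonneg_entries _ _ Ha).
  apply Rmult_le_compat_l; [apply (op_bound_nonneg_entries _ _ Ha)|].
  eapply Rle_trans; [|apply Rle_abs].
  apply (abs_series_fsum_le (fun n => v n j)), (vseries_abs_l2_bound v m K Hv Hm).
Qed.

Lemma inner_ex x y X Y : l2_bound x X -> l2_bound y Y -> 
  ex_series (fun i => x i * y i) /\ Rabs (Series (fun i => x i * y i)) <= X * Y.
Proof.
  intros Hx Hy. destruct (abs_series_ex (fun i => x i * y i) (X * Y)) as (E & E' & L & L').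
  - intros; apply l2_bound_inner; auto.
  - split; [exact E'|lra].
Qed.

Lemma inner_mat_app_transpose a C x y X Y : op_bound a C -> l2_bound x X -> l2_bound y Y ->
  Series (fun i => mat_app a x i * y i) = Series (fun j => x j * mat_app (transpose a) y j).
Proof.
  intros Ha Hx Hy. unfold mat_app.
  rewrite (Series_ext _ (fun i => Series (fun j => y i * (a i j * x j))))
    by (intros; rewrite Series_scal_l; ring).
  rewrite (fubini (fun i j => y i * (a i j * x j)) (Y * (C * X))).
  - apply Series_ext. intros j. rewrite <- Series_scal_l. apply Series_ext. intros. unfold transpose. ring.
  - intros N M.
    eapply Rle_trans; [|apply (l2_bound_inner y (mat_app a (fun j => Rabs (x j))) Y (C * X) N)]; auto.
    2:{ apply mat_app_l2_bound; auto. apply l2_bound_abs; auto. }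
    apply fsum_le. intros i _.
    rewrite (fsum_ext _ (fun j => Rabs (y i) * Rabs (a i j * x j))) by (intros; apply Rabs_mult).
    rewrite fsum_scal, Rabs_mult. apply Rmult_le_compat_l; [apply Rabs_pos|].
    eapply Rle_trans; [|apply Rle_abs]. unfold mat_app.
    rewrite (Series_ext (fun j => a i j * Rabs (x j)) (fun j => Rabs (a i j * x j))).
    2:{ intros j. rewrite Rabs_mult, (Rabs_pos_eq (a i j)) by apply (op_bound_nonneg_entries _ _ Ha). reflexivity. }
    apply (abs_series_fsum_le (fun j => a i j * x j)), (op_bound_row_ex a C x X i Ha Hx).
Qed.

(** * Automatic boundedness *)

Lemma pow2_unbounded Y : exists n, Y < 2 ^ n.
Proof.
  destruct (Pow_x_infinity 2 ltac:(rewrite Rabs_pos_eq; lra) (Y + 1)) as [N H].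
  exists N. specialize (H N (le_n N)). rewrite Rabs_pos_eq in H by (apply pow_le; lra). lra.
Qed.

Lemma geometric_sum q N : 0 <= q < 1 -> fsum (fun k => q ^ k) N <= / (1 - q).
Proof.
  intros H. apply Rmult_le_reg_r with (1 - q); [lra|]. rewrite Rinv_l by lra.
  assert (fsum (fun k => q ^ k) N * (1 - q) = 1 - q ^ N).
  { induction N as [|N IH]; [simpl; lra|]. cbn [fsum]. rewrite Rmult_plus_distr_r, IH. simpl. ring. }
  assert (0 <= q ^ N) by (apply pow_le; lra). lra.
Qed.

Definition trunc (N : nat) (x : nat -> R) : nat -> R := fun i => if Nat.ltb i N then x i else 0.

Lemma trunc_eq N x i : (i < N)%nat -> trunc N x i = x i.
Proof. intros L. unfold trunc. apply Nat.ltb_lt in L. rewrite L. reflexivity. Qed.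

Lemma trunc_nonneg N x : (forall i, 0 <= x i) -> forall i, 0 <= trunc N x i.
Proof. intros H i. unfold trunc. destruct (Nat.ltb i N); [apply H|lra]. Qed.

Lemma trunc_l2_bound N x X : 0 <= X -> fsum (fun i => x i ^ 2) N <= X ^ 2 -> l2_bound (trunc N x) X.
Proof.
  intros HX Bx. split; [exact HX|]. intros M. eapply Rle_trans; [|exact Bx].
  rewrite (fsum_ext (fun i => x i ^ 2) (fun i => trunc N x i ^ 2)) by (intros; rewrite trunc_eq; auto).
  destruct (Nat.le_ge_cases M N) as [L|L].
  - apply fsum_mono; auto. intros; apply pow2_ge_0.
  - induction L; [lra|]. cbn [fsum]. unfold trunc at 2.
    apply Nat.ltb_ge in L. rewrite L. lra.
Qed.

(** By homogeneity. Truncation turns the bound on a section into an l2 bound; a vector with norm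
    bound [0] cannot be normalised, but it vanishes. *)
Lemma op_bound_of_unit a C : nonneg_entries a -> 0 <= C ->
  (forall N x y, (forall i, 0 <= x i) -> (forall i, 0 <= y i) -> l2_bound x 1 -> l2_bound y 1 ->
     fsum (fun i => y i * fsum (fun j => a i j * x j) N) N <= C) -> op_bound a C.
Proof.
  intros Na PC H. repeat split; auto. intros N x y X Y Hx Hy HX HY Bx By.
  apply (trunc_l2_bound N x X HX) in Bx. apply (trunc_l2_bound N y Y HY) in By.
  pose proof (trunc_nonneg N x Hx) as Hx0. pose proof (trunc_nonneg N y Hy) as Hy0. clear Hx Hy. rename Hx0 into Hx, Hy0 into Hy.
  rewrite (fsum_ext _ (fun i => trunc N y i * fsum (fun j => a i j * trunc N x j) N)).
  2:{ intros i L. rewrite trunc_eq by exact L. f_equal. apply fsum_ext. intros j Lj.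
      rewrite trunc_eq by exact Lj. reflexivity. }
  revert Hx Hy Bx By. generalize (trunc N x), (trunc N y). clear x y. intros x y Hx Hy Bx By.
  assert (Z : forall z, l2_bound z 0 -> forall i, z i = 0).
  { intros z Hz i. pose proof (l2_bound_entry z 0 i Hz). pose proof (Rabs_pos (z i)).
    destruct (Req_dec (z i) 0) as [E|E]; [exact E|]. apply Rabs_no_R0 in E. lra. }
  destruct (Req_dec X 0) as [->|NX].
  { rewrite (fsum_ext _ (fun _ => 0)), fsum_zero; [lra|]. intros i _.
    rewrite (fsum_ext _ (fun _ => 0)), fsum_zero; [ring|]. intros j _. rewrite (Z x Bx). ring. }
  destruct (Req_dec Y 0) as [->|NY].
  { rewrite (fsum_ext _ (fun _ => 0)), fsum_zero; [lra|]. intros i _. rewrite (Z y By). ring. }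
  assert (U : forall z W, 0 <= W -> W <> 0 -> l2_bound z W -> l2_bound (fun i => / W * z i) 1).
  { intros z W PW NW Hz. apply l2_bound_weaken with (Rabs (/ W) * W); [apply l2_bound_scal, Hz|].
    assert (0 < / W) by (apply Rinv_0_lt_compat; lra).
    rewrite Rabs_pos_eq, Rinv_l by lra. lra. }
  assert (0 < / X) by (apply Rinv_0_lt_compat; lra). assert (0 < / Y) by (apply Rinv_0_lt_compat; lra).
  specialize (H N (fun i => / X * x i) (fun i => / Y * y i)
    ltac:(intros; apply Rmult_le_pos; auto; lra) ltac:(intros; apply Rmult_le_pos; auto; lra)
    (U x X HX NX Bx) (U y Y HY NY By)).
  rewrite (fsum_ext _ (fun i => (/ X * / Y) * (y i * fsum (fun j => a i j * x j) N))) in H.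
  2:{ intros i _. rewrite (fsum_ext _ (fun j => / X * (a i j * x j))) by (intros; ring).
      rewrite fsum_scal. ring. }
  rewrite fsum_scal in H.
  apply Rmult_le_reg_l with (/ X * / Y); [apply Rmult_lt_0_compat; auto|].
  replace (/ X * / Y * (C * X * Y)) with C by (field; auto). exact H.
Qed.

Lemma not_op_bound_unit a C : nonneg_entries a -> 0 <= C -> ~ op_bound a C ->
  exists N x y, (forall i, 0 <= x i) /\ (forall i, 0 <= y i) /\ l2_bound x 1 /\ l2_bound y 1 /\
     C < fsum (fun i => y i * fsum (fun j => a i j * x j) N) N.
Proof.
  intros Na PC H. apply NNPP. intros E. apply H. apply op_bound_of_unit; auto.
  intros N x y Hx Hy Bx By. apply Rnot_lt_le. intros L. apply E. exists N, x, y. auto.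
Qed.

(** One vector that dominates [2^-n w_n] for every [n] at once. It serves both the automatic
    boundedness and the construction of a vector outside a range. *)
Lemma dyadic_l2_bound (w : nat -> nat -> R) : (forall n, l2_bound (w n) 1) ->
  (forall n i, 0 <= w n i) ->
  let y := vseries (fun n i => (/ 2) ^ n * w n i) in
  l2_bound y 2 /\ (forall n i, (/ 2) ^ n * w n i <= y i).
Proof.
  intros Hw Pw y.
  assert (P2 : forall n, 0 <= (/ 2) ^ n) by (intros; apply pow_le; lra).
  assert (A : forall n, l2_bound (fun i => (/ 2) ^ n * w n i) ((/ 2) ^ n)).
  { intros n. apply l2_bound_weaken with (Rabs ((/ 2) ^ n) * 1); [apply l2_bound_scal, Hw|].
    rewrite Rabs_pos_eq by apply P2. lra. }
  assert (B : forall N, fsum (fun n => (/ 2) ^ n) N <= 2).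
  { intros N. eapply Rle_trans; [apply geometric_sum; lra|]. lra. }
  split; [apply (vseries_l2_bound _ _ 2 A B)|].
  intros n i. apply (Series_term (fun n => (/ 2) ^ n * w n i)).
  - intros k. apply Rmult_le_pos; auto.
  - apply ex_series_Rabs, (vseries_abs_l2_bound _ _ 2 A B).
Qed.

(* Gliding hump: positivity prevents cancellation in [sum 2^-n x_n]. *)
Lemma op_bound_of_defined a : nonneg_entries a ->
  (forall x X, (forall i, 0 <= x i) -> l2_bound x X ->
     (forall i, ex_series (fun j => a i j * x j)) /\ exists Y, l2_bound (mat_app a x) Y) ->
  exists C, op_bound a C.
Proof.
  intros Na H. apply NNPP. intros E.
  assert (W : forall n, exists p : nat * (nat -> R) * (nat -> R),
    let '(N, x, y) := p in
    (forall i, 0 <= x i) /\ (forall i, 0 <= y i) /\ l2_bound x 1 /\ l2_bound y 1 /\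
     4 ^ n < fsum (fun i => y i * fsum (fun j => a i j * x j) N) N).
  { intros n. destruct (not_op_bound_unit a (4 ^ n) Na) as (N & x & y & HH).
    - apply pow_le; lra.
    - intros B. apply E. eexists; exact B.
    - exists (N, x, y). exact HH. }
  destruct (functional_choice _ W) as [f Hf]. clear W.
  destruct (dyadic_l2_bound (fun n => snd (fst (f n)))) as [Nz Lz].
  { intros n. specialize (Hf n). destruct (f n) as [[N x] y]. apply Hf. }
  { intros n. specialize (Hf n). destruct (f n) as [[N x] y]. apply Hf. }
  cbv zeta in Nz, Lz. set (z := vseries _) in *.
  assert (Pz : forall i, 0 <= z i).
  { intros i. eapply Rle_trans; [|apply (Lz O i)]. specialize (Hf O).
    destruct (f O) as [[N x] y]. simpl. destruct Hf as [Hx _]. specialize (Hx i). lra. }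
  destruct (H z 2 Pz Nz) as [Ez [Y NY]].
  destruct (pow2_unbounded Y) as [n Hn].
  specialize (Hf n). specialize (Lz n). destruct (f n) as [[N x] y]. cbn [fst snd] in Lz.
  destruct Hf as (Hx & Hy & Bx & By & L).
  (* Since [x <= 2^n z], the form at [(y, x)] is at most [2^n |a z| <= 2^n Y]. It also exceeds
     [4^n], so [2^n < Y], against the choice of [n]. *)
  assert (U : fsum (fun i => y i * fsum (fun j => a i j * x j) N) N <= 2 ^ n * (1 * Y)).
  { apply Rle_trans with (2 ^ n * fsum (fun i => Rabs (y i * mat_app a z i)) N).
    - rewrite <- fsum_scal. apply fsum_le. intros i _.
      apply Rle_trans with (2 ^ n * (y i * mat_app a z i)).
      2:{ apply Rmult_le_compat_l; [apply pow_le; lra|apply Rle_abs]. }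
      replace (2 ^ n * (y i * mat_app a z i)) with (y i * (2 ^ n * mat_app a z i)) by ring.
      apply Rmult_le_compat_l; [apply Hy|].
      apply Rle_trans with (2 ^ n * fsum (fun j => a i j * z j) N).
      + rewrite <- fsum_scal. apply fsum_le. intros j _.
        replace (2 ^ n * (a i j * z j)) with (a i j * (2 ^ n * z j)) by ring.
        apply Rmult_le_compat_l; [apply Na|]. specialize (Lz j).
        replace (x j) with (2 ^ n * ((/ 2) ^ n * x j)).
        * apply Rmult_le_compat_l; [apply pow_le; lra|exact Lz].
        * rewrite <- Rmult_assoc, <- Rpow_mult_distr, Rinv_r, pow1 by lra. ring.
      + apply Rmult_le_compat_l; [apply pow_le; lra|].
        apply (fsum_le_Series (fun j => a i j * z j)); auto. intros; apply Rmult_le_pos; auto.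
    - apply Rmult_le_compat_l; [apply pow_le; lra|]. apply l2_bound_inner; auto. }
  assert (0 < 2 ^ n) by (apply pow_lt; lra).
  assert (4 ^ n = 2 ^ n * 2 ^ n) by (rewrite <- Rpow_mult_distr; f_equal; lra).
  nra.
Qed.

(** * Growth of powers *)

(** [P n c] reads: the [n]-th size is at most [c]. The abstract form covers both powers of a matrix
    and the sequence in Fekete's lemma. Blocks of length [m] cost [s^m] each; the remainder, shorter
    than [m], costs at most [q^m] beyond its power of [s]. *)
Lemma submult_growth (P : nat -> R -> Prop) M s m :
  (forall n c d, P n c -> c <= d -> P n d) ->
  (forall n k c d, 0 <= c -> 0 <= d -> P n c -> P k d -> P (n + k)%nat (c * d)) ->
  0 <= M -> (forall n, P n (M ^ n)) -> 0 < s -> (0 < m)%nat -> P m (s ^ m) ->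
  exists C, 0 <= C /\ forall n, P n (C * s ^ n).
Proof.
  intros mono mul HM HP Hs Hm Pm. set (q := Rmax 1 (M / s)).
  assert (Q1 : 1 <= q) by apply Rmax_l. assert (Q2 : M / s <= q) by apply Rmax_r.
  assert (Q0 : 0 <= q ^ m) by (apply pow_le; lra).
  exists (q ^ m). split; [exact Q0|].
  intros n. induction n as [n IH] using (well_founded_induction Wf_nat.lt_wf).
  destruct (Nat.lt_ge_cases n m) as [L|L].
  - apply mono with (M ^ n); [apply HP|].
    replace M with (M / s * s) at 1 by (field; lra). rewrite Rpow_mult_distr.
    apply Rmult_le_compat_r; [apply pow_le; lra|].
    apply Rle_trans with (q ^ n).
    + apply pow_incr. split; [|exact Q2]. apply Rmult_le_pos; [exact HM|].
      apply Rlt_le, Rinv_0_lt_compat, Hs.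
    + apply Rle_pow; [exact Q1|lia].
  - replace n with (m + (n - m))%nat at 1 by lia.
    apply mono with (s ^ m * (q ^ m * s ^ (n - m))).
    + apply mul; auto.
      * apply pow_le; lra.
      * apply Rmult_le_pos; [exact Q0|apply pow_le; lra].
      * apply IH. lia.
    + right. replace n with (m + (n - m))%nat at 2 by lia. rewrite pow_add. ring.
Qed.

Definition power_growth (h : mat) (s : R) : Prop := 0 < s /\ exists C, forall n, op_bound (mat_pow h n) (C * s ^ n).

Lemma power_growth_const h s : power_growth h s -> exists C, 0 <= C /\ forall n, op_bound (mat_pow h n) (C * s ^ n).
Proof.
  intros [Hs [C H]]. exists C. split; [|exact H].
  pose proof (op_bound_pos _ _ (H O)). simpl in H0. lra.
Qed.

Lemma power_growth_mono h s t : power_growth h s -> s <= t -> power_growth h t.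
Proof.
  intros G L. destruct (power_growth_const h s G) as [C [PC H]]. destruct G as [Hs _].
  split; [lra|]. exists C. intros n. eapply op_bound_weaken; [apply H|].
  apply Rmult_le_compat_l; [exact PC|]. apply pow_incr; lra.
Qed.

Lemma power_growth_op_bound h M s : op_bound h M -> 0 < s -> M <= s -> power_growth h s.
Proof.
  intros B Hs L. split; [exact Hs|]. exists 1. intros n.
  eapply op_bound_weaken; [apply mat_pow_op_bound, B|]. rewrite Rmult_1_l. apply pow_incr.
  split; [apply (op_bound_pos _ _ B)|exact L].
Qed.

Lemma power_growth_of_power h M s m : op_bound h M -> 0 < s -> (0 < m)%nat -> op_bound (mat_pow h m) (s ^ m) -> power_growth h s.
Proof.
  intros B Hs Hm Bm. split; [exact Hs|].
  destruct (submult_growth (fun n c => op_bound (mat_pow h n) c) M s m) as [C [_ HC]]; auto.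
  - intros n c d Hc L. apply (op_bound_weaken _ c); auto.
  - intros n k c d _ _ Hc Hd. rewrite (mat_pow_add h M n k B). apply mat_mul_op_bound; auto.
  - apply (op_bound_pos _ _ B).
  - intros n. apply mat_pow_op_bound, B.
  - exists C. exact HC.
Qed.

Lemma power_growth_transpose h M s : op_bound h M -> power_growth h s -> power_growth (transpose h) s.
Proof.
  intros B [Hs [C H]]. split; [exact Hs|]. exists C. intros n. rewrite (mat_pow_transpose h M n B).
  apply op_bound_transpose, H.
Qed.

Lemma power_growth_square h M s : op_bound h M -> power_growth (mat_mul h h) s -> power_growth h (sqrt s).
Proof.
  intros B [Hs [C H]]. pose proof (sqrt_lt_R0 s Hs) as Hq. split; [exact Hq|].
  assert (PC : 0 <= C) by (pose proof (op_bound_pos _ _ (H O)); simpl in *; lra).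
  assert (PM := op_bound_pos _ _ B).
  assert (E : forall n, mat_pow (mat_mul h h) n = mat_pow h (n + n)).
  { induction n as [|n IH]; [reflexivity|].
    replace (S n + S n)%nat with (S (S (n + n))) by lia. simpl. rewrite IH.
    apply (mat_mul_assoc h M h M _ (M ^ (n + n))); auto using mat_pow_op_bound. }
  assert (Sq : forall n, s ^ n = sqrt s ^ (n + n)).
  { intros n. rewrite pow_add, <- Rpow_mult_distr, sqrt_def by lra. reflexivity. }
  assert (X : forall n, op_bound (mat_pow h (n + n)) (C * sqrt s ^ (n + n))).
  { intros n. rewrite <- E, <- Sq. apply H. }
  (* The second summand pays for the extra factor [h] of an odd power: [M C (sqrt s)^(2k) = (M C /
     sqrt s) (sqrt s)^(2k+1)]. *)
  exists (C + M * C / sqrt s). intros n.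
  assert (0 <= M * C / sqrt s).
  { apply Rmult_le_pos; [apply Rmult_le_pos; auto|]. apply Rlt_le, Rinv_0_lt_compat, Hq. }
  assert (P : forall k, 0 <= sqrt s ^ k) by (intros; apply pow_le; lra).
  destruct (Nat.Even_or_Odd n) as [[k ->]|[k ->]].
  - replace (2 * k)%nat with (k + k)%nat by lia. eapply op_bound_weaken; [apply X|].
    specialize (P (k + k)%nat). nra.
  - replace (2 * k + 1)%nat with (S (k + k)) by lia. simpl mat_pow.
    eapply op_bound_weaken; [apply mat_mul_op_bound; [exact B|apply X]|]. specialize (P (k + k)%nat).
    simpl pow.
    replace ((C + M * C / sqrt s) * (sqrt s * sqrt s ^ (k + k)))
      with (C * sqrt s * sqrt s ^ (k + k) + M * (C * sqrt s ^ (k + k))) by (field; lra).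
    assert (0 <= C * sqrt s * sqrt s ^ (k + k)).
    { repeat apply Rmult_le_pos; auto; lra. }
    lra.
Qed.

Lemma power_growth_le a b M s : nonneg_entries a -> (forall i j, a i j <= b i j) -> op_bound b M -> power_growth b s -> power_growth a s.
Proof.
  intros Na L B [Hs [C H]]. split; [exact Hs|]. exists C. intros n.
  destruct (mat_pow_le a b M n Na L B) as [N' L']. apply (op_bound_le _ _ _ N' L' (H n)).
Qed.

Lemma bernoulli x n : 0 <= x <= 1 -> 1 - INR n * x <= (1 - x) ^ n.
Proof.
  intros H. induction n as [|n IH]; [simpl; lra|]. rewrite S_INR. simpl.
  pose proof (pos_INR n). pose proof (pow_le (1 - x) n ltac:(lra)).
  assert (0 <= INR n * x * x) by (repeat apply Rmult_le_pos; lra). nra.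
Qed.

(** * Partial Neumann sums and approximate eigenvectors *)

Lemma op_bound_scal c a C : 0 <= c -> op_bound a C -> op_bound (fun i j => c * a i j) (c * C).
Proof.
  intros Hc (N & P & H). repeat split.
  - intros i j. apply Rmult_le_pos; auto.
  - apply Rmult_le_pos; auto.
  - intros n x y X Y Hx Hy HX HY Bx By.
    rewrite (fsum_ext _ (fun i => c * (y i * fsum (fun j => a i j * x j) n))).
    + rewrite fsum_scal. replace (c * C * X * Y) with (c * (C * X * Y)) by ring.
      apply Rmult_le_compat_l; auto.
    + intros i _. rewrite (fsum_ext _ (fun j => c * (a i j * x j))) by (intros; ring).
      rewrite fsum_scal. ring.
Qed.

(** Partial sum of the Neumann series of [(1 - A/g)^-1], up to and including the power [n]. *)
Definition psum (A : mat) (g : R) (n : nat) : mat :=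
  fun i j => fsum (fun k => mat_pow A k i j * (/ g) ^ k) (S n).

Lemma mat_pow_nonneg_entries A M k : op_bound A M -> nonneg_entries (mat_pow A k).
Proof. intros B. apply (op_bound_nonneg_entries _ (M ^ k)), mat_pow_op_bound, B. Qed.

Lemma psum_nonneg_entries A M g n : op_bound A M -> 0 < g -> nonneg_entries (psum A g n).
Proof.
  intros B Hg i j. apply fsum_nonneg. intros k. apply Rmult_le_pos; [apply (mat_pow_nonneg_entries A M k B)|].
  apply pow_le, Rlt_le, Rinv_0_lt_compat, Hg.
Qed.

Lemma conv_le p q n : (forall k, 0 <= p k) -> (forall k, 0 <= q k) ->
  fsum (fun k => p k * q (n - k)%nat) (S n) <= fsum p (S n) * fsum q (S n).
Proof.
  intros Hp Hq. rewrite Rmult_comm, <- fsum_scal. apply fsum_le. intros k _.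
  rewrite Rmult_comm. apply Rmult_le_compat_r; [apply Hp|]. apply fsum_term; [apply Hq|lia].
Qed.

(* Each of the [n+1] splittings [A^n = A^k A^(n-k)] occurs in the square of the partial Neumann sum. *)
Lemma psum_square A M g n K : op_bound A M -> 0 < g -> op_bound (psum A g n) K ->
  forall i l, INR (S n) * ((/ g) ^ n * mat_pow A n i l) <= mat_mul (psum A g n) (psum A g n) i l.
Proof.
  intros B Hg BK i l.
  assert (G : forall k, 0 <= (/ g) ^ k) by (intros; apply pow_le, Rlt_le, Rinv_0_lt_compat, Hg).
  assert (T : forall k, (k < S n)%nat ->
     ex_series (fun j => (mat_pow A k i j * (/ g) ^ k) * (mat_pow A (n - k) j l * (/ g) ^ (n - k))) /\
     Series (fun j => (mat_pow A k i j * (/ g) ^ k) * (mat_pow A (n - k) j l * (/ g) ^ (n - k)))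
     = (/ g) ^ n * mat_pow A n i l).
  { intros k Hk.
    assert (E : forall j, (/ g) ^ n * (mat_pow A k i j * mat_pow A (n - k) j l) =
       (mat_pow A k i j * (/ g) ^ k) * (mat_pow A (n - k) j l * (/ g) ^ (n - k))).
    { intros j. replace n with (k + (n - k))%nat at 1 by lia. rewrite pow_add. ring. }
    split.
    - eapply ex_series_ext; [exact E|].
      apply (ex_series_scal_l ((/ g) ^ n) (fun j => mat_pow A k i j * mat_pow A (n - k) j l)).
      apply (mat_mul_ex _ (M ^ k) _ (M ^ (n - k))); apply mat_pow_op_bound, B.
    - rewrite <- (Series_ext _ _ E), Series_scal_l. f_equal.
      transitivity (mat_pow A (k + (n - k)) i l); [rewrite (mat_pow_add A M k (n - k) B); reflexivity|].
      replace (k + (n - k))%nat with n by lia. reflexivity. }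
  rewrite <- fsum_const.
  rewrite <- (fsum_ext (fun k => Series (fun j => (mat_pow A k i j * (/ g) ^ k) * (mat_pow A (n - k) j l * (/ g) ^ (n - k))))).
  2:{ intros k Hk. apply T, Hk. }
  rewrite <- (proj2 (Series_fsum (fun k j => (mat_pow A k i j * (/ g) ^ k) * (mat_pow A (n - k) j l * (/ g) ^ (n - k)))
    (S n) (fun k Hk => proj1 (T k Hk)))).
  apply Series_le_nonneg; [|apply (mat_mul_ex _ K _ K i l BK BK)].
  intros j. split.
  - apply fsum_nonneg. intros k. repeat apply Rmult_le_pos; auto; apply (mat_pow_nonneg_entries A M _ B).
  - apply (conv_le (fun k => mat_pow A k i j * (/ g) ^ k) (fun k => mat_pow A k j l * (/ g) ^ k));
      intros k; apply Rmult_le_pos; auto; apply (mat_pow_nonneg_entries A M _ B).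
Qed.

(** If all partial sums were bounded by [K], their squares would give [(n+1) |A^n| <= K^2 g^n]. For
    large [n] then [|A^n| <= g^n / 2], and a single such power forces growth at a rate below [g]. *)
Lemma psum_unbounded A M g : op_bound A M -> 0 < g -> (forall t, t < g -> ~ power_growth A t) ->
  forall K, exists n, ~ op_bound (psum A g n) K.
Proof.
  intros B Hg Hmin K. apply NNPP. intros E.
  assert (BK : forall n, op_bound (psum A g n) K).
  { intros n. apply NNPP. intros X. apply E. exists n. exact X. }
  destruct (nfloor_ex (2 * K ^ 2)) as [n0 Hn0]; [pose proof (pow2_ge_0 K); lra|].
  set (n := S n0).
  assert (Hn : 2 * K ^ 2 <= INR (S n)) by (unfold n; rewrite !S_INR; lra).
  assert (Pn : 0 < INR (S n)) by (apply lt_0_INR; lia).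
  assert (Gn : 0 < g ^ n) by (apply pow_lt, Hg).
  assert (Bn : op_bound (mat_pow A n) (g ^ n / 2)).
  { apply op_bound_weaken with (g ^ n / INR (S n) * (K * K)).
    - apply op_bound_le with (fun i j => g ^ n / INR (S n) * mat_mul (psum A g n) (psum A g n) i j).
      + apply (mat_pow_nonneg_entries A M n B).
      + intros i j. pose proof (psum_square A M g n K B Hg (BK n) i j) as L.
        apply Rmult_le_compat_l with (r := g ^ n / INR (S n)) in L.
        2:{ apply Rlt_le, Rdiv_lt_0_compat; auto. }
        eapply Rle_trans; [|exact L]. right. rewrite pow_inv. field. split; lra.
      + apply op_bound_scal; [apply Rlt_le, Rdiv_lt_0_compat; auto|]. apply mat_mul_op_bound; auto.
    - unfold Rdiv. rewrite Rmult_assoc. apply Rmult_le_compat_l; [lra|].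
      apply Rmult_le_reg_l with (INR (S n)); [exact Pn|].
      rewrite <- Rmult_assoc, Rinv_r by lra. lra. }
  (* Chosen so that [(1 - x)^n >= 1 - n x = 1/2] by Bernoulli; the smaller rate is [g (1 - x)]. *)
  set (x := / (2 * INR n)).
  assert (Pn' : 1 <= INR n) by (unfold n; rewrite S_INR; pose proof (pos_INR n0); lra).
  assert (Hx : 0 < x /\ INR n * x = / 2).
  { unfold x. split; [apply Rinv_0_lt_compat; lra|field; lra]. }
  assert (Hx1 : x <= / 2) by nra.
  apply (Hmin (g * (1 - x))); [nra|].
  apply (power_growth_of_power A M _ n B); [nra|unfold n; lia|].
  apply (op_bound_weaken _ _ _ Bn). rewrite Rpow_mult_distr.
  pose proof (bernoulli x n ltac:(lra)). nra.
Qed.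

Lemma vseries_incr v m K i : (forall n, l2_bound (v n) (m n)) -> (forall N, fsum m N <= K) ->
  vseries v i = v O i + Series (fun n => v (S n) i).
Proof.
  intros Hv Hm. apply (Series_incr_1 (fun n => v n i)).
  apply ex_series_Rabs, (vseries_abs_l2_bound v m K Hv Hm).
Qed.

(** Only the absolute values of the coefficients are constrained, so the same geometric majorant
    serves the real resolvent and the real and imaginary parts of the complex one. *)
Lemma neumann_bounds A M s t c x X : op_bound A M -> power_growth A s -> s < t -> l2_bound x X ->
  (forall k, Rabs (c k) <= (/ t) ^ S k) ->
  exists m K, (forall k, l2_bound (fun i => c k * mat_app (mat_pow A k) x i) (m k)) /\ forall N, fsum m N <= K.
Proof.
  intros B G L Hx Hc. destruct (power_growth_const _ _ G) as [C [PC HC]]. destruct G as [Hs _].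
  pose proof (l2_bound_pos _ _ Hx) as HX.
  assert (It : 0 < / t) by (apply Rinv_0_lt_compat; lra).
  assert (Q : 0 <= s / t < 1).
  { split; [apply Rmult_le_pos; lra|]. apply Rmult_lt_reg_r with t; [lra|]. unfold Rdiv.
    rewrite Rmult_assoc, Rinv_l by lra. lra. }
  exists (fun k => (C * X / t) * (s / t) ^ k), ((C * X / t) * / (1 - s / t)). split.
  - intros k. apply l2_bound_weaken with (Rabs (c k) * (C * s ^ k * X)).
    + apply l2_bound_scal. apply mat_app_l2_bound; auto.
    + apply Rle_trans with ((/ t) ^ S k * (C * s ^ k * X)).
      * apply Rmult_le_compat_r; [|apply Hc].
        repeat apply Rmult_le_pos; auto. apply pow_le; lra.
      * right. unfold Rdiv. rewrite Rpow_mult_distr. simpl. ring.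
  - intros N. rewrite fsum_scal. apply Rmult_le_compat_l; [|apply geometric_sum, Q].
    repeat apply Rmult_le_pos; auto; lra.
Qed.

(** The vector is [w = (t - A)^-1 x = sum t^-(k+1) A^k x]. By positivity every partial sum lies
    below it, which transfers largeness of partial sums to [w]. *)
Lemma resolvent A M s t x X : op_bound A M -> power_growth A s -> s < t -> l2_bound x X -> (forall i, 0 <= x i) ->
  exists w W, l2_bound w W /\ (forall i, mat_app A w i = t * w i - x i) /\
    forall n i, fsum (fun k => (/ t) ^ S k * mat_app (mat_pow A k) x i) n <= w i.
Proof.
  intros B G L Hx Px. assert (Ht : 0 < t) by (destruct G; lra).
  assert (It : 0 < / t) by (apply Rinv_0_lt_compat; lra).
  assert (PT : forall k, 0 <= (/ t) ^ k) by (intros; apply pow_le; lra).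
  destruct (neumann_bounds A M s t (fun k => (/ t) ^ S k) x X B G L Hx) as (m & K & Hv & Hm).
  { intros k. rewrite Rabs_pos_eq by apply PT. lra. }
  set (v := fun k i => (/ t) ^ S k * mat_app (mat_pow A k) x i) in *.
  exists (vseries v), K. split; [apply (vseries_l2_bound v m K Hv Hm)|]. split.
  - intros i. rewrite (mat_app_vseries A M v m K i B Hv Hm), (vseries_incr v m K i Hv Hm).
    rewrite (Series_ext _ (fun n => t * v (S n) i)).
    + rewrite Series_scal_l. unfold v at 2. cbn [mat_pow]. rewrite mat_app_id_mat. simpl. field. lra.
    + intros n. unfold v. rewrite (mat_app_mat_pow_succ A M n x X i B Hx).
      pose proof (mat_app_lin A M (mat_app (mat_pow A n) x) (fun _ => 0) (M ^ n * X) 0 ((/ t) ^ S n) 0 i B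
        (mat_app_l2_bound _ _ _ _ (mat_pow_op_bound A M n B) Hx) l2_bound_zero) as E.
      transitivity (mat_app A (fun j => (/ t) ^ S n * mat_app (mat_pow A n) x j + 0 * 0) i).
      { apply Series_ext. intros; ring. }
      rewrite E. simpl. field. lra.
  - intros n i. apply (fsum_le_Series (fun k => v k i)).
    + intros k. apply Rmult_le_pos; [apply PT|].
      apply (mat_app_nonneg _ (M ^ k) x X i); auto using mat_pow_op_bound.
    + apply ex_series_Rabs, (vseries_abs_l2_bound v m K Hv Hm).
Qed.

(** Supplies [t = g (1 + d)] so close to [g] that [t^k <= 2 g^k] for all [k <= n]. The choice
    [d <= 3^-n] works because [(1 + d)^k <= 1 + 3^k d] when [d <= 1]. *)
Lemma small_dilation n e : 0 < e -> exists d, 0 < d <= 1 /\ d <= e /\ (1 + d) ^ n <= 2.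
Proof.
  intros He.
  assert (P3 : 1 <= 3 ^ n) by (apply pow_R1_Rle; lra).
  assert (I3 : 0 < / 3 ^ n) by (apply Rinv_0_lt_compat; lra).
  exists (Rmin e (/ 3 ^ n)). set (d := Rmin e (/ 3 ^ n)).
  assert (D1 : d <= e) by apply Rmin_l. assert (D2 : d <= / 3 ^ n) by apply Rmin_r.
  assert (D0 : 0 < d) by (apply Rmin_pos; auto).
  assert (D3 : 3 ^ n * d <= 1).
  { apply Rmult_le_compat_l with (r := 3 ^ n) in D2; [|lra]. rewrite Rinv_r in D2; lra. }
  assert (D4 : d <= 1) by nra.
  repeat split; auto.
  assert (forall k, (1 + d) ^ k <= 1 + 3 ^ k * d).
  { induction k as [|k IH]; [simpl; lra|]. simpl.
    assert (1 <= 3 ^ k) by (apply pow_R1_Rle; lra).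
    assert (0 <= 3 ^ k * d * (1 - d)) by (repeat apply Rmult_le_pos; lra).
    assert (0 <= (3 ^ k - 1) * d) by (apply Rmult_le_pos; lra). nra. }
  specialize (H n). lra.
Qed.

(** A large partial sum at [g] forces a large [w = (t - A)^-1 x] for [t] slightly above [g]. Since
    [A w - g w = (t - g) w - x] with [|x| <= 1], normalising [w] leaves an error of at most
    [(t - g) + 1/|w|]. *)
Lemma approx_eigenvector A M g : op_bound A M -> 0 < g ->
  (forall t, g < t -> power_growth A t) -> (forall t, t < g -> ~ power_growth A t) ->
  forall e, 0 < e -> exists w, (forall i, 0 <= w i) /\ l2_bound w 1 /\ 1 <= Series (fun i => w i * w i) /\
    l2_bound (fun i => mat_app A w i - g * w i) e.
Proof.
  intros B Hg Hup Hlo e He.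
  (* The estimate below gives [K < 4 g |w|], that is [1/|w| < e/2]; the other half of [e] is left
     for [t - g = g d]. *)
  set (K := 8 * g / e). assert (HK : 0 < K) by (apply Rdiv_lt_0_compat; lra).
  destruct (psum_unbounded A M g B Hg Hlo K) as [n Hn].
  destruct (not_op_bound_unit _ K (psum_nonneg_entries A M g n B Hg) (Rlt_le _ _ HK) Hn)
    as (N & x & y & Px & Py & Nx & Ny & HS).
  destruct (small_dilation n (e / (2 * g))) as (d & Hd & Hde & Hdn); [apply Rdiv_lt_0_compat; lra|].
  set (t := g * (1 + d)).
  assert (Hde' : g * d <= e / 2).
  { replace (e / 2) with (g * (e / (2 * g))) by (field; lra). apply Rmult_le_compat_l; lra. }
  assert (Hgt : g < t <= 2 * g) by (unfold t; nra).
  (* Growth at [g] itself is not assumed, so a rate strictly between [g] and [t] is used. *)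
  destruct (resolvent A M ((g + t) / 2) t x 1 B) as (w & W0 & Nw & Ew & Lw); auto;
    [apply Hup; lra|lra|].
  assert (Pw : forall i, 0 <= w i) by (intros i; apply (Lw O i)).
  assert (Ig : 0 < / g) by (apply Rinv_0_lt_compat; lra).
  (* Termwise [g^-k <= 2 t^-k] for [k <= n], and [t <= 2 g] gives [t^-k <= 2 g t^-(k+1)]; hence the
     factor [4 g]. *)
  assert (Lw' : forall i, fsum (fun j => psum A g n i j * x j) N <= (4 * g) * w i).
  { intros i. apply Rle_trans with (4 * g * fsum (fun k => (/ t) ^ S k * mat_app (mat_pow A k) x i) (S n));
      [|apply Rmult_le_compat_l; [lra|apply Lw]].
    rewrite <- fsum_scal. unfold psum.
    rewrite (fsum_ext _ (fun j => fsum (fun k => (/ g) ^ k * (mat_pow A k i j * x j)) (S n))).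
    2:{ intros j _. rewrite Rmult_comm, <- fsum_scal. apply fsum_ext. intros; ring. }
    rewrite fsum_swap. apply fsum_le. intros k Hk. rewrite fsum_scal, <- Rmult_assoc.
    assert (Bk := mat_pow_op_bound A M k B).
    assert (F : fsum (fun j => mat_pow A k i j * x j) N <= mat_app (mat_pow A k) x i).
    { apply (fsum_le_Series (fun j => mat_pow A k i j * x j)); [|apply (mat_app_ex _ (M ^ k) x 1); auto].
      intros j. apply Rmult_le_pos; [apply (mat_pow_nonneg_entries A M k B)|apply Px]. }
    apply Rmult_le_compat; auto.
    - apply pow_le; lra.
    - apply fsum_nonneg. intros j. apply Rmult_le_pos; [apply (mat_pow_nonneg_entries A M k B)|apply Px].
    - simpl. rewrite !pow_inv.
      assert (g ^ k > 0) by (apply pow_lt; lra). assert (t ^ k > 0) by (apply pow_lt; lra).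
      assert (T : t ^ k <= 2 * g ^ k).
      { unfold t. rewrite Rpow_mult_distr.
        assert ((1 + d) ^ k <= 2) by (eapply Rle_trans; [apply Rle_pow with (n := n); [lra|lia]|exact Hdn]).
        nra. }
      apply Rmult_le_reg_r with (g ^ k * t ^ k * t); [repeat apply Rmult_lt_0_compat; lra|].
      replace (/ g ^ k * (g ^ k * t ^ k * t)) with (t ^ k * t) by (field; lra).
      replace (4 * g * (/ t * / t ^ k) * (g ^ k * t ^ k * t)) with ((2 * g ^ k) * (2 * g)) by (field; lra).
      apply Rmult_le_compat; lra. }
  set (W := l2norm w).
  assert (Ew2 : ex_series (fun i => w i ^ 2)) by (apply l2_bound_l2; exists W0; exact Nw).
  assert (NW : l2_bound w W) by (apply l2_bound_l2norm, Ew2).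
  assert (HW : K < 4 * g * W).
  { eapply Rlt_le_trans; [exact HS|].
    apply Rle_trans with (4 * g * fsum (fun i => Rabs (y i * w i)) N).
    - rewrite <- fsum_scal. apply fsum_le. intros i _.
      rewrite Rabs_pos_eq by (apply Rmult_le_pos; auto).
      replace (4 * g * (y i * w i)) with (y i * (4 * g * w i)) by ring.
      apply Rmult_le_compat_l; auto.
    - apply Rmult_le_compat_l; [lra|]. replace W with (1 * W) by ring. apply l2_bound_inner; auto. }
  assert (PW : 0 < W) by nra. assert (IW : 0 < / W) by (apply Rinv_0_lt_compat, PW).
  exists (fun i => / W * w i). repeat split.
  - intros i. apply Rmult_le_pos; [lra|auto].
  - lra.
  - replace 1 with (Rabs (/ W) * W) by (rewrite Rabs_pos_eq, Rinv_l; lra). apply l2_bound_scal, NW.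
  - right. rewrite (Series_ext _ (fun i => (/ W * / W) * (w i ^ 2))) by (intros; ring).
    rewrite Series_scal_l. unfold W, l2norm.
    rewrite <- Rinv_mult, sqrt_def; [rewrite Rinv_l; [reflexivity|]|].
    + intros Z. unfold W, l2norm in PW. rewrite Z, sqrt_0 in PW. lra.
    + apply Series_nonneg; auto. intros; apply pow2_ge_0.
  - lra.
  - assert (D : l2_bound (fun i => g * d * (/ W * w i) + (- / W) * x i) e).
    { apply l2_bound_weaken with (Rabs (g * d) * (Rabs (/ W) * W) + Rabs (- / W) * 1).
      - apply l2_bound_plus; repeat apply l2_bound_scal; auto.
      - rewrite Rabs_Ropp, (Rabs_pos_eq (/ W)), (Rabs_pos_eq (g * d)), Rinv_l by nra.
        assert (/ W <= e / 2); [|lra].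
        apply Rmult_le_reg_l with (W * 8 * g); [nra|].
        replace (W * 8 * g * / W) with (K * e) by (unfold K; field; lra).
        replace (W * 8 * g * (e / 2)) with (4 * g * W * e) by field.
        apply Rmult_le_compat_r; lra. }
    apply (l2_bound_ext _ (fun i => mat_app A (fun j => / W * w j) i - g * (/ W * w i)) e) in D; [apply D|].
    intros i.
    transitivity (mat_app A (fun j => / W * w j + 0 * w j) i - g * (/ W * w i)).
    2:{ f_equal. apply Series_ext. intros; ring. }
    rewrite (mat_app_lin A M w w W W (/ W) 0 i B NW NW), Ew. unfold t. ring.
Qed.

Lemma not_surjective h M g : op_bound h M -> 0 < g ->
  (forall t, g < t -> power_growth h t) -> (forall t, t < g -> ~ power_growth h t) ->
  exists y, l2_bound y 2 /\ forall x X, l2_bound x X -> ~ (forall i, mat_app h x i - g * x i = y i).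
Proof.
  intros B Hg Hup Hlo. pose proof (op_bound_transpose h M B) as Bt.
  assert (W : forall n, exists w, (forall i, 0 <= w i) /\ l2_bound w 1 /\ 1 <= Series (fun i => w i * w i) /\
    l2_bound (fun i => mat_app (transpose h) w i - g * w i) ((/ 4) ^ n)).
  { intros n. apply (approx_eigenvector (transpose h) M g Bt Hg).
    - intros t Ht. apply (power_growth_transpose h M t B), Hup, Ht.
    - intros t Ht G. apply (Hlo t Ht). apply (power_growth_transpose (transpose h) M t Bt) in G. exact G.
    - apply pow_lt; lra. }
  destruct (functional_choice _ W) as [w Hw]. clear W.
  destruct (dyadic_l2_bound w) as [Ny Ly]; [intros n; apply Hw|intros n; apply Hw|].
  cbv zeta in Ny, Ly. set (y := vseries _) in *. exists y. split; [exact Ny|].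
  intros x X Nx E. destruct (pow2_unbounded X) as [n Hn].
  destruct (Hw n) as (Pw & Nw & Sw & Aw). specialize (Ly n).
  set (w' := w n) in *.
  assert (P2 : 0 < (/ 2) ^ n) by (apply pow_lt; lra).
  destruct (inner_ex w' w' 1 1 Nw Nw) as [E1 _].
  destruct (inner_ex y w' 2 1 Ny Nw) as [E2 _].
  assert (L1 : (/ 2) ^ n <= Series (fun i => y i * w' i)).
  { apply Rle_trans with ((/ 2) ^ n * Series (fun i => w' i * w' i)); [nra|].
    rewrite <- Series_scal_l. apply Series_le_nonneg; [|exact E2].
    intros i. specialize (Pw i). specialize (Ly i). split.
    - apply Rmult_le_pos; [lra|nra].
    - rewrite <- Rmult_assoc. apply Rmult_le_compat_r; auto. }
  destruct (inner_ex (mat_app h x) w' (M * X) 1 (mat_app_l2_bound h M x X B Nx) Nw) as [E3 _].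
  destruct (inner_ex x w' X 1 Nx Nw) as [E4 _].
  destruct (inner_ex x (mat_app (transpose h) w') X (M * 1) Nx (mat_app_l2_bound _ M _ _ Bt Nw)) as [E5 _].
  (* If [(h - g) x = y], moving [h - g] to the other side of the pairing gives [2^-n <= <y, w_n> =
     <x, (h^T - g) w_n> <= X 4^-n], so [2^n <= X], against the choice of [n]. *)
  assert (L2 : Series (fun i => y i * w' i) = Series (fun i => x i * (mat_app (transpose h) w' i - g * w' i))).
  { rewrite (Series_ext _ (fun i => 1 * (mat_app h x i * w' i) + (- g) * (x i * w' i))).
    2:{ intros i. rewrite <- E. ring. }
    rewrite (Series_ext (fun i => x i * (mat_app (transpose h) w' i - g * w' i))
      (fun i => 1 * (x i * mat_app (transpose h) w' i) + (- g) * (x i * w' i))) by (intros; ring).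
    rewrite (proj2 (ex_series_lin 1 (- g) _ _ E3 E4)), (proj2 (ex_series_lin 1 (- g) _ _ E5 E4)).
    rewrite (inner_mat_app_transpose h M x w' X 1 B Nx Nw). reflexivity. }
  destruct (inner_ex _ _ X ((/ 4) ^ n) Nx Aw) as [_ L3]. cbv beta in L3. rewrite <- L2 in L3.
  pose proof (Rle_abs (Series (fun i => y i * w' i))) as L4.
  assert (Q : (/ 4) ^ n = (/ 2) ^ n * (/ 2) ^ n) by (rewrite <- Rpow_mult_distr; f_equal; lra).
  assert (L5 : (/ 2) ^ n * 1 <= (/ 2) ^ n * (X * (/ 2) ^ n)) by (rewrite Q in L3; lra).
  apply Rmult_le_reg_l in L5; [|exact P2].
  assert (T : (/ 2) ^ n * 2 ^ n = 1) by (rewrite <- Rpow_mult_distr, Rinv_l, pow1 by lra; reflexivity).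
  assert (0 < 2 ^ n) by (apply pow_lt; lra). nra.
Qed.

(* The witness is the growth rate [g = inf {t | power_growth h t}]. *)
Lemma growth_in_spectrum h M s : op_bound h M -> 0 < s -> ~ power_growth h s ->
  exists g, s <= g /\ exists y, l2_bound y 2 /\ forall x X, l2_bound x X -> ~ (forall i, mat_app h x i - g * x i = y i).
Proof.
  intros B Hs NG. pose proof (op_bound_pos _ _ B) as PM.
  (* [completeness] provides suprema, so the infimum of the growth rates is taken through
     negation. *)
  set (E := fun u => power_growth h (- u)).
  assert (Low : forall t, power_growth h t -> s <= t).
  { intros t G. apply Rnot_lt_le. intros L. apply NG, (power_growth_mono h t s G). lra. }
  destruct (completeness E) as [u [Hu1 Hu2]].
  - exists (- s). intros u G. apply Low in G. lra.
  - exists (- (M + 1)). unfold E. rewrite Ropp_involutive. apply (power_growth_op_bound h M); auto; lra.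
  - assert (Hsu : s <= - u).
    { assert (u <= - s); [|lra]. apply Hu2. intros v G. apply Low in G. lra. }
    exists (- u). split; [exact Hsu|]. apply (not_surjective h M); auto; [lra| |].
    + intros t Ht. apply NNPP. intros N.
      assert (u <= - t); [|lra]. apply Hu2. intros v G. apply Rnot_lt_le. intros L.
      apply N, (power_growth_mono h (- v) t G). lra.
    + intros t Ht G. assert (- t <= u); [|lra]. apply Hu1. unfold E. rewrite Ropp_involutive. exact G.
Qed.

(** * The spectrum of a nonnegative matrix *)

(** The value is [- l^-(n+1)], the coefficient of [A^n] in the expansion of [(A - l)^-1]. *)
Fixpoint neumann_coef (l : C) (n : nat) : C :=
  match n with O => Copp (Cinv l) | S k => Cmult (Cinv l) (neumann_coef l k) end.

Lemma neumann_coef_Cmod l n : l <> RtoC 0 -> Cmod (neumann_coef l n) = (/ Cmod l) ^ S n.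
Proof.
  intros Hl. induction n as [|n IH].
  - simpl. rewrite Cmod_opp, Cmod_inv by exact Hl. ring.
  - cbn [neumann_coef]. rewrite Cmod_mult, IH, Cmod_inv by exact Hl. reflexivity.
Qed.

Lemma neumann_coef_succ l n : l <> RtoC 0 -> Cmult l (neumann_coef l (S n)) = neumann_coef l n.
Proof. intros Hl. simpl. rewrite Cmult_assoc, Cinv_r by exact Hl. apply Cmult_1_l. Qed.

Lemma neumann_coef_0 l : l <> RtoC 0 -> Cmult l (neumann_coef l 0) = RtoC (-1).
Proof.
  intros Hl. simpl. replace (Cmult l (Copp (/ l)%C)) with (Copp (Cmult l (/ l)%C)) by ring.
  rewrite Cinv_r by exact Hl. apply injective_projections; simpl; ring.
Qed.

Lemma Re_Cmod z : Rabs (Re z) <= Cmod z.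
Proof. eapply Rle_trans; [apply Rmax_l|apply Rmax_Cmod]. Qed.

Lemma Im_Cmod z : Rabs (Im z) <= Cmod z.
Proof. eapply Rle_trans; [apply Rmax_r|apply Rmax_Cmod]. Qed.

Lemma mat_app_neumann h M s (l : C) (c : nat -> R) y Y : op_bound h M -> power_growth h s -> s < Cmod l ->
  l2_bound y Y -> (forall n, Rabs (c n) <= (/ Cmod l) ^ S n) ->
  let z := vseries (fun n i => c n * mat_app (mat_pow h n) y i) in
  (exists Z, l2_bound z Z) /\ (forall i, ex_series (fun n => c n * mat_app (mat_pow h n) y i)) /\
  forall i, mat_app h z i = Series (fun n => c n * mat_app (mat_pow h (S n)) y i).
Proof.
  intros B G L Hy Hc z.
  destruct (neumann_bounds h M s (Cmod l) c y Y B G L Hy Hc) as (m & K & Hv & Hm).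
  split; [|split].
  - exists K. apply (vseries_l2_bound _ m K Hv Hm).
  - intros i. apply ex_series_Rabs, (vseries_abs_l2_bound _ m K Hv Hm).
  - intros i. unfold z. rewrite (mat_app_vseries h M _ m K i B Hv Hm). apply Series_ext. intros n.
    rewrite (mat_app_mat_pow_succ h M n y Y i B Hy).
    transitivity (mat_app h (fun j => c n * mat_app (mat_pow h n) y j + 0 * 0) i).
    { apply Series_ext. intros; ring. }
    rewrite (mat_app_lin h M (mat_app (mat_pow h n) y) (fun _ => 0) (M ^ n * Y) 0 (c n) 0 i B
      (mat_app_l2_bound _ _ _ _ (mat_pow_op_bound h M n B) Hy) l2_bound_zero). ring.
Qed.

(** Solves [(h - l)(zr + i zi) = y] for real [y]. As [l c_(n+1) = c_n], the series for [h z] and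
    [l z] cancel except for the term [- l c_0 y = y]. *)
Lemma neumann_surjective h M s (l : C) y Y : op_bound h M -> power_growth h s -> s < Cmod l -> l2_bound y Y ->
  exists zr zi, (exists Z, l2_bound zr Z) /\ (exists Z, l2_bound zi Z) /\ forall i,
    mat_app h zr i - (Re l * zr i - Im l * zi i) = y i /\
    mat_app h zi i - (Re l * zi i + Im l * zr i) = 0.
Proof.
  intros B G L Hy.
  assert (Hl : l <> RtoC 0).
  { intros ->. rewrite Cmod_0 in L. destruct G. lra. }
  set (c := neumann_coef l).
  destruct (mat_app_neumann h M s l (fun n => Re (c n)) y Y B G L Hy) as (Nr & Er & Ar).
  { intros n. rewrite <- (neumann_coef_Cmod l n Hl). apply Re_Cmod. }
  destruct (mat_app_neumann h M s l (fun n => Im (c n)) y Y B G L Hy) as (Ni & Ei & Ai).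
  { intros n. rewrite <- (neumann_coef_Cmod l n Hl). apply Im_Cmod. }
  set (zr := vseries (fun n i => Re (c n) * mat_app (mat_pow h n) y i)) in *.
  set (zi := vseries (fun n i => Im (c n) * mat_app (mat_pow h n) y i)) in *.
  exists zr, zi. split; [exact Nr|]. split; [exact Ni|]. intros i.
  assert (R0 := f_equal Re (neumann_coef_0 l Hl)). assert (I0 := f_equal Im (neumann_coef_0 l Hl)).
  rewrite re_mult, re_RtoC in R0. rewrite im_mult, im_RtoC in I0. fold c in R0, I0.
  assert (RS : forall n, Re l * Re (c (S n)) - Im l * Im (c (S n)) = Re (c n)).
  { intros n. rewrite <- re_mult. unfold c. rewrite neumann_coef_succ by exact Hl. reflexivity. }
  assert (IS : forall n, Re l * Im (c (S n)) + Im l * Re (c (S n)) = Im (c n)).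
  { intros n. rewrite <- im_mult. unfold c. rewrite neumann_coef_succ by exact Hl. reflexivity. }
  split.
  - rewrite Ar. replace (Re l * zr i - Im l * zi i) with (Re l * zr i + (- Im l) * zi i) by ring.
    unfold zr, zi, vseries.
    destruct (ex_series_lin (Re l) (- Im l) _ _ (Er i) (Ei i)) as [E <-].
    rewrite (Series_incr_1 _ E). cbn [mat_pow]. rewrite mat_app_id_mat.
    rewrite (Series_ext (fun n => Re l * (Re (c (S n)) * mat_app (mat_mul h (mat_pow h n)) y i) + _)
      (fun n => Re (c n) * mat_app (mat_mul h (mat_pow h n)) y i)).
    2:{ intros n. rewrite <- (RS n). simpl. ring. }
    transitivity (- (Re l * Re (c O) - Im l * Im (c O)) * y i); [ring|]. rewrite R0. ring.
  - rewrite Ai. unfold zr, zi, vseries.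
    destruct (ex_series_lin (Re l) (Im l) _ _ (Ei i) (Er i)) as [E <-].
    rewrite (Series_incr_1 _ E). cbn [mat_pow]. rewrite mat_app_id_mat.
    rewrite (Series_ext (fun n => Re l * (Im (c (S n)) * mat_app (mat_mul h (mat_pow h n)) y i) + _)
      (fun n => Im (c n) * mat_app (mat_mul h (mat_pow h n)) y i)).
    2:{ intros n. rewrite <- (IS n). simpl. ring. }
    transitivity (- (Re l * Im (c O) + Im l * Re (c O)) * y i); [ring|]. rewrite I0. ring.
Qed.

(** By positivity, [h z = l z] gives [r u <= h u] for [u = |z|] and [r = |l|]. Iterating,
    [r^n u <= h^n u], whose entries are at most [C s^n U]; with [s < r] this leaves only [u = 0]. *)
Lemma neumann_injective h M s (l : C) (z : nat -> C) U : op_bound h M -> power_growth h s -> s < Cmod l ->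
  l2_bound (fun i => Cmod (z i)) U ->
  (forall i, mat_app h (fun j => Re (z j)) i = Re l * Re (z i) - Im l * Im (z i) /\
             mat_app h (fun j => Im (z j)) i = Re l * Im (z i) + Im l * Re (z i)) ->
  forall i, z i = RtoC 0.
Proof.
  intros B G L Hu E. destruct (power_growth_const _ _ G) as [C0 [PC HC]]. destruct G as [Hs _].
  set (u := fun i => Cmod (z i)) in *. set (r := Cmod l) in *.
  assert (Pu : forall i, 0 <= u i) by (intros; apply Cmod_ge_0).
  assert (Nr : l2_bound (fun j => Re (z j)) U) by (apply l2_bound_le with u; auto; intros; apply Re_Cmod).
  assert (Ni : l2_bound (fun j => Im (z j)) U) by (apply l2_bound_le with u; auto; intros; apply Im_Cmod).
  assert (Au : forall i, r * u i <= mat_app h u i).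
  { intros i. pose proof (mat_app_nonneg h M u U i B Hu Pu) as A0.
    destruct (Rle_lt_dec (r * u i) 0) as [K|K]; [lra|].
    (* Here [w = (h z)_i], so [|w|^2] is the [i]-th entry of [h] applied to the real vector
       [Re (w conj z_j)], which is at most [|w| u_j]. *)
    set (w := Cmult l (z i)). assert (Wm : Cmod w = r * u i) by apply Cmod_mult.
    destruct (E i) as [E1 E2]. rewrite <- re_mult in E1. rewrite <- im_mult in E2.
    fold w in E1, E2.
    apply Rmult_le_reg_l with (r * u i); [exact K|].
    assert (Wsq : (r * u i) * (r * u i) = Re w * Re w + Im w * Im w).
    { rewrite <- Wm. unfold Cmod. rewrite sqrt_def by nra. unfold Re, Im. ring. }
    rewrite Wsq. rewrite <- E1 at 2. rewrite <- E2 at 2.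
    rewrite <- (mat_app_lin h M _ _ U U (Re w) (Im w) i B Nr Ni).
    replace (r * u i * mat_app h u i) with (mat_app h (fun j => (r * u i) * u j + 0 * u j) i).
    2:{ rewrite (mat_app_lin h M u u U U (r * u i) 0 i B Hu Hu). ring. }
    apply (mat_app_mono h M _ _ (Rabs (Re w) * U + Rabs (Im w) * U)
       (Rabs (r * u i) * U + Rabs 0 * U) i B); try (apply l2_bound_plus; apply l2_bound_scal; assumption).
    intros j. rewrite Rmult_0_l, Rplus_0_r, <- Wm. unfold u.
    apply Rle_trans with (Rabs (Re (Cmult w (Cconj (z j))))).
    - replace (Re w * Re (z j) + Im w * Im (z j)) with (Re (Cmult w (Cconj (z j)))).
      + apply Rle_abs.
      + rewrite re_mult. unfold Cconj, Re, Im. simpl. ring.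
    - eapply Rle_trans; [apply Re_Cmod|]. rewrite Cmod_mult, Cmod_conj. lra. }
  assert (An : forall n i, r ^ n * u i <= mat_app (mat_pow h n) u i).
  { induction n as [|n IH]; intros i; [simpl; rewrite mat_app_id_mat; lra|].
    rewrite (mat_app_mat_pow_succ h M n u U i B Hu). simpl.
    apply Rle_trans with (r ^ n * mat_app h u i).
    - rewrite (Rmult_comm r), Rmult_assoc. apply Rmult_le_compat_l; [apply pow_le; lra|apply Au].
    - replace (r ^ n * mat_app h u i) with (mat_app h (fun j => r ^ n * u j + 0 * u j) i).
      2:{ rewrite (mat_app_lin h M u u U U (r ^ n) 0 i B Hu Hu). ring. }
      apply (mat_app_mono h M _ _ (Rabs (r ^ n) * U + Rabs 0 * U) (M ^ n * U) i B).
      + apply l2_bound_plus; apply l2_bound_scal; assumption.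
      + apply mat_app_l2_bound; auto using mat_pow_op_bound.
      + intros j. specialize (IH j). lra. }
  intros i. apply Cmod_eq_0. apply Rle_antisym; [|apply Pu]. apply Rnot_lt_le. intros Lt.
  change (0 < u i) in Lt. pose proof (l2_bound_pos _ _ Hu) as PU.
  (* The [+ 1] keeps the denominator positive when [C0 * U = 0]. *)
  destruct (pow_lt_1_zero (s / r)) with (y := u i / (C0 * U + 1)) as [N HN].
  { rewrite Rabs_pos_eq.
    - apply Rmult_lt_reg_r with r; [lra|]. unfold Rdiv. rewrite Rmult_assoc, Rinv_l by lra. lra.
    - apply Rlt_le, Rdiv_lt_0_compat; lra. }
  { apply Rdiv_lt_0_compat; nra. }
  specialize (HN N (le_n N)). specialize (An N i).
  assert (Q0 : 0 < s / r) by (apply Rdiv_lt_0_compat; lra).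
  assert (Qn : 0 < (s / r) ^ N) by (apply pow_lt, Q0).
  rewrite Rabs_pos_eq in HN by lra.
  assert (Rn : 0 < r ^ N) by (apply pow_lt; lra).
  assert (A2 : r ^ N * u i <= C0 * s ^ N * U).
  { eapply Rle_trans; [exact An|]. eapply Rle_trans; [apply Rle_abs|].
    apply l2_bound_entry. apply mat_app_l2_bound; auto. }
  replace (s ^ N) with ((s / r) ^ N * r ^ N) in A2 by (rewrite <- Rpow_mult_distr; f_equal; field; lra).
  assert (A3 : r ^ N * u i <= r ^ N * ((C0 * U) * (s / r) ^ N)) by lra.
  apply Rmult_le_reg_l in A3; [|exact Rn].
  assert (CU : 0 <= C0 * U) by (apply Rmult_le_pos; auto).
  apply Rmult_lt_compat_l with (r := C0 * U + 1) in HN; [|lra].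
  replace ((C0 * U + 1) * (u i / (C0 * U + 1))) with (u i) in HN by (field; lra). nra.
Qed.

(** * From index sets to total matrices *)

(* Entries outside the index set are arbitrary in [mat] and products do not preserve them;
   setting them to zero turns [mmul I] into [mat_mul]. *)
Definition zero_ext (I : idx) (a : mat) : mat := fun i j => if andb (inI I i) (inI I j) then a i j else 0.

Definition restr (I : idx) (x : nat -> R) : nat -> R := fun i => if inI I i then x i else 0.

Lemma matapp_zero_ext I a x i : matapp I a x i = mat_app (zero_ext I a) x i.
Proof.
  unfold matapp, mat_app, zero_ext, mrow. destruct (inI I i); simpl.
  - apply Series_ext. intros j. destruct (inI I j); ring.
  - symmetry. apply is_series_unique, is_series_fsum.
    apply is_lim_seq_ext with (fun _ => 0); [|apply is_lim_seq_const].
    intros n. rewrite (fsum_ext _ (fun _ => 0)), fsum_zero by (intros; ring). reflexivity.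
Qed.

Lemma mat_app_zero_ext_restr I a x : mat_app (zero_ext I a) (restr I x) = mat_app (zero_ext I a) x.
Proof.
  apply functional_extensionality; intros i. unfold mat_app, zero_ext, restr. apply Series_ext. intros j.
  destruct (inI I i), (inI I j); simpl; ring.
Qed.

Lemma mat_app_zero_ext_out I a x i : inI I i = false -> mat_app (zero_ext I a) x i = 0.
Proof. intros H. rewrite <- matapp_zero_ext. unfold matapp. rewrite H. reflexivity. Qed.

Lemma restr_l2_bound I x X : l2_bound x X -> l2_bound (restr I x) X.
Proof.
  intros H. apply l2_bound_le with (fun i => Rabs (x i)); [|apply l2_bound_abs, H].
  intros i. unfold restr. destruct (inI I i); [lra|]. rewrite Rabs_R0. apply Rabs_pos.
Qed.

Lemma restr_l2 I x X : l2_bound x X -> l2 I (restr I x).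
Proof.
  intros H. split.
  - intros i Hi. unfold restr. rewrite Hi. reflexivity.
  - apply l2_bound_l2. exists X. apply restr_l2_bound, H.
Qed.

Lemma zero_ext_mat_mul I a b : zero_ext I (mmul I a b) = mat_mul (zero_ext I a) (zero_ext I b).
Proof.
  apply functional_extensionality; intros i. apply functional_extensionality; intros j.
  unfold zero_ext at 1. unfold mat_mul, mmul. destruct (andb (inI I i) (inI I j)) eqn:E.
  - apply andb_prop in E. destruct E as [Ei Ej]. apply Series_ext. intros k.
    unfold zero_ext. rewrite Ei, Ej. destruct (inI I k); simpl; ring.
  - symmetry. apply is_series_unique, is_series_fsum.
    apply is_lim_seq_ext with (fun _ => 0); [|apply is_lim_seq_const].
    intros n. rewrite (fsum_ext _ (fun _ => 0)), fsum_zero; [reflexivity|].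
    intros k _. unfold zero_ext. destruct (inI I i), (inI I j), (inI I k); simpl in *; try discriminate; ring.
Qed.

Lemma zero_ext_nonneg_entries I a : nonneg_mat I a -> nonneg_entries (zero_ext I a).
Proof.
  intros H i j. unfold zero_ext. destruct (andb (inI I i) (inI I j)) eqn:E; [|lra].
  apply andb_prop in E. apply H; apply E.
Qed.

Lemma zero_ext_bounded I a : nonneg_mat I a -> defines_op I a -> exists C, op_bound (zero_ext I a) C.
Proof.
  intros Na D. apply op_bound_of_defined; [apply zero_ext_nonneg_entries, Na|].
  intros x X Px Nx. destruct (D _ (restr_l2 I x X Nx)) as [D1 D2]. split.
  - intros i. destruct (inI I i) eqn:Ei.
    + eapply ex_series_ext; [|apply (D1 i Ei)]. intros j. unfold mrow, restr, zero_ext. rewrite Ei.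
      destruct (inI I j); simpl; [reflexivity|]. symmetry. apply Rmult_0_l.
    + exists 0. apply is_series_fsum. apply is_lim_seq_ext with (fun _ => 0); [|apply is_lim_seq_const].
      intros n. rewrite (fsum_ext _ (fun _ => 0)), fsum_zero; [reflexivity|].
      intros k _. unfold zero_ext. rewrite Ei. apply Rmult_0_l.
  - destruct (proj2 (l2_bound_l2 _) (proj2 D2)) as [Y HY]. exists Y.
    apply (l2_bound_ext (matapp I a (restr I x))); [|exact HY].
    intros i. rewrite matapp_zero_ext, mat_app_zero_ext_restr. reflexivity.
Qed.

(* [sup_over] is [0] on the empty set and on unbounded sets. *)
Lemma sup_over_le P c : 0 <= c -> (forall r, P r -> r <= c) -> sup_over P <= c.
Proof.
  intros Hc H. unfold sup_over. destruct (Lub_Rbar_correct P) as [_ L].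
  specialize (L (Finite c) (fun r Hr => H r Hr)).
  destruct (Lub_Rbar P); simpl in *; auto; contradiction.
Qed.

Lemma sup_over_ub P c r : (forall r, P r -> r <= c) -> P r -> r <= sup_over P.
Proof.
  intros H Hr. unfold sup_over. destruct (Lub_Rbar_correct P) as [U L].
  specialize (L (Finite c) (fun r Hr => H r Hr)). specialize (U r Hr).
  destruct (Lub_Rbar P); simpl in *; auto; contradiction.
Qed.

Lemma sup_over_nonneg P : (forall r, P r -> 0 <= r) -> 0 <= sup_over P.
Proof.
  intros H. unfold sup_over. destruct (Lub_Rbar_correct P) as [U L].
  destruct (classic (exists r, P r)) as [[r Hr]|E].
  - specialize (U r Hr). specialize (H r Hr). destruct (Lub_Rbar P); simpl in *; lra.
  - specialize (L m_infty). destruct (Lub_Rbar P); simpl in *; try lra.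
    exfalso. apply L. intros x Hx. apply E. exists x. exact Hx.
Qed.

(** * Operator norm and spectral radius through zero extension *)

Lemma opnorm_set_le I a C : op_bound (zero_ext I a) C ->
  forall r, (exists x, l2 I x /\ l2norm x <= 1 /\ r = l2norm (matapp I a x)) -> r <= C.
Proof.
  intros B r (x & [_ E] & L & ->). apply (l2norm_le x 1 ltac:(lra) E) in L.
  assert (N : l2_bound (matapp I a x) C).
  { apply l2_bound_ext with (mat_app (zero_ext I a) x); [intros; symmetry; apply matapp_zero_ext|].
    replace C with (C * 1) by ring. apply mat_app_l2_bound; auto. }
  apply l2norm_le; [apply (op_bound_pos _ _ B)| |exact N]. apply l2_bound_l2. exists C. exact N.
Qed.

Lemma opnorm_nonneg I a : 0 <= opnorm I a.
Proof. apply sup_over_nonneg. intros r (x & _ & _ & ->). apply sqrt_pos. Qed.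

Lemma opnorm_le I a C : op_bound (zero_ext I a) C -> opnorm I a <= C.
Proof. intros B. apply sup_over_le; [apply (op_bound_pos _ _ B)|apply opnorm_set_le, B]. Qed.

(** Some bound [C] must be known first: were the supremum infinite, [opnorm] would read [0]. *)
Lemma opnorm_op_bound I a C : op_bound (zero_ext I a) C -> op_bound (zero_ext I a) (opnorm I a).
Proof.
  intros B. apply op_bound_of_unit; [apply (op_bound_nonneg_entries _ _ B)|apply opnorm_nonneg|].
  intros N x y Px Py Nx Ny.
  pose proof (mat_app_l2_bound _ _ _ _ B Nx) as Nax.
  assert (E : ex_series (fun i => mat_app (zero_ext I a) x i ^ 2)) by (apply l2_bound_l2; eexists; apply Nax).
  apply Rle_trans with (1 * l2norm (mat_app (zero_ext I a) x)).
  - eapply Rle_trans; [|apply (l2_bound_inner y _ 1 _ N Ny (l2_bound_l2norm _ E))].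
    apply fsum_le. intros i _. eapply Rle_trans; [|apply Rle_abs].
    apply Rmult_le_compat_l; [apply Py|].
    apply (fsum_le_Series (fun j => zero_ext I a i j * x j)); [|apply (mat_app_ex _ C x 1 i B Nx)].
    intros j. apply Rmult_le_pos; [apply (op_bound_nonneg_entries _ _ B)|apply Px].
  - rewrite Rmult_1_l. apply (sup_over_ub _ C); [apply opnorm_set_le, B|].
    exists (restr I x). split; [apply (restr_l2 I x 1 Nx)|]. split.
    + pose proof (restr_l2_bound I x 1 Nx) as Nr. apply l2norm_le; [lra| |exact Nr].
      apply l2_bound_l2. exists 1. exact Nr.
    + f_equal. apply functional_extensionality. intros i.
      rewrite matapp_zero_ext, mat_app_zero_ext_restr. reflexivity.
Qed.

Lemma l2c_l2_bound I z : l2c I z -> exists U, l2_bound (fun i => Cmod (z i)) U.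
Proof. intros [_ E]. apply l2_bound_l2, E. Qed.

Lemma spectrum_le_growth I a M s l : op_bound (zero_ext I a) M -> power_growth (zero_ext I a) s ->
  in_spectrum I a l -> Cmod l <= s.
Proof.
  intros B G H. apply Rnot_lt_le. intros L. apply H. clear H.
  assert (Hl : 0 < Cmod l) by (destruct G; lra).
  split.
  - intros z Hz E. destruct (l2c_l2_bound I z Hz) as [U HU].
    apply (neumann_injective (zero_ext I a) M s l z U B G L HU).
    intros i. specialize (E i). unfold mactc in E. rewrite !matapp_zero_ext in E.
    assert (E1 := f_equal Re E). assert (E2 := f_equal Im E).
    unfold Cminus, Cplus, Copp, Cmult, Re, Im, RtoC in *. simpl in *. lra.
  - intros y Hy. destruct (l2c_l2_bound I y Hy) as [U HU].
    assert (Nr : l2_bound (fun j => Re (y j)) U) by (eapply l2_bound_le; [|exact HU]; intros; apply Re_Cmod).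
    assert (Ni : l2_bound (fun j => Im (y j)) U) by (eapply l2_bound_le; [|exact HU]; intros; apply Im_Cmod).
    destruct (neumann_surjective _ M s l _ U B G L Nr) as (ar & ai & [Ar HAr] & [Ai HAi] & Ea).
    destruct (neumann_surjective _ M s l _ U B G L Ni) as (br & bi & [Br HBr] & [Bi HBi] & Eb).
    (* With [a] and [b] solving for [Re y] and [Im y], this is [a + i b]. *)
    set (z := fun i => (1 * ar i + (-1) * bi i, 1 * ai i + 1 * br i) : C).
    assert (E : forall i, Cminus (mactc I a z i) (Cmult l (z i)) = y i).
    { intros i. destruct (Ea i) as [Ea1 Ea2]. destruct (Eb i) as [Eb1 Eb2].
      unfold mactc. rewrite !matapp_zero_ext. unfold z, Re at 1, Im at 1. cbn [fst snd].
      rewrite (mat_app_lin _ M ar bi Ar Bi 1 (-1) i B HAr HBi), (mat_app_lin _ M ai br Ai Br 1 1 i B HAi HBr).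
      apply injective_projections; unfold Cminus, Cplus, Copp, Cmult, Re, Im in *; simpl in *; lra. }
    exists z. split; [split|exact E].
    (* Outside the index set the matrix acts as zero and [y] vanishes, so the equation reads
       [l z_i = 0] with [l] nonzero. *)
    + intros i Hi. specialize (E i).
      rewrite (proj1 Hy i Hi) in E. unfold mactc in E. rewrite !matapp_zero_ext, !(mat_app_zero_ext_out I a _ i Hi) in E.
      assert (Z : Cmult l (z i) = RtoC 0).
      { apply injective_projections; [apply (f_equal Re) in E|apply (f_equal Im) in E];
        unfold Cminus, Cplus, Copp, Cmult, Re, Im, RtoC in *; simpl in *; lra. }
      apply Cmod_eq_0. apply (f_equal Cmod) in Z. rewrite Cmod_mult, Cmod_0 in Z.
      apply Rmult_integral in Z. destruct Z as [Z|Z]; [lra|exact Z].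
    + assert (N1 : ex_series (fun i => (1 * ar i + (-1) * bi i) ^ 2)).
      { apply l2_bound_l2. eexists. apply l2_bound_plus; apply l2_bound_scal; eassumption. }
      assert (N2 : ex_series (fun i => (1 * ai i + 1 * br i) ^ 2)).
      { apply l2_bound_l2. eexists. apply l2_bound_plus; apply l2_bound_scal; eassumption. }
      eapply ex_series_ext; [|apply (proj1 (ex_series_lin 1 1 _ _ N1 N2))].
      intros i. unfold Cmod. rewrite pow2_sqrt by (apply Rplus_le_le_0_compat; apply pow2_ge_0).
      unfold z. cbn [fst snd]. ring_simplify. reflexivity.
Qed.

Lemma specrad_nonneg I a : 0 <= specrad I a.
Proof. apply sup_over_nonneg. intros r (l & _ & ->). apply Cmod_ge_0. Qed.

Lemma specrad_le_growth I a M s : op_bound (zero_ext I a) M -> power_growth (zero_ext I a) s -> specrad I a <= s.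
Proof.
  intros B G. apply sup_over_le; [destruct G; lra|]. intros r (l & H & ->).
  apply (spectrum_le_growth I a M s l B G H).
Qed.

Lemma growth_of_specrad I a M s : op_bound (zero_ext I a) M -> specrad I a < s -> power_growth (zero_ext I a) s.
Proof.
  intros B L. pose proof (specrad_nonneg I a) as S0. apply NNPP. intros NG.
  destruct (growth_in_spectrum (zero_ext I a) M s B ltac:(lra) NG) as (g & Hg & y & Hy & Hsurj).
  assert (Sp : in_spectrum I a (RtoC g)).
  { intros [_ Surj]. pose proof (restr_l2_bound I y 2 Hy) as Hr.
    destruct (Surj (fun i => RtoC (restr I y i))) as (z & Hz & E).
    - split.
      + intros i Hi. unfold restr. rewrite Hi. reflexivity.
      + eapply ex_series_ext; [|apply l2_bound_l2; exists 2; apply l2_bound_abs, Hr].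
        intros i. rewrite Cmod_R. reflexivity.
    - destruct (l2c_l2_bound I z Hz) as [U HU].
      (* The unreachable [y] may be nonzero outside the index set, whereas [z] solves the equation
         for [restr I y]. Outside, the zero extension minus [g] is multiplication by [- g], so
         adding [- y / g] there gives a solution for [y] itself. *)
      set (x := fun i => Re (z i) + (- / g) * (y i - restr I y i)).
      apply (Hsurj x (U + Rabs (- / g) * (2 + Rabs (-1) * 2))).
      + apply l2_bound_plus; [eapply l2_bound_le; [|exact HU]; intros; apply Re_Cmod|].
        apply l2_bound_scal.
        apply l2_bound_ext with (fun i => y i + (-1) * restr I y i); [intros; ring|].
        apply l2_bound_plus; auto. apply l2_bound_scal, Hr.
      + assert (Rx : restr I x = restr I (fun i => Re (z i))).
        { apply functional_extensionality; intros i. unfold x, restr. destruct (inI I i); ring. }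
        intros i. rewrite <- mat_app_zero_ext_restr, Rx, mat_app_zero_ext_restr.
        destruct (inI I i) eqn:Ei.
        * specialize (E i). unfold mactc in E. rewrite !matapp_zero_ext in E.
          apply (f_equal Re) in E. unfold x, restr in *. rewrite Ei in *.
          unfold Cminus, Cplus, Copp, Cmult, Re, Im, RtoC in *. simpl in *. lra.
        * rewrite (mat_app_zero_ext_out I a _ i Ei). unfold x, restr. rewrite Ei, (proj1 Hz i Ei).
          rewrite re_RtoC. field. lra. }
  assert (g <= specrad I a); [|lra].
  (* The spectrum must be bounded for the supremum to be finite; [M + 1] is used because a growth
     rate has to be positive and [M] may be [0]. *)
  apply (sup_over_ub _ (M + 1)).
  - intros r (l & H & ->). apply (spectrum_le_growth I a M (M + 1) l B); auto.
    pose proof (op_bound_pos _ _ B). apply (power_growth_op_bound _ M); auto; lra.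
  - exists (RtoC g). split; [exact Sp|]. rewrite Cmod_R, Rabs_pos_eq; lra.
Qed.

Lemma specrad_le_opnorm I a M : op_bound (zero_ext I a) M -> specrad I a <= opnorm I a.
Proof.
  intros B. apply opnorm_op_bound in B. pose proof (opnorm_nonneg I a).
  (* The norm may be [0], and growth rates are positive. *)
  apply le_epsilon. intros e He.
  apply (specrad_le_growth I a (opnorm I a) _ B). apply (power_growth_op_bound _ _ _ B); lra.
Qed.

(** * Powers with nonnegative base *)

Lemma hpow_0_r x : hpow x 0 = 1.
Proof. unfold hpow. destruct (Req_EM_T 0 0); [reflexivity|contradiction]. Qed.

Lemma hpow_0_l y : y <> 0 -> hpow 0 y = 0.
Proof.
  intros H. unfold hpow. destruct (Req_EM_T y 0); [contradiction|].
  destruct (Req_EM_T 0 0); [reflexivity|contradiction].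
Qed.

Lemma hpow_pos x y : 0 < x -> hpow x y = Rpower x y.
Proof.
  intros H. unfold hpow. destruct (Req_EM_T y 0) as [->|_].
  - symmetry. apply Rpower_O, H.
  - destruct (Req_EM_T x 0); [lra|reflexivity].
Qed.

Lemma hpow_gt0 x y : 0 < x -> 0 < hpow x y.
Proof. intros H. rewrite hpow_pos by exact H. apply exp_pos. Qed.

Lemma hpow_nonneg x y : 0 <= hpow x y.
Proof.
  unfold hpow. destruct (Req_EM_T y 0); [lra|]. destruct (Req_EM_T x 0); [lra|].
  apply Rlt_le, exp_pos.
Qed.

Lemma hpow_1_l y : hpow 1 y = 1.
Proof. rewrite hpow_pos by lra. unfold Rpower. rewrite ln_1, Rmult_0_r, exp_0. reflexivity. Qed.

Lemma hpow_1_r x : 0 <= x -> hpow x 1 = x.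
Proof.
  intros [H|<-].
  - rewrite hpow_pos by exact H. apply Rpower_1, H.
  - apply hpow_0_l. lra.
Qed.

Lemma hpow_mono x x' y : 0 <= x <= x' -> 0 <= y -> hpow x y <= hpow x' y.
Proof.
  intros [[H|<-] L] Hy.
  - rewrite !hpow_pos by lra. apply Rle_Rpower_l; lra.
  - destruct (Req_dec y 0) as [->|N]; [rewrite !hpow_0_r; lra|].
    rewrite hpow_0_l by exact N. apply hpow_nonneg.
Qed.

Lemma hpow_mult x x' y : 0 <= x -> 0 <= x' -> hpow (x * x') y = hpow x y * hpow x' y.
Proof.
  intros Hx Hx'. destruct (Req_dec y 0) as [->|N]; [rewrite !hpow_0_r; ring|].
  destruct Hx as [Hx|<-]; [|rewrite Rmult_0_l, !hpow_0_l by exact N; ring].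
  destruct Hx' as [Hx'|<-]; [|rewrite Rmult_0_r, !hpow_0_l by exact N; ring].
  assert (0 < x * x') by (apply Rmult_lt_0_compat; auto).
  rewrite !hpow_pos by assumption. symmetry. apply Rpower_mult_distr; auto.
Qed.

Lemma hpow_hpow x y z : 0 <= x -> hpow (hpow x y) z = hpow x (y * z).
Proof.
  intros Hx. destruct (Req_dec y 0) as [->|Ny].
  { rewrite Rmult_0_l, !hpow_0_r. apply hpow_1_l. }
  destruct (Req_dec z 0) as [->|Nz].
  { rewrite Rmult_0_r, !hpow_0_r. reflexivity. }
  destruct Hx as [Hx|<-].
  - rewrite (hpow_pos (hpow x y)) by (apply hpow_gt0, Hx). rewrite !hpow_pos by exact Hx.
    apply Rpower_mult.
  - rewrite (hpow_0_l y Ny), (hpow_0_l z Nz). symmetry. apply hpow_0_l.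
    intros E. apply Rmult_integral in E. tauto.
Qed.

Lemma hpow_plus x y z : 0 <= x -> 0 <= y -> 0 <= z -> hpow x (y + z) = hpow x y * hpow x z.
Proof.
  intros [Hx|<-] Hy Hz.
  - rewrite !hpow_pos by exact Hx. apply Rpower_plus.
  - destruct (Req_dec y 0) as [->|Ny]; [rewrite hpow_0_r, Rplus_0_l; ring|].
    rewrite !hpow_0_l by lra. destruct (Req_dec z 0) as [->|Nz]; [rewrite hpow_0_r; ring|].
    rewrite hpow_0_l by exact Nz. ring.
Qed.

Lemma hpow_pow x y n : 0 <= x -> hpow (x ^ n) y = hpow x y ^ n.
Proof.
  intros Hx. induction n as [|n IH]; simpl; [apply hpow_1_l|].
  rewrite hpow_mult, IH by (auto using pow_le). reflexivity.
Qed.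

Lemma hpow_nat x n : 0 <= x -> hpow x (INR n) = x ^ n.
Proof.
  intros Hx. induction n as [|n IH]; [apply hpow_0_r|].
  rewrite S_INR, hpow_plus, IH, hpow_1_r by (auto using pos_INR; lra). simpl. ring.
Qed.

Lemma hpow_le_self x y : 0 <= x <= 1 -> 1 <= y -> hpow x y <= x.
Proof.
  intros Hx Hy. replace y with (1 + (y - 1)) by ring.
  rewrite hpow_plus, hpow_1_r by lra.
  pose proof (hpow_mono x 1 (y - 1) Hx ltac:(lra)) as L. rewrite hpow_1_l in L.
  pose proof (hpow_nonneg x (y - 1)). nra.
Qed.

(** Right continuity of [s^p], also at [S = 0]. Otherwise [S] lies below [x^(1/p)], and the midpoint
    of the two contradicts the hypothesis. It is used to let growth rates and eventual bounds
    decrease to [S]. *)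
Lemma hpow_limit x S p : 0 <= S -> 0 < p -> (forall s, S < s -> x <= hpow s p) -> x <= hpow S p.
Proof.
  intros HS Hp H. destruct (Rle_lt_dec x 0) as [Hx|Hx].
  { eapply Rle_trans; [exact Hx|apply hpow_nonneg]. }
  apply Rnot_lt_le. intros L.
  set (s' := hpow x (/ p)).
  assert (E : hpow s' p = x).
  { unfold s'. rewrite hpow_hpow, Rinv_l by lra. apply hpow_1_r. lra. }
  assert (Ps : 0 < s') by (apply hpow_gt0, Hx).
  assert (Lt : S < s').
  { apply Rnot_le_lt. intros L'.
    pose proof (hpow_mono s' S p ltac:(lra) ltac:(lra)). lra. }
  specialize (H ((S + s') / 2) ltac:(lra)).
  assert (hpow ((S + s') / 2) p < hpow s' p); [|lra].
  rewrite !hpow_pos by lra. apply Rlt_Rpower_l; lra.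
Qed.

(** Concavity of [ln]: its graph lies below the tangent at [m]. *)
Lemma ln_le_tangent p m : 0 < p -> 0 < m -> ln p <= ln m + (p / m - 1).
Proof.
  intros Hp Hm. assert (Q : 0 < p / m) by (apply Rdiv_lt_0_compat; auto).
  assert (ln (p / m) <= p / m - 1).
  { rewrite <- (ln_exp (p / m - 1)). pose proof (exp_ineq1_le (p / m - 1)).
    destruct (Rle_lt_or_eq_dec (p / m) (exp (p / m - 1))) as [L|L]; [lra| |].
    - apply Rlt_le, ln_increasing; auto.
    - rewrite <- L. lra. }
  rewrite ln_div in H by auto. lra.
Qed.

(* Weighted AM-GM; the excess [al + be - 1] of the exponents only helps since [p, q <= 1]. *)
Lemma weighted_amgm al be p q : 0 <= al -> 0 <= be -> 1 <= al + be -> 0 <= p <= 1 -> 0 <= q <= 1 ->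
  hpow p al * hpow q be <= al / (al + be) * p + be / (al + be) * q.
Proof.
  intros Ha Hb Hab Hp Hq. set (g := al + be) in *.
  assert (Ig : 0 < / g) by (apply Rinv_0_lt_compat; lra).
  assert (Wa : 0 <= al / g) by (apply Rmult_le_pos; lra).
  assert (Wb : 0 <= be / g) by (apply Rmult_le_pos; lra).
  assert (W1 : al / g + be / g = 1) by (unfold g; field; unfold g in *; lra).
  assert (R0 : 0 <= al / g * p + be / g * q) by (apply Rplus_le_le_0_compat; apply Rmult_le_pos; lra).
  (* Zero exponents are treated apart because [hpow 0 0 = 1]; otherwise a zero base makes the left
     side vanish. *)
  destruct (Req_dec al 0) as [Za|Na].
  { rewrite Za in *. rewrite hpow_0_r. replace (be / g) with 1 by lra.
    pose proof (hpow_le_self q be Hq ltac:(unfold g in *; lra)). lra. }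
  destruct (Req_dec be 0) as [Zb|Nb].
  { rewrite Zb in *. rewrite hpow_0_r. replace (al / g) with 1 by lra.
    pose proof (hpow_le_self p al Hp ltac:(unfold g in *; lra)). lra. }
  destruct (proj1 Hp) as [Pp|<-]; [|rewrite (hpow_0_l al Na); lra].
  destruct (proj1 Hq) as [Pq|<-]; [|rewrite (hpow_0_l be Nb); lra].
  set (m := al / g * p + be / g * q).
  assert (Hm : 0 < m).
  { unfold m. assert (0 < al / g) by (apply Rdiv_lt_0_compat; lra).
    assert (0 < al / g * p) by (apply Rmult_lt_0_compat; auto).
    assert (0 <= be / g * q) by (apply Rmult_le_pos; lra). lra. }
  assert (Hm1 : m <= 1) by (unfold m; nra).
  rewrite !hpow_pos by assumption. unfold Rpower. rewrite <- exp_plus, <- (exp_ln m Hm).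
  assert (Lm : ln m <= 0).
  { rewrite <- ln_1. destruct Hm1 as [L| -> ]; [apply Rlt_le, ln_increasing; auto|lra]. }
  assert (X : al * ln p + be * ln q <= ln m).
  { pose proof (ln_le_tangent p m Pp Hm) as Tp. pose proof (ln_le_tangent q m Pq Hm) as Tq.
    apply Rmult_le_compat_l with (r := al) in Tp; [|lra].
    apply Rmult_le_compat_l with (r := be) in Tq; [|lra].
    (* The linear terms cancel because the tangent point [m] is the weighted mean. What remains is
       [g ln m <= ln m], from [g >= 1] and [ln m <= 0]. *)
    assert (Z : al * (p / m - 1) + be * (q / m - 1) = 0).
    { assert (Em : al * p + be * q = g * m) by (unfold m; field; lra).
      replace (al * (p / m - 1) + be * (q / m - 1)) with ((al * p + be * q) / m - g)
        by (unfold g; field; lra).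
      rewrite Em. field. lra. }
    apply Rle_trans with (g * ln m); [unfold g in *; lra|]. nra. }
  destruct X as [X| ->]; [apply Rlt_le, exp_increasing, X|lra].
Qed.

(** Hölder's inequality with exponents summing to at least one. The terms [u_k / U] and [v_k / V]
    lie in [[0,1]] and have sums at most [1], so AM-GM can be applied termwise and summed. *)
Lemma holder_fsum al be u v U V n : 0 <= al -> 0 <= be -> 1 <= al + be ->
  (forall k, 0 <= u k) -> (forall k, 0 <= v k) -> fsum u n <= U -> fsum v n <= V ->
  fsum (fun k => hpow (u k) al * hpow (v k) be) n <= hpow U al * hpow V be.
Proof.
  intros Ha Hb Hab Hu Hv HU HV.
  assert (D : forall w W, (forall k, 0 <= w k) -> fsum w n <= W ->
    (forall k, (k < n)%nat -> 0 <= / W * w k <= 1 /\ w k = W * (/ W * w k)) /\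
    fsum (fun k => / W * w k) n <= 1 /\ 0 <= W).
  { intros w W Hw HW. assert (PW : 0 <= W) by (eapply Rle_trans; [apply (fsum_nonneg w n Hw)|exact HW]).
    split; [|split; [|exact PW]].
    - intros k Hk. pose proof (fsum_term w n k Hw Hk) as Tk. specialize (Hw k).
      destruct (Req_dec W 0) as [ZW|NW].
      (* With [W = 0] the convention [/ 0 = 0] is harmless, because [w k] vanishes too. *)
      + rewrite ZW, Rinv_0, !Rmult_0_l. rewrite ZW in HW. split; lra.
      + assert (0 < / W) by (apply Rinv_0_lt_compat; lra). repeat split.
        * apply Rmult_le_pos; lra.
        * apply Rmult_le_reg_l with W; [lra|]. rewrite <- Rmult_assoc, Rinv_r by exact NW. lra.
        * field. exact NW.
    - rewrite fsum_scal. destruct (Req_dec W 0) as [ZW|NW].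
      + rewrite ZW, Rinv_0. lra.
      + apply Rmult_le_reg_l with W; [lra|]. rewrite <- Rmult_assoc, Rinv_r by exact NW. lra. }
  destruct (D u U Hu HU) as (Du & Su & PU). destruct (D v V Hv HV) as (Dv & Sv & PV).
  apply Rle_trans with (fsum (fun k => (hpow U al * hpow V be) *
     (al / (al + be) * (/ U * u k) + be / (al + be) * (/ V * v k))) n).
  - apply fsum_le. intros k Hk. destruct (Du k Hk) as [Bu Eu]. destruct (Dv k Hk) as [Bv Ev].
    transitivity (hpow U al * hpow V be * (hpow (/ U * u k) al * hpow (/ V * v k) be)).
    { right. cbv beta. rewrite Eu at 1. rewrite Ev at 1.
      rewrite (hpow_mult U (/ U * u k)), (hpow_mult V (/ V * v k)) by lra. ring. }
    apply Rmult_le_compat_l; [apply Rmult_le_pos; apply hpow_nonneg|].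
    apply weighted_amgm; auto.
  - rewrite fsum_scal, fsum_plus, (fsum_scal (al / (al + be))), (fsum_scal (be / (al + be))).
    assert (0 < / (al + be)) by (apply Rinv_0_lt_compat; lra).
    assert (Wa : 0 <= al / (al + be)) by (apply Rmult_le_pos; lra).
    assert (Wb : 0 <= be / (al + be)) by (apply Rmult_le_pos; lra).
    assert (W1 : al / (al + be) + be / (al + be) = 1) by (field; lra).
    rewrite <- (Rmult_1_r (hpow U al * hpow V be)) at 2.
    apply Rmult_le_compat_l; [apply Rmult_le_pos; apply hpow_nonneg|]. nra.
Qed.

(** * Weighted Hadamard products *)

(** The second matrix enters untransposed, so that both arguments multiply in the same order; the
    transpose in [Sab] is supplied as an argument. *)
Definition hadamard (al be : R) (a b : mat) : mat := fun i j => hpow (a i j) al * hpow (b i j) be.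

Lemma hadamard_nonneg_entries al be a b : nonneg_entries (hadamard al be a b).
Proof. intros i j. apply Rmult_le_pos; apply hpow_nonneg. Qed.

Lemma op_bound_plus a b C D : op_bound a C -> op_bound b D -> op_bound (fun i j => a i j + b i j) (C + D).
Proof.
  intros (Na & PC & Ha) (Nb & PD & Hb). repeat split.
  - intros i j. apply Rplus_le_le_0_compat; auto.
  - lra.
  - intros n x y X Y Hx Hy HX HY Bx By.
    rewrite (fsum_ext _ (fun i => y i * fsum (fun j => a i j * x j) n + y i * fsum (fun j => b i j * x j) n)).
    + rewrite fsum_plus. specialize (Ha n x y X Y Hx Hy HX HY Bx By).
      specialize (Hb n x y X Y Hx Hy HX HY Bx By). lra.
    + intros i _. rewrite (fsum_ext _ (fun j => a i j * x j + b i j * x j)) by (intros; ring).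
      rewrite fsum_plus. ring.
Qed.

(** For [C = 0] all entries are squeezed to [0], so the identity survives [/ 0 = 0]. *)
Lemma op_bound_normalize a C : op_bound a C ->
  op_bound (fun i j => / C * a i j) 1 /\ forall i j, a i j = C * (/ C * a i j).
Proof.
  intros B. pose proof (op_bound_pos _ _ B) as PC. destruct (Req_dec C 0) as [->|NC].
  - split.
    + apply op_bound_weaken with (/ 0 * 0); [apply op_bound_scal; [rewrite Rinv_0; lra|exact B]|lra].
    + intros i j. pose proof (op_bound_entry _ _ i j B). pose proof (op_bound_nonneg_entries _ _ B i j). lra.
  - split.
    + apply op_bound_weaken with (/ C * C); [|rewrite Rinv_l by exact NC; lra].
      apply op_bound_scal; [|exact B]. apply Rlt_le, Rinv_0_lt_compat. lra.
    + intros i j. field. exact NC.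
Qed.

(** An entry never exceeds the norm, so normalised entries lie in [[0,1]]. AM-GM then dominates the
    product by [C^al D^be] times a convex combination of two matrices of bound [1]. *)
Lemma hadamard_op_bound al be a b C D : 0 <= al -> 0 <= be -> 1 <= al + be -> op_bound a C -> op_bound b D ->
  op_bound (hadamard al be a b) (hpow C al * hpow D be).
Proof.
  intros Ha Hb Hab Ba Bb.
  pose proof (op_bound_pos _ _ Ba) as PC. pose proof (op_bound_pos _ _ Bb) as PD.
  destruct (op_bound_normalize a C Ba) as [Bp Ep]. destruct (op_bound_normalize b D Bb) as [Bq Eq].
  set (p := fun i j => / C * a i j) in *. set (q := fun i j => / D * b i j) in *.
  assert (0 < / (al + be)) by (apply Rinv_0_lt_compat; lra).
  assert (Wa : 0 <= al / (al + be)) by (apply Rmult_le_pos; lra).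
  assert (Wb : 0 <= be / (al + be)) by (apply Rmult_le_pos; lra).
  set (K := hpow C al * hpow D be). assert (HK : 0 <= K) by (apply Rmult_le_pos; apply hpow_nonneg).
  apply op_bound_weaken with (K * (al / (al + be) * 1 + be / (al + be) * 1)); [|right; field; lra].
  apply op_bound_le with (fun i j => K * (al / (al + be) * p i j + be / (al + be) * q i j)).
  - apply hadamard_nonneg_entries.
  - intros i j. unfold hadamard. rewrite (Ep i j), (Eq i j).
    change (/ C * a i j) with (p i j). change (/ D * b i j) with (q i j).
    assert (Pp : 0 <= p i j <= 1) by (split; [apply (op_bound_nonneg_entries _ _ Bp)|apply (op_bound_entry p 1), Bp]).
    assert (Pq : 0 <= q i j <= 1) by (split; [apply (op_bound_nonneg_entries _ _ Bq)|apply (op_bound_entry q 1), Bq]).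
    rewrite !hpow_mult by lra.
    replace (hpow C al * hpow (p i j) al * (hpow D be * hpow (q i j) be))
      with (K * (hpow (p i j) al * hpow (q i j) be)) by (unfold K; ring).
    apply Rmult_le_compat_l; [exact HK|]. apply weighted_amgm; auto.
  - apply (op_bound_scal K (fun i j => al / (al + be) * p i j + be / (al + be) * q i j)); [exact HK|].
    apply (op_bound_plus (fun i j => al / (al + be) * p i j) (fun i j => be / (al + be) * q i j));
      apply op_bound_scal; auto.
Qed.

(** Hölder over the inner summation index, on partial sums. *)
Lemma hadamard_mat_mul al be a a' b b' C C' D D' : 0 <= al -> 0 <= be -> 1 <= al + be ->
  op_bound a C -> op_bound a' C' -> op_bound b D -> op_bound b' D' ->
  forall i j, mat_mul (hadamard al be a b) (hadamard al be a' b') i j <= hadamard al be (mat_mul a a') (mat_mul b b') i j.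
Proof.
  intros Ha Hb Hab Ba Ba' Bb Bb' i j.
  apply nonneg_series_bound.
  { intros k. apply Rmult_le_pos; apply hadamard_nonneg_entries. }
  intros n. unfold hadamard at 3.
  rewrite (fsum_ext _ (fun k => hpow (a i k * a' k j) al * hpow (b i k * b' k j) be)).
  - assert (Nu : forall k, 0 <= a i k * a' k j).
    { intros k. apply Rmult_le_pos; [apply (op_bound_nonneg_entries _ _ Ba)|apply (op_bound_nonneg_entries _ _ Ba')]. }
    assert (Nv : forall k, 0 <= b i k * b' k j).
    { intros k. apply Rmult_le_pos; [apply (op_bound_nonneg_entries _ _ Bb)|apply (op_bound_nonneg_entries _ _ Bb')]. }
    apply (holder_fsum al be (fun k => a i k * a' k j) (fun k => b i k * b' k j)); auto.
    + apply (fsum_le_Series (fun k => a i k * a' k j)); auto. apply (mat_mul_ex a C a' C'); auto.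
    + apply (fsum_le_Series (fun k => b i k * b' k j)); auto. apply (mat_mul_ex b D b' D'); auto.
  - intros k _. unfold hadamard.
    rewrite !hpow_mult; [ring|apply (op_bound_nonneg_entries _ _ Bb)|apply (op_bound_nonneg_entries _ _ Bb')
      |apply (op_bound_nonneg_entries _ _ Ba)|apply (op_bound_nonneg_entries _ _ Ba')].
Qed.

Lemma mat_pow_hadamard al be a b C D n : 0 <= al -> 0 <= be -> 1 <= al + be -> op_bound a C -> op_bound b D ->
  forall i j, mat_pow (hadamard al be a b) n i j <= hadamard al be (mat_pow a n) (mat_pow b n) i j.
Proof.
  intros Ha Hb Hab Ba Bb. pose proof (hadamard_op_bound al be a b C D Ha Hb Hab Ba Bb) as Bh.
  induction n as [|n IH]; intros i j; simpl.
  - unfold hadamard, id_mat. destruct (Nat.eqb i j).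
    + rewrite !hpow_1_l. lra.
    + apply Rmult_le_pos; apply hpow_nonneg.
  - pose proof (mat_pow_op_bound a C n Ba) as Ban. pose proof (mat_pow_op_bound b D n Bb) as Bbn.
    eapply Rle_trans; [|apply (hadamard_mat_mul al be a (mat_pow a n) b (mat_pow b n) C (C ^ n) D (D ^ n)); auto].
    eapply mat_mul_le; [apply hadamard_nonneg_entries|apply (mat_pow_nonneg_entries _ _ n Bh)|intros; lra|exact IH|exact Bh|].
    apply (hadamard_op_bound al be _ _ (C ^ n) (D ^ n)); auto.
Qed.

Lemma power_growth_hadamard al be a b C D s t : 0 <= al -> 0 <= be -> 1 <= al + be -> op_bound a C -> op_bound b D ->
  power_growth a s -> power_growth b t -> power_growth (hadamard al be a b) (hpow s al * hpow t be).
Proof.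
  intros Ha Hb Hab Ba Bb Ga Gb.
  destruct (power_growth_const _ _ Ga) as [K [PK HK]]. destruct (power_growth_const _ _ Gb) as [L [PL HL]].
  destruct Ga as [Hs _], Gb as [Ht _].
  split; [apply Rmult_lt_0_compat; apply hpow_gt0; auto|].
  exists (hpow K al * hpow L be). intros n.
  apply op_bound_le with (hadamard al be (mat_pow a n) (mat_pow b n)).
  - apply (mat_pow_nonneg_entries _ _ n (hadamard_op_bound al be a b C D Ha Hb Hab Ba Bb)).
  - apply (mat_pow_hadamard al be a b C D); auto.
  - apply op_bound_weaken with (hpow (K * s ^ n) al * hpow (L * t ^ n) be).
    + apply hadamard_op_bound; auto.
    + right. rewrite !hpow_mult, !hpow_pow, Rpow_mult_distr by (auto using pow_le; try apply pow_le; lra). ring.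
Qed.

(** Outside the index set [hpow 0 0 = 1] could intrude, but at least one exponent is nonzero and its
    factor is [0]. *)
Lemma zero_ext_hadamard I al be a b : 1 <= al + be ->
  zero_ext I (fun i j => hpow (a i j) al * hpow (b j i) be) = hadamard al be (zero_ext I a) (transpose (zero_ext I b)).
Proof.
  intros Hab. apply functional_extensionality; intros i. apply functional_extensionality; intros j.
  unfold hadamard, transpose, zero_ext. destruct (inI I i), (inI I j); simpl; try reflexivity;
    (destruct (Req_dec al 0) as [->|N];
      [rewrite (hpow_0_l be) by lra; ring|rewrite (hpow_0_l al) by exact N; ring]).
Qed.

(** * Monotonicity and Hadamard bounds for the norm and the spectral radius *)

Lemma opnorm_mono I a b M : nonneg_entries (zero_ext I a) -> (forall i j, zero_ext I a i j <= zero_ext I b i j) ->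
  op_bound (zero_ext I b) M -> opnorm I a <= opnorm I b.
Proof.
  intros Na L B. apply opnorm_le. apply op_bound_le with (zero_ext I b); auto. apply (opnorm_op_bound I b M B).
Qed.

Lemma specrad_mono I a b M : nonneg_entries (zero_ext I a) -> (forall i j, zero_ext I a i j <= zero_ext I b i j) ->
  op_bound (zero_ext I b) M -> specrad I a <= specrad I b.
Proof.
  intros Na L B. apply le_epsilon. intros e He.
  apply (specrad_le_growth I a M); [apply (op_bound_le _ _ M Na L B)|].
  apply (power_growth_le _ _ M _ Na L B). apply (growth_of_specrad I b M); auto. lra.
Qed.

Lemma specrad_square I a M : op_bound (zero_ext I a) M -> specrad I a ^ 2 <= specrad I (mmul I a a).
Proof.
  intros B. assert (B2 : op_bound (zero_ext I (mmul I a a)) (M * M)) by (rewrite zero_ext_mat_mul; apply mat_mul_op_bound; auto).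
  pose proof (specrad_nonneg I a) as P1. pose proof (specrad_nonneg I (mmul I a a)) as P2.
  apply le_epsilon. intros e He.
  pose proof (growth_of_specrad I (mmul I a a) (M * M) (specrad I (mmul I a a) + e) B2 ltac:(lra)) as G.
  rewrite zero_ext_mat_mul in G. apply (power_growth_square _ M _ B) in G.
  apply (specrad_le_growth I a M _ B) in G.
  rewrite <- (pow2_sqrt (specrad I (mmul I a a) + e)) by lra.
  apply pow_incr. split; assumption.
Qed.

Lemma opnorm_hadamard I al be a b c C D S : 0 <= al -> 0 <= be -> 1 <= al + be ->
  op_bound (zero_ext I a) C -> op_bound (zero_ext I b) D -> nonneg_entries (zero_ext I c) ->
  (forall i j, zero_ext I c i j <= hadamard al be (zero_ext I a) (transpose (zero_ext I b)) i j) ->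
  opnorm I a <= S -> opnorm I b <= S -> opnorm I c <= hpow S (al + be).
Proof.
  intros Ha Hb Hab Ba Bb Nc L La Lb.
  apply opnorm_op_bound in Ba. apply opnorm_op_bound in Bb.
  pose proof (opnorm_nonneg I a) as Pa.
  apply opnorm_le. apply (op_bound_le _ _ _ Nc L). rewrite hpow_plus by lra.
  apply hadamard_op_bound; auto; [apply (op_bound_weaken _ _ _ Ba La)|].
  apply op_bound_transpose, (op_bound_weaken _ _ _ Bb Lb).
Qed.

Lemma specrad_hadamard I al be a b c C D S : 0 <= al -> 0 <= be -> 1 <= al + be ->
  op_bound (zero_ext I a) C -> op_bound (zero_ext I b) D -> nonneg_entries (zero_ext I c) ->
  (forall i j, zero_ext I c i j <= hadamard al be (zero_ext I a) (transpose (zero_ext I b)) i j) ->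
  specrad I a <= S -> specrad I b <= S -> specrad I c <= hpow S (al + be).
Proof.
  intros Ha Hb Hab Ba Bb Nc L La Lb. pose proof (specrad_nonneg I a) as Pa.
  (* Growth at the spectral radius itself may fail, so rates above it are used and lowered to it
     afterwards. *)
  apply hpow_limit; [lra|lra|]. intros s Hs.
  pose proof (op_bound_transpose _ _ Bb) as Bt.
  pose proof (hadamard_op_bound al be _ _ C D Ha Hb Hab Ba Bt) as Bh.
  apply (specrad_le_growth I c _ _ (op_bound_le _ _ _ Nc L Bh)).
  apply (power_growth_le _ _ _ _ Nc L Bh). rewrite hpow_plus by lra.
  apply (power_growth_hadamard al be _ _ C D); auto.
  - apply (growth_of_specrad I a C); auto. lra.
  - apply (power_growth_transpose _ D _ Bb), (growth_of_specrad I b D); auto. lra.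
Qed.

(** * Products of members of a bounded set *)

Definition bounded_set (I : idx) (Sg : matset) (M : R) : Prop :=
  0 <= M /\ forall a, Sg a -> op_bound (zero_ext I a) M.

Lemma prodset_bounded I Sg M k : bounded_set I Sg M -> bounded_set I (prodset I Sg k) (M ^ S k).
Proof.
  intros [PM H]. split; [apply pow_le, PM|].
  induction k as [|k IH]; intros c Hc.
  - simpl in *. rewrite Rmult_1_r. auto.
  - destruct Hc as (a & b & Ha & Hb & ->). rewrite zero_ext_mat_mul.
    apply (mat_mul_op_bound _ M _ (M ^ S k)); auto.
Qed.

(** Indices are exponents minus one: [(j+1) + (k+1) = S (j + k) + 1]. Equality is stated after
    [zero_ext], where bounds on the factors justify reassociation. *)
Lemma prodset_mul I Sg M j k b c : bounded_set I Sg M -> prodset I Sg j b -> prodset I Sg k c ->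
  exists a, prodset I Sg (S (j + k)) a /\ zero_ext I a = mat_mul (zero_ext I b) (zero_ext I c).
Proof.
  intros HS. revert b. induction j as [|j IH]; intros b Hb Hc.
  - exists (mmul I b c). split; [exists b, c; auto|apply zero_ext_mat_mul].
  - destruct Hb as (b1 & b2 & Hb1 & Hb2 & ->). destruct (IH b2 Hb2 Hc) as (a & Ha & Ea).
    exists (mmul I b1 a). split; [exists b1, a; auto|].
    rewrite !zero_ext_mat_mul, Ea. symmetry. apply (mat_mul_assoc _ M _ (M ^ S j) _ (M ^ S k)).
    + apply HS, Hb1.
    + apply (prodset_bounded I Sg M j HS), Hb2.
    + apply (prodset_bounded I Sg M k HS), Hc.
Qed.

Lemma prodset_split I Sg M j k a : bounded_set I Sg M -> prodset I Sg (S (j + k)) a ->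
  exists b c, prodset I Sg j b /\ prodset I Sg k c /\ zero_ext I a = mat_mul (zero_ext I b) (zero_ext I c).
Proof.
  intros HS. revert a. induction j as [|j IH]; intros a Ha.
  - destruct Ha as (b & c & Hb & Hc & ->). exists b, c. split; [exact Hb|]. split; [exact Hc|].
    apply zero_ext_mat_mul.
  - destruct Ha as (a1 & a2 & Ha1 & Ha2 & ->). destruct (IH a2 Ha2) as (b & c & Hb & Hc & E).
    exists (mmul I a1 b), c. split; [exists a1, b; auto|]. split; [exact Hc|].
    rewrite !zero_ext_mat_mul, E. symmetry. apply (mat_mul_assoc _ M _ (M ^ S j) _ (M ^ S k)).
    + apply HS, Ha1.
    + apply (prodset_bounded I Sg M j HS), Hb.
    + apply (prodset_bounded I Sg M k HS), Hc.
Qed.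

(** Exponents multiply; the index is [(j+1)(k+1) - 1 = j (k+1) + k]. *)
Lemma prodset_prodset I Sg M j k c : bounded_set I Sg M -> prodset I (prodset I Sg j) k c ->
  exists a, prodset I Sg (j * S k + k) a /\ zero_ext I a = zero_ext I c.
Proof.
  intros HS. revert c. induction k as [|k IH]; intros c Hc.
  - exists c. replace (j * 1 + 0)%nat with j by lia. auto.
  - destruct Hc as (a1 & c1 & Ha1 & Hc1 & ->). destruct (IH c1 Hc1) as (a & Ha & Ea).
    destruct (prodset_mul I Sg M j _ a1 a HS Ha1 Ha) as (b & Hb & Eb).
    exists b. split.
    + replace (j * S (S k) + S k)%nat with (S (j + (j * S k + k))) by lia. exact Hb.
    + rewrite Eb, zero_ext_mat_mul, Ea. reflexivity.
Qed.

Lemma Sab_bounded I al be Sg M : 0 <= al -> 0 <= be -> 1 <= al + be ->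
  bounded_set I Sg M -> bounded_set I (Sab al be Sg) (hpow M al * hpow M be).
Proof.
  intros Ha Hb Hab [PM H]. split; [apply Rmult_le_pos; apply hpow_nonneg|].
  intros c (a & b & HA & HB & ->). rewrite zero_ext_hadamard by exact Hab.
  apply hadamard_op_bound; auto. apply op_bound_transpose. auto.
Qed.

Lemma prodset_nonneg_entries I Sg M k a : bounded_set I Sg M -> prodset I Sg k a -> nonneg_entries (zero_ext I a).
Proof. intros HS Ha. apply (op_bound_nonneg_entries _ (M ^ S k)), (prodset_bounded I Sg M k HS), Ha. Qed.

Lemma Sab_prodset I al be Sg M k c : 0 <= al -> 0 <= be -> 1 <= al + be ->
  bounded_set I Sg M -> prodset I (Sab al be Sg) k c ->
  exists a b, prodset I Sg k a /\ prodset I Sg k b /\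
    forall i j, zero_ext I c i j <= hadamard al be (zero_ext I a) (transpose (zero_ext I b)) i j.
Proof.
  intros Ha Hb Hab HS. pose proof (Sab_bounded I al be Sg M Ha Hb Hab HS) as HSab.
  revert c. induction k as [|k IH]; intros c Hc.
  - destruct Hc as (a & b & HA & HB & ->). exists a, b. split; [exact HA|]. split; [exact HB|].
    rewrite zero_ext_hadamard by exact Hab. intros; lra.
  - destruct Hc as (c1 & c2 & Hc1 & Hc2 & ->). destruct (IH c2 Hc2) as (a2 & b2 & HA2 & HB2 & L).
    pose proof (prodset_nonneg_entries I _ _ k c2 HSab Hc2) as N2.
    destruct Hc1 as (a1 & b1 & HA1 & HB1 & ->).
    (* Transposition reverses products, so the new factor [b1] is appended on the right while [a1]
       goes on the left. *)
    destruct (prodset_mul I Sg M k 0 b2 b1 HS HB2 HB1) as (b & HB & EB).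
    exists (mmul I a1 a2), b. split; [exists a1, a2; auto|].
    split; [replace (S k) with (S (k + 0)) by lia; exact HB|].
    intros i j. rewrite EB, !zero_ext_mat_mul, mat_mul_transpose, zero_ext_hadamard by exact Hab.
    pose proof (proj2 HS a1 HA1) as B1. pose proof (op_bound_transpose _ _ (proj2 HS b1 HB1)) as T1.
    pose proof (proj2 (prodset_bounded I Sg M k HS) a2 HA2) as B2.
    pose proof (op_bound_transpose _ _ (proj2 (prodset_bounded I Sg M k HS) b2 HB2)) as T2.
    eapply Rle_trans; [|apply (hadamard_mat_mul al be _ _ _ _ M (M ^ S k) M (M ^ S k)); auto].
    eapply mat_mul_le; [apply hadamard_nonneg_entries|exact N2|intros; lra|exact L| |]; apply hadamard_op_bound; eauto.
Qed.

(* [(A_1^(al) o (B_1^T)^(be)) (A_2^(al) o (B_2^T)^(be)) <= (A_1 A_2)^(al) o ((B_2 B_1)^T)^(be)] *)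
Lemma Sab_double I al be Sg M p k c : 0 <= al -> 0 <= be -> 1 <= al + be ->
  bounded_set I Sg M -> prodset I (Sab al be (prodset I Sg p)) (S (k + k)) c ->
  exists d, prodset I (Sab al be (prodset I Sg (S (p + p)))) k d /\
    forall i j, zero_ext I c i j <= zero_ext I d i j.
Proof.
  intros Ha Hb Hab HS. set (Ph := prodset I Sg p). set (M1 := M ^ S p).
  assert (HP : bounded_set I Ph M1) by (apply prodset_bounded, HS).
  pose proof (Sab_bounded I al be Ph M1 Ha Hb Hab HP) as HPab.
  set (Ps := prodset I Sg (S (p + p))).
  assert (HQ : bounded_set I Ps (M ^ S (S (p + p)))) by (apply prodset_bounded, HS).
  pose proof (Sab_bounded I al be Ps _ Ha Hb Hab HQ) as HQab.
  assert (Two : forall c1 c2, Sab al be Ph c1 -> Sab al be Ph c2 ->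
    exists d, Sab al be Ps d /\ forall i j, mat_mul (zero_ext I c1) (zero_ext I c2) i j <= zero_ext I d i j).
  { intros c1 c2 (a1 & b1 & HA1 & HB1 & ->) (a2 & b2 & HA2 & HB2 & ->).
    destruct (prodset_mul I Sg M p p a1 a2 HS HA1 HA2) as (a & HA & EA).
    destruct (prodset_mul I Sg M p p b2 b1 HS HB2 HB1) as (b & HB & EB).
    exists (fun i j => hpow (a i j) al * hpow (b j i) be).
    split; [exists a, b; auto|]. intros i j.
    rewrite !zero_ext_hadamard, EA, EB, mat_mul_transpose by exact Hab.
    apply (hadamard_mat_mul al be _ _ _ _ M1 M1 M1 M1); auto;
      [| |apply op_bound_transpose|apply op_bound_transpose]; apply (proj2 HP); assumption. }
  revert c. induction k as [|k IH]; intros c Hc.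
  - destruct Hc as (c1 & c2 & H1 & H2 & ->). destruct (Two c1 c2 H1 H2) as (d & Hd & L).
    exists d. split; [exact Hd|]. intros i j. rewrite zero_ext_mat_mul. apply L.
  (* Two factors are split off and merged into one, leaving [2 (k + 1)] factors for the induction
     hypothesis. *)
  - replace (S (S k + S k)) with (S (S (S (k + k)))) in Hc by lia.
    destruct Hc as (c1 & c' & H1 & (c2 & c3 & H2 & H3 & ->) & ->).
    destruct (Two c1 c2 H1 H2) as (d1 & Hd1 & L1). destruct (IH c3 H3) as (d2 & Hd2 & L2).
    exists (mmul I d1 d2). split; [exists d1, d2; auto|].
    pose proof (proj2 HPab c1 H1) as B1. pose proof (proj2 HPab c2 H2) as B2.
    pose proof (proj2 (prodset_bounded I _ _ _ HPab) c3 H3) as B3.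
    rewrite !zero_ext_mat_mul. erewrite <- mat_mul_assoc by eassumption.
    apply (mat_mul_le _ _ _ _ _ _ (mat_mul_nonneg_entries _ _ _ _ B1 B2) (op_bound_nonneg_entries _ _ B3) L1 L2
      (proj2 HQab d1 Hd1) (proj2 (prodset_bounded I _ _ _ HQab) d2 Hd2)).
Qed.

(** * Suprema over products of fixed length *)

Definition psup (I : idx) (F : mat -> R) (Sg : matset) (k : nat) : R :=
  sup_over (fun r => exists a, prodset I Sg k a /\ r = F a).

(** The properties common to the norm and the spectral radius: nonnegative, below every bound,
    monotone, and compatible with Hadamard products. Comparisons resting on these alone are proved
    once for both. *)
Definition size_functional (I : idx) (F : mat -> R) : Prop :=
  (forall a, 0 <= F a) /\
  (forall a M, op_bound (zero_ext I a) M -> F a <= M) /\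
  (forall a b M, nonneg_entries (zero_ext I a) -> (forall i j, zero_ext I a i j <= zero_ext I b i j) ->
     op_bound (zero_ext I b) M -> F a <= F b) /\
  (forall al be a b c C D S, 0 <= al -> 0 <= be -> 1 <= al + be ->
     op_bound (zero_ext I a) C -> op_bound (zero_ext I b) D -> nonneg_entries (zero_ext I c) ->
     (forall i j, zero_ext I c i j <= hadamard al be (zero_ext I a) (transpose (zero_ext I b)) i j) ->
     F a <= S -> F b <= S -> F c <= hpow S (al + be)).

Lemma opnorm_size I : size_functional I (opnorm I).
Proof.
  split; [apply opnorm_nonneg|]. split; [apply opnorm_le|]. split; [apply opnorm_mono|].
  apply opnorm_hadamard.
Qed.

Lemma specrad_size I : size_functional I (specrad I).
Proof.
  split; [apply specrad_nonneg|]. split; [|split; [apply specrad_mono|apply specrad_hadamard]].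
  intros a M B. eapply Rle_trans; [apply (specrad_le_opnorm I a M B)|apply opnorm_le, B].
Qed.

Lemma psup_nonneg I F Sg k : size_functional I F -> 0 <= psup I F Sg k.
Proof. intros [H _]. apply sup_over_nonneg. intros r (a & _ & ->). apply H. Qed.

Lemma psup_ub I F Sg M k a : size_functional I F -> bounded_set I Sg M -> prodset I Sg k a ->
  F a <= psup I F Sg k.
Proof.
  intros (_ & H & _) HS Ha. apply (sup_over_ub _ (M ^ S k)); [|exists a; auto].
  intros r (b & Hb & ->). apply H. apply (prodset_bounded I Sg M k HS), Hb.
Qed.

Lemma psup_le I F Sg k c : 0 <= c -> (forall a, prodset I Sg k a -> F a <= c) -> psup I F Sg k <= c.
Proof. intros Hc H. apply sup_over_le; auto. intros r (a & Ha & ->). auto. Qed.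

Lemma psup_bound I F Sg M k : size_functional I F -> bounded_set I Sg M -> psup I F Sg k <= M ^ S k.
Proof.
  intros (_ & H & _) HS. apply psup_le; [apply pow_le, HS|].
  intros a Ha. apply H. apply (prodset_bounded I Sg M k HS), Ha.
Qed.

Lemma psup_double I F al be Sg M p k : size_functional I F -> 0 <= al -> 0 <= be -> 1 <= al + be ->
  bounded_set I Sg M ->
  psup I F (Sab al be (prodset I Sg p)) (S (k + k)) <= psup I F (Sab al be (prodset I Sg (S (p + p)))) k.
Proof.
  intros HF Ha Hb Hab HS. apply psup_le; [apply psup_nonneg, HF|]. intros c Hc.
  pose proof (Sab_bounded I al be _ _ Ha Hb Hab (prodset_bounded I Sg M p HS)) as HP.
  pose proof (Sab_bounded I al be _ _ Ha Hb Hab (prodset_bounded I Sg M (S (p + p)) HS)) as HQ.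
  destruct (Sab_double I al be Sg M p k c Ha Hb Hab HS Hc) as (d & Hd & L).
  eapply Rle_trans; [|apply (psup_ub I F _ _ k d HF HQ Hd)].
  destruct HF as (_ & _ & Mono & _).
  apply (Mono c d _ (prodset_nonneg_entries I _ _ _ c HP Hc) L (proj2 (prodset_bounded I _ _ k HQ) d Hd)).
Qed.

Lemma psup_Sab I F al be Sg M k : size_functional I F -> 0 <= al -> 0 <= be -> 1 <= al + be ->
  bounded_set I Sg M -> psup I F (Sab al be Sg) k <= hpow (psup I F Sg k) (al + be).
Proof.
  intros HF Ha Hb Hab HS. apply psup_le; [apply hpow_nonneg|]. intros c Hc.
  pose proof (Sab_bounded I al be _ _ Ha Hb Hab HS) as HP.
  destruct (Sab_prodset I al be Sg M k c Ha Hb Hab HS Hc) as (a & b & HA & HB & L).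
  pose proof (psup_ub I F _ _ k a HF HS HA) as La. pose proof (psup_ub I F _ _ k b HF HS HB) as Lb.
  destruct HF as (_ & _ & _ & Had).
  apply (Had al be a b c _ _ _ Ha Hb Hab (proj2 (prodset_bounded I _ _ k HS) a HA)
    (proj2 (prodset_bounded I _ _ k HS) b HB) (prodset_nonneg_entries I _ _ _ c HP Hc) L La Lb).
Qed.

Lemma psup_prodset I F Sg M j k : size_functional I F -> bounded_set I Sg M ->
  psup I F (prodset I Sg j) k <= psup I F Sg (j * S k + k).
Proof.
  intros HF HS. apply psup_le; [apply psup_nonneg, HF|]. intros c Hc.
  destruct (prodset_prodset I Sg M j k c HS Hc) as (a & Ha & E).
  eapply Rle_trans; [|apply (psup_ub I F _ _ _ a HF HS Ha)].
  destruct HF as (_ & _ & Mono & _).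
  apply (Mono c a (M ^ S (j * S k + k))); rewrite <- ?E.
  - apply (prodset_nonneg_entries I Sg M _ a HS Ha).
  - intros; lra.
  - apply (prodset_bounded I Sg M _ HS), Ha.
Qed.

(** Replaces submultiplicativity, which the spectral radius lacks: the square of a product of
    [k + 1] factors is a product of [2 (k + 1)] factors. *)
Lemma psup_specrad_square I Sg M k : bounded_set I Sg M ->
  psup I (specrad I) Sg k ^ 2 <= psup I (specrad I) Sg (S (k + k)).
Proof.
  intros HS. pose proof (psup_nonneg I _ Sg (S (k + k)) (specrad_size I)) as P2.
  rewrite <- (pow2_sqrt _ P2).
  apply pow_incr. split; [apply psup_nonneg, specrad_size|].
  apply psup_le; [apply sqrt_pos|]. intros a Ha.
  pose proof (proj2 (prodset_bounded I Sg M k HS) a Ha) as Ba.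
  pose proof (specrad_square I a _ Ba) as Q.
  destruct (prodset_mul I Sg M k k a a HS Ha Ha) as (b & Hb & Eb).
  pose proof (psup_ub I _ Sg M _ b (specrad_size I) HS Hb) as U.
  assert (L : specrad I (mmul I a a) <= specrad I b).
  { apply (specrad_mono I _ _ (M ^ S (S (k + k)))); rewrite ?zero_ext_mat_mul, <- ?Eb.
    - apply (prodset_nonneg_entries I Sg M _ b HS Hb).
    - intros; lra.
    - apply (prodset_bounded I Sg M _ HS), Hb. }
  rewrite <- (sqrt_pow2 (specrad I a)) by apply specrad_nonneg. apply sqrt_le_1_alt. lra.
Qed.

Lemma psup_opnorm_mul I Sg M j k : bounded_set I Sg M ->
  psup I (opnorm I) Sg (S (j + k)) <= psup I (opnorm I) Sg j * psup I (opnorm I) Sg k.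
Proof.
  intros HS. pose proof (opnorm_size I) as HF.
  apply psup_le; [apply Rmult_le_pos; apply psup_nonneg, HF|]. intros a Ha.
  destruct (prodset_split I Sg M j k a HS Ha) as (b & c & Hb & Hc & E).
  apply opnorm_le. rewrite E. apply mat_mul_op_bound.
  - eapply op_bound_weaken; [|apply (psup_ub I _ Sg M j b HF HS Hb)].
    eapply opnorm_op_bound, (prodset_bounded I Sg M j HS), Hb.
  - eapply op_bound_weaken; [|apply (psup_ub I _ Sg M k c HF HS Hc)].
    eapply opnorm_op_bound, (prodset_bounded I Sg M k HS), Hc.
Qed.

(** * Limits superior *)

Lemma LimSup_bounded v M : (forall k, 0 <= v k <= M) ->
  exists L, LimSup_seq v = Finite L /\ 0 <= L /\
   (forall e, 0 < e -> (forall N, exists n, (N <= n)%nat /\ L - e < v n) /\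
     exists N, forall n, (N <= n)%nat -> v n < L + e).
Proof.
  intros H. assert (C : is_LimSup_seq v (LimSup_seq v)) by (unfold LimSup_seq; apply proj2_sig).
  destruct (LimSup_seq v) as [L| |]; simpl in C.
  - exists L. split; [reflexivity|]. split.
    + apply le_epsilon. intros e He. destruct (proj2 (C (mkposreal e He))) as [N HN].
      specialize (HN N (le_n N)). specialize (H N). simpl in HN. lra.
    + intros e He. destruct (C (mkposreal e He)) as [C1 C2]. simpl in *. auto.
  - destruct (C M O) as (n & _ & Hn). specialize (H n). lra.
  - destruct (C 0) as (N & HN). specialize (HN N (le_n N)). specialize (H N). lra.
Qed.

Lemma LimSup_nonneg v M : (forall k, 0 <= v k <= M) -> 0 <= real (LimSup_seq v).
Proof. intros H. destruct (LimSup_bounded v M H) as (L & -> & HL & _). exact HL. Qed.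

(** The map [phi] allows a comparison at longer products: along indices tending to infinity, terms
    of [v] are eventually below any [s] above its limit superior. *)
Lemma LimSup_hpow u v M (phi : nat -> nat) p : 0 < p -> (forall k, 0 <= v k <= M) ->
  (forall k, (k <= phi k)%nat) -> (forall k, 0 <= u k <= hpow (v (phi k)) p) ->
  real (LimSup_seq u) <= hpow (real (LimSup_seq v)) p.
Proof.
  intros Hp Hv Hphi Hu.
  destruct (LimSup_bounded v M Hv) as (L & -> & HL & CL).
  destruct (LimSup_bounded u (hpow M p)) as (L' & -> & HL' & CL').
  { intros k. split; [apply Hu|]. eapply Rle_trans; [apply Hu|]. apply hpow_mono; [apply Hv|lra]. }
  simpl. apply hpow_limit; auto. intros s Hs. apply le_epsilon. intros e He.
  destruct (CL (s - L) ltac:(lra)) as [_ [N HN]].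
  destruct (proj1 (CL' e He) N) as (n & Ln & Hn).
  specialize (HN (phi n) ltac:(specialize (Hphi n); lia)).
  assert (u n <= hpow s p); [|lra].
  eapply Rle_trans; [apply Hu|]. apply hpow_mono; [|lra]. specialize (Hv (phi n)). lra.
Qed.

Lemma INR_S_pos k : 0 < INR (S k).
Proof. apply lt_0_INR. lia. Qed.

Lemma rootk_le x s k : 0 <= x -> 0 <= s -> x <= s ^ S k -> rootk x (S k) <= s.
Proof.
  intros Hx Hs L. unfold rootk. pose proof (INR_S_pos k).
  rewrite <- (hpow_1_r s Hs), <- (Rinv_r (INR (S k))), <- hpow_hpow, hpow_nat by lra.
  apply hpow_mono; [lra|]. apply Rlt_le, Rinv_0_lt_compat; lra.
Qed.

Lemma rootk_pow x k : 0 <= x -> rootk x (S k) ^ S k = x.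
Proof.
  intros Hx. unfold rootk. pose proof (INR_S_pos k).
  rewrite <- hpow_nat, hpow_hpow, Rinv_l, hpow_1_r by (auto using hpow_nonneg; lra). reflexivity.
Qed.

(** [Lim_seq] has a value for every sequence, so convergence is a genuine claim. It follows once the
    limit superior lies below every term. *)
Lemma fekete (t : nat -> R) M : 0 <= M -> (forall k, 0 <= t k <= M ^ S k) ->
  (forall j k, t (S (j + k)) <= t j * t k) ->
  let u := fun k => rootk (t k) (S k) in
  Lim_seq u = LimSup_seq u /\ forall k, real (LimSup_seq u) <= u k.
Proof.
  intros HM Ht Hsub u.
  assert (Hu : forall k, 0 <= u k <= M).
  { intros k. split; [apply hpow_nonneg|]. apply rootk_le; auto; apply Ht. }
  destruct (LimSup_bounded u M Hu) as (L & EL & HL & CL).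
  assert (B : forall m, L <= u m).
  (* The rate [s] is positive even if [u m = 0], and its gap to [s' = u m + e] absorbs the constant
     of [submult_growth]: [C (s/s')^n <= 1] for large [n]. *)
  { intros m. apply le_epsilon. intros e He. set (s := u m + e / 2).
    assert (Hs : 0 < s) by (unfold s; specialize (Hu m); lra).
    (* Shifts the index so that it equals the exponent, with the empty product of size [1]. *)
    set (T := fun n => match n with O => 1 | S k => t k end).
    destruct (submult_growth (fun n c => T n <= c) M s (S m)) as (C & PC & HC); auto.
    - intros; lra.
    - intros n k c d Hc Hd L1 L2.
      assert (T (n + k)%nat <= T n * T k).
      { destruct n as [|n]; [simpl; lra|]. destruct k as [|k].
        - rewrite Nat.add_0_r. simpl. lra.
        - replace (S n + S k)%nat with (S (S (n + k))) by lia. apply Hsub. }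
      eapply Rle_trans; [exact H|].
      assert (PT : forall q, 0 <= T q) by (intros [|q]; simpl; [lra|apply Ht]).
      apply Rmult_le_compat; auto.
    - intros [|n]; [simpl; lra|apply Ht].
    - lia.
    - simpl T. apply Rle_trans with (u m ^ S m).
      + unfold u. rewrite rootk_pow by apply Ht. lra.
      + apply pow_incr. unfold s. specialize (Hu m). lra.
    - set (s' := u m + e). assert (Hss : 0 < s < s') by (unfold s' in *; unfold s in *; lra).
      assert (Q : 0 < s / s' < 1).
      { split; [apply Rdiv_lt_0_compat; lra|]. apply Rmult_lt_reg_r with s'; [lra|].
        unfold Rdiv. rewrite Rmult_assoc, Rinv_l by lra. lra. }
      destruct (pow_lt_1_zero (s / s')) with (y := / (C + 1)) as [N HN].
      { rewrite Rabs_pos_eq; lra. }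
      { apply Rinv_0_lt_compat. lra. }
      apply le_epsilon. intros e' He'. destruct (proj1 (CL e' He') N) as (n & Ln & Hn).
      assert (u n <= s'); [|unfold s' in *; lra].
      apply rootk_le; [apply Ht|lra|]. eapply Rle_trans; [apply (HC (S n))|].
      specialize (HN (S n) ltac:(lia)). assert (0 < (s / s') ^ S n) by (apply pow_lt; lra).
      rewrite Rabs_pos_eq in HN by lra.
      replace s with (s / s' * s') at 1 by (field; lra). rewrite Rpow_mult_distr.
      assert (0 < s' ^ S n) by (apply pow_lt; lra).
      rewrite <- Rmult_assoc. rewrite <- (Rmult_1_l (s' ^ S n)) at 2.
      apply Rmult_le_compat_r; [lra|].
      apply Rmult_lt_compat_l with (r := C + 1) in HN; [|lra]. rewrite Rinv_r in HN by lra. lra. }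
  rewrite EL. split; [|exact B].
  apply is_lim_seq_unique, is_lim_seq_spec. intros e.
  destruct (CL e (cond_pos e)) as [_ [N HN]]. exists N. intros n Hn.
  specialize (HN n Hn). specialize (B n). pose proof (cond_pos e). apply Rabs_def1; lra.
Qed.

(** For [specrad] this is [gsr] by conversion; for [opnorm] it equals [jsr] by Fekete's lemma. *)
Definition growth_rate (I : idx) (F : mat -> R) (Sg : matset) : R :=
  real (LimSup_seq (fun k => rootk (psup I F Sg k) (S k))).

Lemma root_bounds I F Sg M k : size_functional I F -> bounded_set I Sg M ->
  0 <= rootk (psup I F Sg k) (S k) <= M.
Proof.
  intros HF HS. split; [apply hpow_nonneg|].
  apply rootk_le; [apply psup_nonneg, HF|apply HS|apply psup_bound; auto].
Qed.

Lemma jsr_fekete I Sg M : bounded_set I Sg M ->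
  jsr I Sg = growth_rate I (opnorm I) Sg /\
  forall k, jsr I Sg <= rootk (psup I (opnorm I) Sg k) (S k).
Proof.
  intros HS. destruct (fekete (psup I (opnorm I) Sg) M) as [E L].
  - apply HS.
  - intros k. split; [apply psup_nonneg, opnorm_size|apply psup_bound; auto using opnorm_size].
  - intros j k. apply (psup_opnorm_mul I Sg M); auto.
  - cbv zeta in E, L. assert (Q : jsr I Sg = growth_rate I (opnorm I) Sg) by exact (f_equal real E).
    split; [exact Q|]. rewrite Q. exact L.
Qed.

Lemma inv_INR_S_half k : / INR (S (S (k + k))) = / INR (S k) * / 2.
Proof.
  pose proof (INR_S_pos k). rewrite <- Rinv_mult. f_equal.
  replace (S (S (k + k))) with (S k * 2)%nat by lia. rewrite mult_INR. simpl (INR 2). lra.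
Qed.

(** The comparison holds term by term: if [x_k] and [y_k] are the suprema for the two sets at index
    [k], then [x_k^2 <= x_(2k+1) <= y_k]. *)
Lemma gsr_Sab_double I al be Sg M p : 0 <= al -> 0 <= be -> 1 <= al + be -> bounded_set I Sg M ->
  gsr I (Sab al be (prodset I Sg p)) <= hpow (gsr I (Sab al be (prodset I Sg (S (p + p))))) (/ 2).
Proof.
  intros Ha Hb Hab HS. pose proof (specrad_size I) as HF.
  pose proof (Sab_bounded I al be _ _ Ha Hb Hab (prodset_bounded I Sg M p HS)) as HP.
  pose proof (Sab_bounded I al be _ _ Ha Hb Hab (prodset_bounded I Sg M (S (p + p)) HS)) as HQ.
  eapply (LimSup_hpow _ _ _ (fun k => k)); [lra| |auto|].
  - intros k. apply (root_bounds I (specrad I) _ _ k HF HQ).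
  - intros k. split; [apply hpow_nonneg|]. cbv beta.
    change (rootk (psup I (specrad I) (Sab al be (prodset I Sg p)) k) (S k) <=
      hpow (rootk (psup I (specrad I) (Sab al be (prodset I Sg (S (p + p)))) k) (S k)) (/ 2)).
    pose proof (psup_nonneg I _ (Sab al be (prodset I Sg p)) k HF) as P1.
    pose proof (psup_nonneg I _ (Sab al be (prodset I Sg (S (p + p)))) k HF) as P2.
    pose proof (psup_specrad_square I _ _ k HP) as Q.
    pose proof (psup_double I _ al be Sg M p k HF Ha Hb Hab HS) as D.
    unfold rootk. rewrite hpow_hpow by exact P2.
    set (x := psup I (specrad I) (Sab al be (prodset I Sg p)) k) in *.
    pose proof (INR_S_pos k) as Pk.
    assert (E : hpow x (/ INR (S k)) = hpow (x ^ 2) (/ INR (S k) * / 2)).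
    { rewrite <- (hpow_nat x 2 P1), hpow_hpow by exact P1. f_equal.
      change (INR 2) with (1 + 1). field. lra. }
    rewrite E. apply hpow_mono.
    + split; [apply pow_le, P1|lra].
    + pose proof (INR_S_pos k). apply Rlt_le, Rmult_lt_0_compat; apply Rinv_0_lt_compat; lra.
Qed.

Lemma jsr_Sab_double I al be Sg M p : 0 <= al -> 0 <= be -> 1 <= al + be -> bounded_set I Sg M ->
  jsr I (Sab al be (prodset I Sg p)) <= hpow (jsr I (Sab al be (prodset I Sg (S (p + p))))) (/ 2).
Proof.
  intros Ha Hb Hab HS. pose proof (opnorm_size I) as HF.
  pose proof (Sab_bounded I al be _ _ Ha Hb Hab (prodset_bounded I Sg M p HS)) as HP.
  pose proof (Sab_bounded I al be _ _ Ha Hb Hab (prodset_bounded I Sg M (S (p + p)) HS)) as HQ.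
  destruct (jsr_fekete I _ _ HP) as [EP LP]. destruct (jsr_fekete I _ _ HQ) as [EQ _].
  set (x := jsr I (Sab al be (prodset I Sg p))) in *.
  (* The joint spectral radius lies below each of its roots, in particular those of even length; as
     a constant sequence it fits [LimSup_hpow]. *)
  replace x with (real (LimSup_seq (fun _ => x)))  by (rewrite LimSup_seq_const; reflexivity).
  rewrite EQ.
  eapply (LimSup_hpow _ _ _ (fun k => k)); [lra| |auto|].
  - intros k. apply (root_bounds I (opnorm I) _ _ k HF HQ).
  - intros k. cbv beta. split.
    + rewrite EP. eapply LimSup_nonneg. intros n. apply (root_bounds I _ _ _ n HF HP).
    + eapply Rle_trans; [apply (LP (S (k + k)))|]. unfold rootk.
      rewrite hpow_hpow by (apply psup_nonneg, HF). rewrite inv_INR_S_half.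
      apply hpow_mono.
      * split; [apply psup_nonneg, HF|apply (psup_double I _ al be Sg M p k HF Ha Hb Hab HS)].
      * pose proof (INR_S_pos k). apply Rlt_le, Rmult_lt_0_compat; apply Rinv_0_lt_compat; lra.
Qed.

Lemma growth_rate_Sab I F al be Sg M p : size_functional I F ->
  0 <= al -> 0 <= be -> 1 <= al + be -> bounded_set I Sg M ->
  growth_rate I F (Sab al be (prodset I Sg p)) <= hpow (growth_rate I F Sg) (INR (S p) * (al + be)).
Proof.
  intros HF Ha Hb Hab HS.
  pose proof (prodset_bounded I Sg M p HS) as HP. pose proof (INR_S_pos p) as Pp.
  (* Products of [k + 1] members of the [(p+1)]-st power are products of [(p+1)(k+1)] members of
     [Sg]. *)
  eapply (LimSup_hpow _ _ _ (fun k => p * S k + k)%nat).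
  - apply Rmult_lt_0_compat; lra.
  - intros k. apply (root_bounds I F Sg M k HF HS).
  - intros k. lia.
  - intros k. cbv beta. split; [apply hpow_nonneg|].
    pose proof (INR_S_pos k) as Pk. assert (0 < / INR (S k)) by (apply Rinv_0_lt_compat; lra).
    unfold rootk. set (y := psup I F Sg (p * S k + k)).
    assert (Py : 0 <= y) by (apply psup_nonneg, HF).
    rewrite hpow_hpow by exact Py.
    apply Rle_trans with (hpow (hpow y (al + be)) (/ INR (S k))).
    + apply hpow_mono; [|lra]. split; [apply psup_nonneg, HF|].
      eapply Rle_trans; [apply (psup_Sab I F al be _ _ k HF Ha Hb Hab HP)|].
      apply hpow_mono; [|lra]. split; [apply psup_nonneg, HF|].
      apply (psup_prodset I F Sg M p k HF HS).
    + right. rewrite hpow_hpow by exact Py. f_equal.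
      replace (S (p * S k + k)) with (S p * S k)%nat by lia. rewrite mult_INR. field. lra.
Qed.

Lemma growth_rate_nonneg I F Sg M : size_functional I F -> bounded_set I Sg M ->
  0 <= growth_rate I F Sg.
Proof. intros HF HS. eapply LimSup_nonneg. intros k. apply (root_bounds I F Sg M k HF HS). Qed.

(** Collects what the theorem needs about [r], so that only arithmetic of exponents remains. *)
Lemma rate_properties I al be Sg M (r : idx -> matset -> R) : r = gsr \/ r = jsr ->
  0 <= al -> 0 <= be -> 1 <= al + be -> bounded_set I Sg M ->
  0 <= r I Sg /\
  (forall p, 0 <= r I (Sab al be (prodset I Sg p))) /\
  (forall p, r I (Sab al be (prodset I Sg p)) <= hpow (r I (Sab al be (prodset I Sg (S (p + p))))) (/ 2)) /\
  (forall p, r I (Sab al be (prodset I Sg p)) <= hpow (r I Sg) (INR (S p) * (al + be))).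
Proof.
  intros Hr Ha Hb Hab HS.
  assert (HP : forall p, bounded_set I (Sab al be (prodset I Sg p))
     (hpow (M ^ S p) al * hpow (M ^ S p) be)).
  { intros p. apply Sab_bounded; auto. apply prodset_bounded, HS. }
  destruct Hr as [-> | ->].
  - pose proof (specrad_size I) as HF. repeat split.
    + apply (growth_rate_nonneg I _ Sg M HF HS).
    + intros p. apply (growth_rate_nonneg I _ _ _ HF (HP p)).
    + intros p. apply (gsr_Sab_double I al be Sg M p Ha Hb Hab HS).
    + intros p. apply (growth_rate_Sab I _ al be Sg M p HF Ha Hb Hab HS).
  - pose proof (opnorm_size I) as HF. rewrite (proj1 (jsr_fekete I Sg M HS)).
    split; [apply (growth_rate_nonneg I _ Sg M HF HS)|].
    split; [|split]; intros p.
    + rewrite (proj1 (jsr_fekete I _ _ (HP p))). apply (growth_rate_nonneg I _ _ _ HF (HP p)).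
    + apply (jsr_Sab_double I al be Sg M p Ha Hb Hab HS).
    + rewrite (proj1 (jsr_fekete I _ _ (HP p))).
      apply (growth_rate_Sab I _ al be Sg M p HF Ha Hb Hab HS).
Qed.

Theorem theorem4p3 (I : idx) (HI : I <> Some 0%nat) (Psi : matset)
  (Hnn : forall a, Psi a -> nonneg_mat I a)
  (Hop : forall a, Psi a -> defines_op I a)
  (Hbd : exists M, forall a, Psi a -> opnorm I a <= M)
  (r : idx -> matset -> R) (Hr : r = gsr \/ r = jsr)
  (alpha beta : R) (Ha : 0 <= alpha) (Hb : 0 <= beta) (Hab : 1 <= alpha + beta) :
  let rn := fun n : nat =>
    rootk (r I (Sab alpha beta (mpowset I Psi (2 ^ n)))) (2 ^ n) in
  r I (Sab alpha beta Psi) = rn 0%nat /\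
  (forall n, rn n <= rn (S n)) /\
  (forall n, rn n <= hpow (r I Psi) (alpha + beta)).
Proof.
  intros rn.
  assert (HS : exists M, bounded_set I Psi M).
  (* For empty [Psi] the given [M] may be negative. *)
  { destruct Hbd as [M HM]. exists (Rmax 0 M). split; [apply Rmax_l|]. intros a A.
    destruct (zero_ext_bounded I a (Hnn a A) (Hop a A)) as [C HC].
    apply (op_bound_weaken _ (opnorm I a)); [apply (opnorm_op_bound I a C HC)|].
    eapply Rle_trans; [apply (HM a A)|apply Rmax_r]. }
  destruct HS as [M HS].
  destruct (rate_properties I alpha beta Psi M r Hr Ha Hb Hab HS) as (P0 & P1 & P2 & P3).
  assert (E2 : forall n, S (Nat.pred (2 ^ n)) = (2 ^ n)%nat).
  { intros n. apply Nat.succ_pred. apply Nat.pow_nonzero. lia. }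
  assert (I2 : forall n, 0 < INR (2 ^ n)).
  { intros n. rewrite <- E2. apply INR_S_pos. }
  unfold rn, mpowset. split; [|split].
  - unfold rootk. simpl. rewrite Rinv_1, hpow_1_r; [reflexivity|]. apply (P1 O).
  (* With [p + 1 = 2^n], the index [S (p + p)] stands for the exponent [2^(n+1)]. Taking [2^n]-th
     roots turns the exponent [1/2] into [2^-(n+1)]. *)
  - intros n. specialize (P2 (Nat.pred (2 ^ n))).
    replace (S (Nat.pred (2 ^ n) + Nat.pred (2 ^ n))) with (Nat.pred (2 ^ S n)) in P2
      by (specialize (E2 n); simpl; lia).
    unfold rootk.
    apply Rle_trans with (hpow (hpow (r I (Sab alpha beta (prodset I Psi (Nat.pred (2 ^ S n))))) (/ 2))
      (/ INR (2 ^ n))).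
    + apply hpow_mono; [split; [apply P1|exact P2]|]. apply Rlt_le, Rinv_0_lt_compat, I2.
    + right. rewrite hpow_hpow by apply P1. f_equal.
      rewrite Nat.pow_succ_r', mult_INR. specialize (I2 n). simpl (INR 2). field. lra.
  - intros n. specialize (P3 (Nat.pred (2 ^ n))). rewrite E2 in P3. unfold rootk.
    apply Rle_trans with (hpow (hpow (r I Psi) (INR (2 ^ n) * (alpha + beta))) (/ INR (2 ^ n))).
    + apply hpow_mono; [split; [apply P1|exact P3]|]. apply Rlt_le, Rinv_0_lt_compat, I2.
    + right. rewrite hpow_hpow by exact P0. f_equal. specialize (I2 n). field. lra.
Qed.
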